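(* Let $A\in M_d(\mathbb C)^g$ and $B\in M_e(\mathbb C)^{\tilde g}$, assume that $\mathcal D_A$ is bounded and that $p=(p^1,\dots,p^{\tilde g}):\mathcal D_A\to\mathcal D_B$ satisfies $p(0)=0$. Let $G(x)=\Lambda_B(p(x))=\sum_{t=1}^{\tilde g}B_tp^t(x)$. If $p$ is either a free rational function or a free function analytic and bounded on a free pseudoconvex set $\mathcal G_Q$ containing $\mathcal D_A$, then there exist a Hilbert space $H$, a formal power series $W=\sum_\alpha W_\alpha\alpha$ with coefficients $W_\alpha:\mathbb C^e\to H\otimes\mathbb C^d$, a unitary $C:H\otimes\mathbb C^d\to H\otimes\mathbb C^d$ and an isometry $\mathscr W:\mathbb C^e\to H\otimes\mathbb C^d$ such that $L_B(p(x))=I+G(x)+G(x)^*$ and $$I+G(x)+G(x)^*=W(x)^*L_{I_H\otimes A}(x)W(x)\qquad( * )$$ holds in the ring of $e\times e$ matrices over formal power series in $x,x^*$, and there is a $\tau>0$ such that $( * )$ holds at each $X\in\Delta_\tau$. Moreover, letting $\mathbf A_j=I_H\otimes A_j$ and $R_j=(C-I)\mathbf A_j$, $$G(x)=\mathscr W^*C\Big(\sum_{j=1}^g\mathbf A_jx_j\Big)W(x),\qquad W(x)=\Big(I-\sum_{j=1}^gR_jx_j\Big)^{-1}\mathscr W,$$ and the coefficients of $G$ satisfy $G_{x_j\alpha}=\mathscr W^*C\mathbf A_jR^\alpha\mathscr W$ for all words $\alpha$ and $1\le j\le g$.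
   Context: For a tuple $A=(A_1,\dots,A_g)$ of operators on a Hilbert space, $\Lambda_A(x)=\sum_jA_jx_j$ and $L_A(x)=I+\Lambda_A(x)+\Lambda_A(x)^*$, evaluated at $X\in M_n(\mathbb C)^g$ by $L_A(X)=I+\sum_jA_j\otimes X_j+\sum_jA_j^*\otimes X_j^*$. For $A\in M_d(\mathbb C)^g$, $\mathcal D_A=(\mathcal D_A(n))_n$ with $\mathcal D_A(n)=\{X\in M_n(\mathbb C)^g:L_A(X)\succeq0\}$; it is bounded if there is $N$ with $\|X\|\le N$ for all $n$, $X\in\mathcal D_A(n)$. $I_H\otimes A=(I_H\otimes A_1,\dots,I_H\otimes A_g)$. $p:\mathcal D_A\to\mathcal D_B$ means the domain of $p$ contains $\mathcal D_A$ and $p$ maps $\mathcal D_A$ into $\mathcal D_B$. A free rational function regular at $0$ is an expression $r(x)=c^*(I-\Lambda_E(x))^{-1}b$ with $E\in M_m(\mathbb C)^g$, $b,c\in\mathbb C^m$; a rational mapping $p$ has such entries. A free pseudoconvex set is $\mathcal G_Q=\{X:\|Q(X)\|<1\}$ (over all sizes), where $Q=\sum Q_ww$ is a matrix-valued polynomial in freely noncommuting variables $x_1,\dots,x_g$ (no adjoints) and $Q(X)=\sum Q_w\otimes w(X)$. A free function is a sequence of functions on matrix levels respecting intertwinings (equivalently direct sums and similarities); it is analytic if analytic on each (open) level. Near $0$ it has a power series; write $G=\sum_\alpha G_\alpha\alpha$. A formal power series $f=\sum_\alpha f_\alpha\alpha$ is evaluated as $f(X)=\sum_{N\ge0}\sum_{|\alpha|=N}f_\alpha\otimes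 X^\alpha$ when this converges, where for a word $\alpha=x_{i_1}\cdots x_{i_m}$, $X^\alpha=X_{i_1}\cdots X_{i_m}$, $R^\alpha=R_{i_1}\cdots R_{i_m}$. The spectral radius of $X\in M_n(\mathbb C)^g$ is $\rho(X)=\limsup_N\max\{\|X^\alpha\|^{1/N}:|\alpha|=N\}$ and $\Delta_\tau=\{X:\rho(X)<\tau\}$ (over all sizes). That $( * )$ holds in the ring of formal power series means: with $\mathbf A=I_H\otimes A$, for all words $\alpha,\beta$ and $1\le j,k\le g$, $W_\beta^*\mathbf A_k^*W_{x_j\alpha}+W_{x_k\beta}^*\mathbf A_jW_\alpha+W_{x_k\beta}^*W_{x_j\alpha}=0$, $W_\emptyset^*(\mathbf A_kW_\alpha+W_{x_k\alpha})=G_{x_k\alpha}$, and $W_\emptyset^*W_\emptyset=I$. *)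

(* Defs.v *)
From HB Require Import structures.
From mathcomp Require Import all_boot all_order all_algebra.
From mathcomp Require Import sesquilinear spectral.
From mathcomp Require Import complex mxtens.
From mathcomp Require Import mathcomp_extra boolp classical_sets functions.
From mathcomp Require Import reals topology normedtype sequences exp.

Set Implicit Arguments.
Unset Strict Implicit.
Unset Printing Implicit Defensive.

Import Order.TTheory GRing.Theory Num.Theory.
Import numFieldNormedType.Exports.

Local Open Scope classical_set_scope.
Local Open Scope sesquilinear_scope.
Local Open Scope ring_scope.

Notation word g := (seq 'I_g).

Section Matrices.
Context {R : realType}.
Local Notation C := R[i].

Definition l2norm {n : nat} (v : 'cV[C]_n) : R :=
  Num.sqrt (\sum_i (complex.Re `|v i 0|) ^+ 2).

Definition opnorm {m n : nat} (M : 'M[C]_(m, n)) : R :=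
  sup [set l2norm (M *m v) | v in [set v : 'cV[C]_n | l2norm v <= 1]].

(* Over R[i], 0 <= z also says that z is real, so this forces M to be
   Hermitian. *)
Definition psdmx {n : nat} (M : 'M[C]_n) : Prop :=
  forall v : 'cV[C]_n, 0 <= (v^t* *m M *m v) 0 0.

Definition mxtuple (g n : nat) := 'I_g -> 'M[C]_n.

Definition tnorm {g n : nat} (X : mxtuple g n) : R :=
  \big[Num.max/0]_(j < g) opnorm (X j).

Definition mxword {g n : nat} (X : mxtuple g n) (w : word g) : 'M[C]_n :=
  \prod_(j <- w) X j.

Definition spectral_radius {g n : nat} (X : mxtuple g n) : R :=
  limn_sup (fun N : nat => \big[Num.max/0]_(w : N.-tuple 'I_g)
                             (opnorm (mxword X w) `^ (N%:R^-1))).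

Definition linear_pencil {g d n : nat} (A : mxtuple g d) (X : mxtuple g n) :
    'M[C]_(d * n) :=
  \sum_(j < g) A j *t X j.

Definition monic_pencil {g d n : nat} (A : mxtuple g d) (X : mxtuple g n) :
    'M[C]_(d * n) :=
  1%:M + \sum_(j < g) A j *t X j + \sum_(j < g) (A j)^t* *t (X j)^t*.

End Matrices.

Section FreeSets.
Context {R : realType}.
Local Notation C := R[i].

Definition free_set (g : nat) := forall n : nat, set (@mxtuple R g n).

Definition free_subset {g : nat} (D D' : free_set g) : Prop :=
  forall n : nat, D n `<=` D' n.

Definition free_spectrahedron {g d : nat} (A : @mxtuple R g d) : free_set g :=
  fun n => [set X | psdmx (monic_pencil A X)].

Definition free_bounded {g : nat} (D : free_set g) : Prop :=
  exists N : R, forall (n : nat) (X : mxtuple g n), D n X -> tnorm X <= N.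

(* The polynomial \sum_(|w| < N) Q_w w; the values of Q on longer words are
   ignored. *)
Definition mxpoly_eval {g s r n : nat} (N : nat) (Q : word g -> 'M[C]_(s, r))
    (X : mxtuple g n) : 'M[C]_(s * n, r * n) :=
  \sum_(k < N) \sum_(w : k.-tuple 'I_g) Q w *t mxword X w.

Definition pseudoconvex_set {g s r : nat} (N : nat)
    (Q : word g -> 'M[C]_(s, r)) : free_set g :=
  fun n => [set X | opnorm (mxpoly_eval N Q X) < 1].

End FreeSets.

Section FreeFunctions.
Context {R : realType}.
Local Notation C := R[i].

(* Total functions; only the values on the relevant free set matter. *)
Definition graded_fun (g : nat) := forall n : nat, @mxtuple R g n -> 'M[C]_n.
Definition graded_map (g h : nat) :=
  forall n : nat, @mxtuple R g n -> @mxtuple R h n.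

Definition component {g h : nat} (p : graded_map g h) (t : 'I_h) :
    graded_fun g :=
  fun n X => p n X t.

Definition maps_into {g h : nat} (p : graded_map g h)
    (D : free_set g) (D' : free_set h) : Prop :=
  forall (n : nat) (X : mxtuple g n), D n X -> D' n (p n X).

(* c^* (I - \Lambda_E(x))^{-1} b *)
Definition rational_domain {g m : nat} (E : @mxtuple R g m) : free_set g :=
  fun n => [set X | (1%:M - linear_pencil E X) \in unitmx].

Definition rational_eval {g m : nat} (E : @mxtuple R g m) (b c : 'cV[C]_m) :
    graded_fun g :=
  fun n X => castmx (mul1n n, mul1n n)
    ((c^t* *t (1%:M : 'M[C]_n)) *m invmx (1%:M - linear_pencil E X)
       *m (b *t (1%:M : 'M[C]_n))).

Definition rational_on {g : nat} (D : free_set g) (f : graded_fun g) : Prop :=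
  exists (m : nat) (E : @mxtuple R g m) (b c : 'cV[C]_m),
    free_subset D (rational_domain E) /\
    forall (n : nat) (X : mxtuple g n),
      rational_domain E X -> f n X = rational_eval E b c X.

Definition respects_intertwinings {g : nat} (D : free_set g)
    (f : graded_fun g) : Prop :=
  forall (m n : nat) (X : mxtuple g m) (Y : mxtuple g n) (S : 'M[C]_(m, n)),
    D m X -> D n Y ->
    (forall j, X j *m S = S *m Y j) -> f m X *m S = S *m f n Y.

(* f is analytic in the g * n * n matrix entries of X: it is the sum of an
   absolutely convergent power series on a polydisc centered at X. *)
Definition analytic_at {g n : nat} (f : @mxtuple R g n -> C)
    (X : mxtuple g n) : Prop :=
  exists (r : R) (c : {ffun 'I_g * 'I_n * 'I_n -> nat} -> C),
    let coord (Z : mxtuple g n) (i : 'I_g * 'I_n * 'I_n) :=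
      Z i.1.1 i.1.2 i.2 in
    [/\ 0 < r,
        exists M : R, forall N : nat,
          \sum_(mu : {ffun 'I_g * 'I_n * 'I_n -> 'I_N})
             complex.Re `|c [ffun i => mu i : nat]| * r ^+ (\sum_i mu i)%N
          <= M
      & forall Y : mxtuple g n,
          (forall i, complex.Re `|coord Y i - coord X i| < r) ->
          ((fun N : nat =>
             \sum_(mu : {ffun 'I_g * 'I_n * 'I_n -> 'I_N})
                c [ffun i => mu i : nat] *
                \prod_i (coord Y i - coord X i) ^+ mu i) : nat -> C^o)
            @ \oo --> (f Y : C^o)].

Definition free_analytic {g : nat} (D : free_set g) (f : graded_fun g) : Prop :=
  respects_intertwinings D f /\
  forall (n : nat) (X : mxtuple g n), D n X ->
    forall a b : 'I_n, analytic_at (fun Y => f n Y a b) X.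

Definition bounded_on {g h : nat} (D : free_set g) (p : graded_map g h) : Prop :=
  exists M : R, forall (n : nat) (X : mxtuple g n), D n X -> tnorm (p n X) <= M.

(* The neighborhood of 0 has the same radius at all matrix sizes; that all
   sizes are included makes the coefficients unique. *)
Definition power_series_at0 {g : nat} (f : graded_fun g) (a : word g -> C) :
    Prop :=
  exists eps : R, 0 < eps /\
    forall (n : nat) (X : mxtuple g n), tnorm X < eps ->
      ((fun N : nat => \sum_(k < N) \sum_(w : k.-tuple 'I_g) a w *: mxword X w)
         : nat -> 'M[C^o]_n) @ \oo --> (f n X : 'M[C^o]_n).

End FreeFunctions.

Section Hilbert.
Context {R : realType}.
Local Notation C := R[i].

(* The inner product is linear in the first variable. *)
Record hilbertType := HilbertType {
  hilbert_sort :> completeNormedModType C;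
  hdot : {dot hilbert_sort for Num.conj};
  hdotE : forall u : hilbert_sort, hdot u u = `|u| ^+ 2 }.

(* {ffun 'I_k -> H} stands for the Hilbert space H \otimes C^k, the tensor
   h \otimes v being [ffun i => v i 0 *: h]; 'I_(d * n) is the index set of
   C^d \otimes C^n, ordered as in *t. *)
Definition tdot {H : hilbertType} {k : nat} (u v : {ffun 'I_k -> H}) : C :=
  \sum_i hdot H (u i) (v i).

Definition cdot {m : nat} (u v : 'cV[C]_m) : C :=
  \sum_i u i 0 * (v i 0)^*.

(* I_H \otimes M *)
Definition ampl {H : hilbertType} {m n : nat} (M : 'M[C]_(m, n))
    (u : {ffun 'I_n -> H}) : {ffun 'I_m -> H} :=
  [ffun i => \sum_j M i j *: u j].

Definition hadj {H : hilbertType} {m k : nat} (T : 'cV[C]_m -> {ffun 'I_k -> H})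
    (u : {ffun 'I_k -> H}) : 'cV[C]_m :=
  \col_i tdot u (T (delta_mx i 0)).

Lemma hadjP {H : hilbertType} {m k : nat}
    (T : {linear 'cV[C]_m -> {ffun 'I_k -> H}}) (u : {ffun 'I_k -> H})
    (v : 'cV[C]_m) :
  cdot (hadj T u) v = tdot u (T v).
Proof.
have -> : v = \sum_i v i 0 *: delta_mx i 0.
  rewrite [LHS]matrix_sum_delta; apply: eq_bigr => i _.
  by rewrite big_ord1.
rewrite linear_sum /cdot /tdot.
under [RHS]eq_bigr => j _.
  rewrite sum_ffunE linear_sumr.
  under eq_bigr => i _ do rewrite linearZ ffunE linearZr_LR /=.
  over.
rewrite exchange_big /=; apply: eq_bigr => i _.
rewrite -mulr_sumr mulrC mxE; congr (_ * _).
rewrite summxE (bigD1 i) //= big1 ?addr0; last first.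
  by move=> j ji; rewrite !mxE eq_sym (negbTE ji) mulr0.
by rewrite !mxE !eqxx mulr1.
Qed.

Definition unitary_op {H : hilbertType} {k : nat}
    (U : {ffun 'I_k -> H} -> {ffun 'I_k -> H}) : Prop :=
  (forall u v, tdot (U u) (U v) = tdot u v) /\ (forall w, exists u, U u = w).

Definition isometry_op {H : hilbertType} {m k : nat}
    (T : 'cV[C]_m -> {ffun 'I_k -> H}) : Prop :=
  forall v, tdot (T v) (T v) = cdot v v.

(* T \otimes M : C^e \otimes C^n -> (H \otimes C^d) \otimes C^n *)
Definition htens {H : hilbertType} {e d n : nat}
    (T : 'cV[C]_e -> {ffun 'I_d -> H}) (M : 'M[C]_n)
    (v : 'cV[C]_(e * n)) : {ffun 'I_(d * n) -> H} :=
  [ffun k => \sum_(j < n) M (mxtens_unindex k).2 j *: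
     T (\col_(b < e) v (mxtens_index (b, j)) 0) (mxtens_unindex k).1].

(* L_{I_H \otimes A}(X) on H \otimes C^d \otimes C^n *)
Definition ampl_pencil (H : hilbertType) {g d n : nat} (A : @mxtuple R g d)
    (X : mxtuple g n) (u : {ffun 'I_(d * n) -> H}) : {ffun 'I_(d * n) -> H} :=
  u + \sum_(j < g) ampl (A j *t X j) u
    + \sum_(j < g) ampl ((A j)^t* *t (X j)^t*) u.

End Hilbert.
Arguments hilbertType R : clear implicits.

Section FormalSeries.
Context {R : realType}.
Local Notation C := R[i].
Context {g : nat}.

(* Formal power series in x whose coefficients are maps V -> V'. *)
Definition opseries (V V' : zmodType) := word g -> V -> V'.

Definition ser_const {V V' : zmodType} (T : V -> V') : opseries V V' :=
  fun w v => if w is [::] then T v else 0.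

Definition ser_linear {V V' : zmodType} (T : 'I_g -> V -> V') : opseries V V' :=
  fun w v => if w is [:: j] then T j v else 0.

Definition ser_sub {V V' : zmodType} (F F' : opseries V V') : opseries V V' :=
  fun w v => F w v - F' w v.

Definition ser_mul {V V' V'' : zmodType} (F : opseries V' V'')
    (F' : opseries V V') : opseries V V'' :=
  fun w v => \sum_(i < (size w).+1) F (take i w) (F' (drop i w) v).

Definition ser_inverse {V : zmodType} (F F' : opseries V V) : Prop :=
  ser_mul F F' =2 ser_const id /\ ser_mul F' F =2 ser_const id.

Definition opword {V : Type} (T : 'I_g -> V -> V) (w : word g) (v : V) : V :=
  foldr T v w.

(* Words in x and x^*: inl j is x_j and inr j is x_j^*. *)
Notation xword := (seq ('I_g + 'I_g)).

Definition xstar (w : xword) : xword :=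
  rev [seq (if l is inl j then inr j else
            if l is inr j then inl j else l) | l <- w].

(* A series in x seen as a series in x and x^*. *)
Definition xseries {V : zmodType} (f : word g -> V) : xword -> V :=
  fun w =>
    let a := pmap (fun l : 'I_g + 'I_g => if l is inl j then Some j else None) w
    in if size a == size w then f a else 0.

(* I + F + F^* *)
Definition ser_hermitian {e : nat} (F : word g -> 'M[C]_e) : xword -> 'M[C]_e :=
  fun w => (if w is [::] then 1%:M else 0)
           + xseries F w + (xseries F (xstar w))^t*.

(* L_B(f) for a tuple f of scalar series *)
Definition ser_pencil {h e : nat} (B : @mxtuple R h e)
    (f : 'I_h -> word g -> C) : xword -> 'M[C]_e :=
  fun w => (if w is [::] then 1%:M else 0)
           + \sum_(t < h) xseries (f t) w *: B t
           + \sum_(t < h) (xseries (f t) (xstar w))^* *: (B t)^t*.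

(* I + G + G^* = W^* L_{I_H \otimes A} W, by comparing the coefficients of the
   words \beta^* x_k^* x_j \alpha, x_k \alpha and 1. *)
Definition formal_identity {H : hilbertType R} {d e : nat} (A : @mxtuple R g d)
    (G : word g -> 'M[C]_e) (W : word g -> 'cV[C]_e -> {ffun 'I_d -> H}) :
    Prop :=
  [/\ forall (alpha beta : word g) (j k : 'I_g) (v : 'cV[C]_e),
        hadj (W beta) (ampl ((A k)^t*) (W (j :: alpha) v))
        + hadj (W (k :: beta)) (ampl (A j) (W alpha v))
        + hadj (W (k :: beta)) (W (j :: alpha) v) = 0,
      forall (alpha : word g) (k : 'I_g) (v : 'cV[C]_e),
        hadj (W [::]) (ampl (A k) (W alpha v) + W (k :: alpha) v)
        = G (k :: alpha) *m v
    & forall v : 'cV[C]_e, hadj (W [::]) (W [::] v) = v].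

Definition converges_mx {e n : nat} (G : word g -> 'M[C]_e) (X : mxtuple g n)
    (GX : 'M[C]_(e * n)) : Prop :=
  ((fun N : nat => \sum_(k < N) \sum_(w : k.-tuple 'I_g) G w *t mxword X w)
     : nat -> 'M[C^o]_(e * n)) @ \oo --> (GX : 'M[C^o]_(e * n)).

(* As C^e \otimes C^n has finite dimension and the target is a finite power of
   H, norm convergence is convergence of the entries at every vector. *)
Definition converges_op {H : hilbertType R} {d e n : nat}
    (W : word g -> 'cV[C]_e -> {ffun 'I_d -> H}) (X : mxtuple g n)
    (WX : 'cV[C]_(e * n) -> {ffun 'I_(d * n) -> H}) : Prop :=
  forall (v : 'cV[C]_(e * n)) (i : 'I_(d * n)),
    (fun N : nat =>
       (\sum_(k < N) \sum_(w : k.-tuple 'I_g) htens (W w) (mxword X w) v) i)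
      @ \oo --> WX v i.

Definition identity_at {H : hilbertType R} {d e n : nat} (A : @mxtuple R g d)
    (G : word g -> 'M[C]_e) (W : word g -> 'cV[C]_e -> {ffun 'I_d -> H})
    (X : mxtuple g n) : Prop :=
  exists (GX : 'M[C]_(e * n))
         (WX : {linear 'cV[C]_(e * n) -> {ffun 'I_(d * n) -> H}}),
    [/\ converges_mx G X GX, converges_op W X WX
      & forall v : 'cV[C]_(e * n),
          (1%:M + GX + GX^t*) *m v = hadj WX (ampl_pencil A X (WX v))].

End FormalSeries.

(* Main.v *)
(* A free function is determined on nilpotent points by a formal power series, by
   intertwining with the truncated shift on Fock space, and intertwining with a
   shift bordered by one eigenvalue shows that the series converges near 0.

   On the nilpotent points of D_A of order N, positivity of I + G + G^* yields by
   cone duality a Gram matrix of vectors w_u, |u| <= N, that satisfy the factorization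
   I + G + G^* = W^* L_A W up to order N; boundedness of D_A enters as a state rho with
   tr (A_j rho) = 0.
   The lurking isometry argument turns these vectors into a finite-dimensional
   unitary U_N and isometry V_N realizing the coefficients of G up to order N.
   The ultraproduct of these realizations along a free ultrafilter on N realizes
   all coefficients at once, and the remaining assertions are consequences of
   G_{jw} = V^* U A_j R^w V and W_w = R^w V. *)
Require Import Defs.
From HB Require Import structures.
From mathcomp Require Import all_boot all_order all_algebra.
From mathcomp Require Import sesquilinear spectral ring_quotient generic_quotient.
From mathcomp Require Import complex mxtens.
From mathcomp Require Import mathcomp_extra boolp classical_sets functions.
From mathcomp Require Import reals topology normedtype sequences exp.
From mathcomp Require Import ring lra.

Set Implicit Arguments.
Unset Strict Implicit.
Unset Printing Implicit Defensive.

Import Order.TTheory GRing.Theory Num.Theory.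
Import numFieldNormedType.Exports.
Local Open Scope classical_set_scope.
Local Open Scope sesquilinear_scope.
Local Open Scope ring_scope.

(** * Completion of a pre-Hilbert space *)

(** At a nilpotent point [p X] is a polynomial in [X], so [p_maps] gives positivity there without
    any convergence. Conjugating the scaled shift by an invertible [S] again gives a nilpotent
    tuple, and this makes duality work: a positive definite functional on matrices over Fock space
    has a density [S^* S]. Its nonnegativity on the cone of values [W^* L_A W] says that the
    conjugated shift lies in the spectrahedron, and its value at the target is a value of the form
    of [I + G + G^*] at that point. Separation is obtained from nearest points. Compactness comes
    from the scaled shift: its pencil is at least 1/2, so fixing the trace of the image bounds the
    trace of the preimage. The certificates for different N are unrelated: their dimensions grow and
    [U_N] need not extend its predecessors. An ultraproduct asks for no compatibility, since inner
    products are bounded scalars with a limit along the ultrafilter, and each coefficient of G is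
    correct from some N on. *)

Module PreHilbert.
Section PreHilbert.
Context {R : realType} {V : lmodType R[i]}.
Local Notation C := R[i].
Variable f : V -> V -> C.
Hypothesis f_lin : forall a u v w, f (a *: u + v) w = a * f u w + f v w.
Hypothesis f_sym : forall u v, f u v = (f v u)^*.
Hypothesis f_ge0 : forall u, 0 <= f u u.

Lemma form0l u : f 0 u = 0.
Proof. by have := f_lin (-1) 0 0 u; rewrite scaler0 addr0 mulN1r addNr. Qed.

Lemma formDl u v w : f (u + v) w = f u w + f v w.
Proof. by rewrite -[u]scale1r f_lin mul1r scale1r. Qed.

Lemma formZl a u w : f (a *: u) w = a * f u w.
Proof. by rewrite -[a *: u]addr0 f_lin form0l addr0. Qed.

Lemma formBl u v w : f (u - v) w = f u w - f v w.
Proof. by rewrite formDl -scaleN1r formZl mulN1r. Qed.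

Lemma form0r u : f u 0 = 0.
Proof. by rewrite f_sym form0l conjC0. Qed.

Lemma formDr u v w : f w (u + v) = f w u + f w v.
Proof. by rewrite f_sym formDl rmorphD /= -!f_sym. Qed.

Lemma formZr a u w : f w (a *: u) = a^* * f w u.
Proof. by rewrite f_sym formZl rmorphM /= -f_sym. Qed.

Lemma formBr u v w : f w (u - v) = f w u - f w v.
Proof. by rewrite f_sym formBl rmorphB /= -!f_sym. Qed.

Lemma form_real u : (f u u)^* = f u u.
Proof. by rewrite -f_sym. Qed.

Lemma cauchy_schwarz u v : `|f u v| ^+ 2 <= f u u * f v v.
Proof.
have key x y : f y y > 0 -> `|f x y| ^+ 2 <= f x x * f y y.
  move=> y0; have := f_ge0 (f y y *: x - f x y *: y).
  rewrite formBl !formBr !formZl !formZr form_real.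
  rewrite [f y x]f_sym normCK; move: (f x y) (f y y) (f x x) y0 => b a c a0.
  have -> : a * (a * c) - a * (b^* * b) - (b * (a * b^*) - b * (b^* * a))
    = a * (c * a - b * b^*) by ring.
  by rewrite pmulr_rge0// subr_ge0.
have := f_ge0 v; rewrite le_eqVlt => /predU1P[v0|v0]; last exact: key.
have := f_ge0 u; rewrite le_eqVlt => /predU1P[u0|u0]; last first.
  by rewrite f_sym norm_conjC mulrC key.
(* Both vectors are null here, so the square expands to [-2 |f u v|^2], which has to be
   nonnegative. *)
have := f_ge0 (u - f u v *: v).
rewrite formBl !formBr !formZl !formZr -v0 -u0 !mulr0 subr0 sub0r.
rewrite [f v u]f_sym normCK [_^* * _]mulrC -opprD oppr_ge0 => h.
by apply: le_trans h; rewrite lerDl mul_conjC_ge0.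
Qed.

(** The form is only semidefinite. By Cauchy-Schwarz its isotropic vectors form the radical, hence a
    subspace. *)
Definition null : {pred V} := [pred v | f v v == 0].

Lemma null_l u v : u \in null -> f u v = 0.
Proof.
rewrite inE => /eqP u0; have := cauchy_schwarz u v.
rewrite u0 mul0r => h; apply/eqP; rewrite -normr_eq0 -sqrf_eq0 eq_le h.
by rewrite exprn_ge0.
Qed.

Lemma null_r u v : v \in null -> f u v = 0.
Proof. by move=> v0; rewrite f_sym null_l// conjC0. Qed.

Lemma null_zmod : zmod_closed null.
Proof.
split; first by rewrite inE form0l.
by move=> u v u0 v0; rewrite inE formBl null_l// formBr null_r// null_l// subrr subr0.
Qed.

HB.instance Definition _ := GRing.isZmodClosed.Build V null null_zmod.

Definition quot : Type := Quotient.quot null.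
HB.instance Definition _ := GRing.Zmodule.on quot.

Definition class (v : V) : quot := (\pi_(Quotient.quot null) v)%qT.
Definition rep (q : quot) : V := repr (q : Quotient.quot null).

Lemma repK q : class (rep q) = q.
Proof. exact: reprK. Qed.

Lemma classP u v : class u = class v <-> u - v \in null.
Proof.
by rewrite -Quotient.equivE; split; [move/eqmodP|move=> ?; apply/eqmodP].
Qed.

Lemma classD u v : class (u + v) = class u + class v.
Proof. by rewrite /class !piE. Qed.

Lemma rep_null v : rep (class v) - v \in null.
Proof. by apply/classP; rewrite repK. Qed.

Definition qscale (a : C) (q : quot) : quot := class (a *: rep q).

Lemma null_scale a v : v \in null -> a *: v \in null.
Proof. by move=> v0; rewrite inE formZl null_l// mulr0. Qed.

Lemma qscale_class a v : qscale a (class v) = class (a *: v).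
Proof. by apply/classP; rewrite -scalerBr null_scale// rep_null. Qed.

Lemma qscaleA a b q : qscale a (qscale b q) = qscale (a * b) q.
Proof. by rewrite -[q]repK !qscale_class scalerA. Qed.
Lemma qscale1 : left_id 1 qscale.
Proof. by move=> q; rewrite -[q]repK qscale_class scale1r. Qed.
Lemma qscaleDr : right_distributive qscale +%R.
Proof.
by move=> a p q; rewrite -[p]repK -[q]repK -classD !qscale_class scalerDr classD.
Qed.
Lemma qscaleDl q : {morph qscale^~ q : a b / a + b}.
Proof. by move=> a b; rewrite -[q]repK !qscale_class scalerDl classD. Qed.

HB.instance Definition _ :=
  GRing.Zmodule_isLmodule.Build C quot qscaleA qscale1 qscaleDr qscaleDl.

Lemma class_is_linear : linear class.
Proof. by move=> a u v; rewrite classD -qscale_class. Qed.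
HB.instance Definition _ := GRing.isLinear.Build C V quot _ class class_is_linear.

Definition qdot (p q : quot) : C := f (rep p) (rep q).

Lemma qdot_class u v : qdot (class u) (class v) = f u v.
Proof.
rewrite /qdot -[rep (class u)](subrK u) -[rep (class v)](subrK v).
by rewrite formDl [f (_ - u) _]null_l ?rep_null// add0r formDr null_r ?rep_null// add0r.
Qed.

Lemma qdot_linear w : scalar (qdot^~ w).
Proof.
move=> a u v; rewrite -[u]repK -[v]repK -[w]repK -linearP !qdot_class.
exact: f_lin.
Qed.

Lemma qdot_sym u v : qdot u v = (qdot v u)^*.
Proof. exact: f_sym. Qed.

Lemma qdot_eq0 u : qdot u u = 0 -> u = 0.
Proof.
move=> u0; rewrite -[u]repK -(linear0 class); apply/classP.
by rewrite subr0 inE; apply/eqP.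
Qed.

Lemma qdot_gt0 u : u != 0 -> 0 < qdot u u.
Proof.
by move=> u0; rewrite lt_neqAle f_ge0 andbT eq_sym; apply: contra u0 => /eqP/qdot_eq0->.
Qed.

Definition qnorm (q : quot) : C := sqrtC (qdot q q).

Lemma qnorm_sqr q : qnorm q ^+ 2 = qdot q q.
Proof. exact: sqrtCK. Qed.
Lemma qnorm_ge0 q : 0 <= qnorm q.
Proof. by rewrite sqrtC_ge0 f_ge0. Qed.

Lemma qnormZ a q : qnorm (a *: q) = `|a| * qnorm q.
Proof.
apply/eqP; rewrite -(@eqrXn2 _ 2)// ?mulr_ge0 ?qnorm_ge0// exprMn !qnorm_sqr.
by rewrite -[q]repK -linearZ !qdot_class formZl formZr mulrA normCK.
Qed.

Lemma qnormD p q : qnorm (p + q) <= qnorm p + qnorm q.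
Proof.
rewrite -(@ler_pXn2r _ 2)// ?nnegrE ?addr_ge0 ?qnorm_ge0//.
rewrite sqrrD !qnorm_sqr -[p]repK -[q]repK -linearD !qdot_class.
set u := rep p; set v := rep q.
rewrite formDl !formDr [f v u]f_sym addrA -[_ + f u v + _]addrA.
rewrite lerD2r// lerD2l//.
have le1 : `|f u v| <= qnorm (class u) * qnorm (class v).
  rewrite -(@ler_pXn2r _ 2)// ?nnegrE ?mulr_ge0 ?qnorm_ge0//.
  by rewrite exprMn !qnorm_sqr !qdot_class cauchy_schwarz.
apply: le_trans (lerD le1 le1).
rewrite -[X in _ <= _ + X]norm_conjC; apply: le_trans (ler_normD _ _).
apply: real_ler_norm.
by rewrite CrealE rmorphD /= conjCK addrC.
Qed.

Lemma qnorm_eq0 q : qnorm q = 0 -> q = 0.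
Proof. by move/eqP; rewrite sqrtC_eq0 => /eqP/qdot_eq0. Qed.

HB.instance Definition _ :=
  Lmodule_isNormed.Build C quot qnormD qnormZ qnorm_eq0.

Lemma qnorm_class v : `|class v : quot| ^+ 2 = f v v.
Proof. by rewrite -qdot_class -qnorm_sqr. Qed.

Hypothesis f_complete : forall u : nat -> V,
  (forall k m n, (k <= m)%N -> (k <= n)%N ->
     f (u m - u n) (u m - u n) <= (2%:R^-1 ^+ k) ^+ 2) ->
  exists v, forall k, f (u k - v) (u k - v) <= (2%:R * 2%:R^-1 ^+ k) ^+ 2.

Lemma half_pow_small (eps : C) : 0 < eps -> exists k, 3%:R * 2%:R^-1 ^+ k < eps.
Proof.
move=> eps0; have epsR : eps = (complex.Re eps)%:C%C.
  by rewrite RRe_real// ger0_real// ltW.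
move: eps0; rewrite epsR; set e := complex.Re eps; rewrite ltcR => e0.
exists (Num.bound (3%:R / e)).
set k := Num.bound _.
have hk : 3%:R / e < k%:R by rewrite archi_boundP// divr_ge0// ltW.
have -> : 3%:R * 2%:R^-1 ^+ k = (3%:R * 2%:R^-1 ^+ k : R)%:C%C.
  by rewrite rmorphM rmorphXn fmorphV !rmorph_nat.
rewrite ltcR exprVn ltr_pdivrMr ?exprn_gt0// mulrC -ltr_pdivrMr//.
by apply: lt_le_trans hk _; rewrite -natrX ler_nat ltnW// ltn_expl.
Qed.

(** A Cauchy filter contains balls of radius [r k / 2]; lifts of their centres form a sequence to
    which [f_complete] applies. Points of the ball are within [r k] of its centre, and the centre
    within [2 * r k] of the limit, hence the 3 in [half_pow_small]. *)
Lemma quot_complete (F : set_system quot) : ProperFilter F -> cauchy F -> cvg F.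
Proof.
move=> FF /cauchyP Fc.
pose r k : C := 2%:R^-1 ^+ k.
have r0 k : 0 < r k by rewrite exprn_gt0// invr_gt0.
have /choice[x Hx] : forall k, exists x : quot, F (ball x (r k / 2%:R)).
  by move=> k; apply: Fc; rewrite divr_gt0.
have rle k m : (k <= m)%N -> r m <= r k.
  move=> km; rewrite -(subnK km) /r exprD ler_piMl ?exprn_ge0 ?invr_ge0//.
  by rewrite exprn_ile1 ?invr_ge0// invf_le1// ler1n.
have [u m n um un|v Hv] := @f_complete (rep \o x).
  rewrite /= -qnorm_class linearB /= !repK.
  rewrite ler_pXn2r ?nnegrE// ?ltW// -/(r u).
  have [z [/= z1 z2]] := filter_ex (filterI (Hx m) (Hx n)).
  move: z1 z2; rewrite -!ball_normE /= => z1 z2.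
  rewrite -(subrKA z).
  apply: le_lt_trans (ler_normD _ _) _; rewrite [`|z - _|]distrC.
  have -> : r u = r u / 2%:R + r u / 2%:R by field.
  apply: ltrD; [apply: lt_le_trans z1 _|apply: lt_le_trans z2 _];
  by rewrite ler_pM2r ?invr_gt0// rle.
apply/cvg_ex; exists (class v); apply/cvg_ballP => e e0.
have [k hk] := half_pow_small e0.
apply: filterS (Hx k) => z; rewrite -!ball_normE /= => hz.
rewrite -(subrKA (x k)); apply: le_lt_trans (ler_normD _ _) _.
apply: le_lt_trans hk; rewrite -/(r k).
have -> : 3%:R * r k = 2%:R * r k + r k by ring.
apply: lerD; last first.
  by apply/ltW/(lt_le_trans hz); rewrite ler_piMr ?ltW// invf_lt1// ltr1n.
have := Hv k; rewrite -qnorm_class linearB /= repK => h.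
by rewrite distrC -(@ler_pXn2r _ 2) ?nnegrE ?mulr_ge0// ltW.
Qed.

HB.instance Definition _ := Uniform_isComplete.Build quot quot_complete.

Lemma qdot_bilinear : bilinear_for
  (GRing.Scale.Law.clone _ _ *%R _) (GRing.Scale.Law.clone _ _ (Num.conj \; *%R) _)
  qdot.
Proof.
split=> w a u v; first exact: qdot_linear.
by rewrite qdot_sym qdot_linear rmorphD rmorphM /= -!qdot_sym.
Qed.

HB.instance Definition _ := bilinear_isBilinear.Build C quot quot C
  (GRing.Scale.Law.clone _ _ *%R _) (GRing.Scale.Law.clone _ _ (Num.conj \; *%R) _)
  qdot qdot_bilinear.

Lemma qdot_hermitian u v : qdot u v = (-1) ^+ false * (qdot v u)^*.
Proof. by rewrite expr0 mul1r qdot_sym. Qed.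

HB.instance Definition _ := isHermitianSesquilinear.Build C quot false Num.conj
  qdot qdot_hermitian.

HB.instance Definition _ := isDotProduct.Build C quot qdot qdot_gt0.

(** By [f_complete] the quotient by the null vectors is already complete, so no points are adjoined
    and [pi] is onto: operators can be defined on representatives in [V]. *)
Lemma hilbert_quotient : exists (H : hilbertType R) (pi : {linear V -> H}),
  (forall h, exists v, pi v = h) /\ forall u v, hdot H (pi u) (pi v) = f u v.
Proof.
exists (@HilbertType R quot qdot (fun u => esym (qnorm_sqr u))), class.
by split=> [h|u v]; [exists (rep h); exact: repK|exact: qdot_class].
Qed.

End PreHilbert.
End PreHilbert.

(** * Inner product on column vectors and adjoints of matrices *)

Section Cdot.
Context {R : realType}.
Local Notation C := R[i].
Implicit Types m n k : nat.

Lemma cdot_linear m a (u v w : 'cV[C]_m) :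
  cdot (a *: u + v) w = a * cdot u w + cdot v w.
Proof.
rewrite /cdot mulr_sumr -big_split; apply: eq_bigr => i _.
by rewrite !mxE mulrDl mulrA.
Qed.

Lemma cdot_sym m (u v : 'cV[C]_m) : cdot u v = (cdot v u)^*.
Proof.
rewrite /cdot rmorph_sum; apply: eq_bigr => i _.
by rewrite rmorphM /= conjCK mulrC.
Qed.

Lemma cdot_ge0 m (u : 'cV[C]_m) : 0 <= cdot u u.
Proof. by apply: sumr_ge0 => i _; rewrite mul_conjC_ge0. Qed.

Definition cdotDl m (u v w : 'cV[C]_m) := PreHilbert.formDl (@cdot_linear m) u v w.
Definition cdotBl m (u v w : 'cV[C]_m) := PreHilbert.formBl (@cdot_linear m) u v w.
Definition cdotZl m a (u w : 'cV[C]_m) := PreHilbert.formZl (@cdot_linear m) a u w.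
Definition cdot0l m (u : 'cV[C]_m) := PreHilbert.form0l (@cdot_linear m) u.
Definition cdotDr m (u v w : 'cV[C]_m) :=
  PreHilbert.formDr (@cdot_linear m) (@cdot_sym m) u v w.
Definition cdotBr m (u v w : 'cV[C]_m) :=
  PreHilbert.formBr (@cdot_linear m) (@cdot_sym m) u v w.
Definition cdotZr m a (u w : 'cV[C]_m) :=
  PreHilbert.formZr (@cdot_linear m) (@cdot_sym m) a u w.
Definition cdot0r m (u : 'cV[C]_m) :=
  PreHilbert.form0r (@cdot_linear m) (@cdot_sym m) u.
Definition cdot_cs m (u v : 'cV[C]_m) :=
  PreHilbert.cauchy_schwarz (@cdot_linear m) (@cdot_sym m) (@cdot_ge0 m) u v.

Lemma cdotE m (u v : 'cV[C]_m) : cdot u v = (v^t* *m u) 0 0.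
Proof. by rewrite mxE; apply: eq_bigr => i _; rewrite !mxE mulrC. Qed.

Lemma adjmxM m n k (M : 'M[C]_(m, n)) (N : 'M[C]_(n, k)) :
  (M *m N)^t* = N^t* *m M^t*.
Proof. by rewrite trmx_mul map_mxM. Qed.

Lemma adjmxD m n (M N : 'M[C]_(m, n)) : (M + N)^t* = M^t* + N^t*.
Proof. by rewrite linearD map_mxD. Qed.

Lemma adjmx_sum m n (I : Type) (r : seq I) (P : pred I) (F : I -> 'M[C]_(m, n)) :
  (\sum_(i <- r | P i) F i)^t* = \sum_(i <- r | P i) (F i)^t*.
Proof. by rewrite linear_sum map_mx_sum. Qed.

Lemma adjmx1 m : (1%:M : 'M[C]_m)^t* = 1%:M.
Proof. by rewrite trmx1 map_mx1. Qed.

Lemma adjmxZ m n a (M : 'M[C]_(m, n)) : (a *: M)^t* = a^* *: M^t*.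
Proof. by rewrite linearZ map_mxZ. Qed.

Lemma adjmx_tens m n p q (M : 'M[C]_(m, n)) (N : 'M[C]_(p, q)) :
  (M *t N)^t* = M^t* *t N^t*.
Proof. by rewrite trmx_tens map_mxT. Qed.

Lemma cdot_mulmxl m n (M : 'M[C]_(m, n)) u v :
  cdot (M *m u) v = cdot u (M^t* *m v).
Proof. by rewrite !cdotE adjmxM trmxCK mulmxA. Qed.

Lemma cdot_mulmxr m n (M : 'M[C]_(m, n)) u v :
  cdot u (M *m v) = cdot (M^t* *m u) v.
Proof. by rewrite cdot_mulmxl trmxCK. Qed.

Lemma cdot_eq0 m (u : 'cV[C]_m) : cdot u u = 0 -> u = 0.
Proof.
move/eqP; rewrite psumr_eq0 => [/allP h|i _]; last by rewrite mul_conjC_ge0.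
apply/colP => i; rewrite mxE; apply/eqP.
by have := h i (mem_index_enum _); rewrite mulf_eq0 conjC_eq0 orbb.
Qed.

Lemma cdot_delta m (u : 'cV[C]_m) i : cdot u (delta_mx i 0) = u i 0.
Proof.
rewrite /cdot (bigD1 i)//= big1 => [|j ji]; rewrite !mxE.
  by rewrite !eqxx conjC1 mulr1 addr0.
by rewrite (negbTE ji) conjC0 mulr0.
Qed.

(** The parallelogram law without the square of [u - v]; it bounds sums directly at the level of
    squared norms. *)
Lemma cdotD_le m (u v : 'cV[C]_m) :
  cdot (u + v) (u + v) <= 2%:R * cdot u u + 2%:R * cdot v v.
Proof.
have := cdot_ge0 (u - v).
rewrite cdotBl !cdotBr cdotDl !cdotDr => h; rewrite -subr_ge0.
by apply: le_trans h _; rewrite le_eqVlt; apply/orP; left; apply/eqP; ring.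
Qed.

End Cdot.

(** * Ultraproducts of finite-dimensional realizations *)

Section UltraLimits.
Context {R : realType}.
Local Notation C := R[i].
Variable F : set_system nat.
Context {FU : UltraFilter F}.

(* An inductive wrapper, so that [-->] is not unfolded to a product. *)
Variant ucvg (x : nat -> C) (l : C) : Prop :=
  UCvg of (x : nat -> C^o) @ F --> (l : C^o).

Lemma ucvgP x l :
  ucvg x l <-> forall eps : C, 0 < eps -> F [set N | `|x N - l| < eps].
Proof.
split=> [[/cvgrPdist_lt h] eps /h|h]; first by apply: filterS => N /=; rewrite distrC.
by split; apply/cvgrPdist_lt => eps /h; apply: filterS => N /=; rewrite distrC.
Qed.

Lemma ucvg_unique x l l' : ucvg x l -> ucvg x l' -> l = l'.
Proof.
by move=> [xl] [xl'];
  apply: (@cvg_unique _ (@norm_hausdorff _ C^o) _ (fmap_proper_filter _ _) _ _ xl xl').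
Qed.

Lemma ucvg_cst c : ucvg (fun=> c) c.
Proof. split; exact: cvg_cst. Qed.

Lemma ucvgD x y l l' : ucvg x l -> ucvg y l' -> ucvg (fun N => x N + y N) (l + l').
Proof. by move=> [xl] [yl]; split; exact: (@cvgD C C^o nat F _ x y l l' xl yl). Qed.

Lemma ucvgM x y l l' : ucvg x l -> ucvg y l' -> ucvg (fun N => x N * y N) (l * l').
Proof. by move=> [xl] [yl]; split; exact: (@cvgM C nat F _ x y l l' xl yl). Qed.

Lemma ucvg_norm x l : ucvg x l -> ucvg (fun N => `|x N|) `|l|.
Proof. by move=> [xl]; split; exact: (@cvg_norm C C^o nat F _ x l xl). Qed.

Lemma ucvg_conj x l : ucvg x l -> ucvg (fun N => (x N)^*) l^*.
Proof.
move=> /ucvgP xl; apply/ucvgP => eps /xl; apply: filterS => N /=.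
by rewrite -rmorphB norm_conjC.
Qed.

Lemma ucvg_near x y l : F [set N | x N = y N] -> ucvg x l -> ucvg y l.
Proof.
move=> xy /ucvgP xl; apply/ucvgP => eps /xl h.
by apply: filterS2 xy h => N /= ->.
Qed.

Lemma ucvg_sum (I : Type) (r : seq I) (x : I -> nat -> C) (l : I -> C) :
  (forall i, ucvg (x i) (l i)) ->
  ucvg (fun N => \sum_(i <- r) x i N) (\sum_(i <- r) l i).
Proof.
move=> xl; elim: r => [|i r IHr].
  rewrite big_nil; apply: (ucvg_near _ (ucvg_cst 0)).
  by apply: nearW => N /=; rewrite big_nil.
rewrite big_cons; apply: (ucvg_near _ (ucvgD (xl i) IHr)).
by apply: nearW => N /=; rewrite big_cons.
Qed.

Lemma ucvg_ge0 x l : F [set N | 0 <= x N] -> ucvg x l -> 0 <= l.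
Proof.
move=> x0 xl; have /ucvg_norm xl' := xl.
have -> : l = `|l|; last exact: normr_ge0.
apply: (ucvg_unique xl); apply: (ucvg_near _ xl').
by apply: filterS x0 => N /= /ger0_norm.
Qed.

Lemma ucvg_le x y l l' :
  F [set N | x N <= y N] -> ucvg x l -> ucvg y l' -> l <= l'.
Proof.
move=> xy xl yl; rewrite -subr_ge0.
have xl' : ucvg (fun N => - x N) (- l) by case: xl => xl; split; exact: (@cvgN C C^o nat F _ x l xl).
apply: (ucvg_ge0 _ (ucvgD yl xl')).
by apply: filterS xy => N /=; rewrite subr_ge0.
Qed.

Lemma ucvg_lt x l c :
  (forall N, 0 <= x N) -> ucvg x l -> l < c -> F [set N | x N < c].
Proof.
move=> x0 xl lc; have l0 : 0 <= l by apply: (ucvg_ge0 _ xl); exact: nearW.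
move: xl => /ucvgP /(_ (c - l)); rewrite subr_gt0 => /(_ lc).
apply: filterS => N /= h; rewrite -(ltrD2r (- l)); apply: le_lt_trans h.
by rewrite real_ler_norm// rpredB// ger0_real.
Qed.

(** Compactness of [[-M, M]] gives a cluster point, and an ultrafilter converges to its cluster
    points: if the preimage of a neighbourhood is not in [F], its complement is, which contradicts
    clustering. *)
Lemma real_ultra_cvg (x : nat -> R) (M : R) :
  (forall N, `|x N| <= M) -> exists l, forall eps : R, 0 < eps -> F [set N | `|x N - l| < eps].
Proof.
move=> xM; have cK := @segment_compact R (- M) M.
have U' : ProperFilter (x @ F) by apply: fmap_proper_filter.
have [|l [_ cl]] := cK (x @ F) U'.
  by apply: nearW => N /=; rewrite in_itv /= -ler_norml.
exists l => eps eps0.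
have [//|Fn] := in_ultra_setVsetC [set N | `|x N - l| < eps] FU.
have Fx : (x @ F) (x @` (~` [set N | `|x N - l| < eps])).
  by apply: (@filterS _ F _ _ _ _ Fn) => N h; exists N.
have [y [[N /= xN <-]]] := cl _ _ Fx (nbhsx_ballx l _ eps0).
by rewrite -ball_normE /= distrC => /xN.
Qed.

Lemma ultra_cvg (x : nat -> C) (M : C) :
  (forall N, `|x N| <= M) -> exists l, ucvg x l.
Proof.
move=> xM.
have MR N : (complex.Re `|x N|) <= complex.Re M by move: (xM N); rewrite lecE => /andP[].
have [|a ha] := @real_ultra_cvg (fun N => complex.Re (x N)) (complex.Re M).
  move=> N; apply: le_trans (MR N).
  by rewrite -lecR RRe_real ?normr_real// normc_ge_Re.
have [|b hb] := @real_ultra_cvg (fun N => complex.Im (x N)) (complex.Re M).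
  move=> N; apply: le_trans (MR N).
  rewrite -lecR RRe_real ?normr_real//.
  have := normc_ge_Re (x N * 'i%C); rewrite ReiNIm normrN => /le_trans; apply.
  by rewrite normrM [`|'i%C|]normc_def /= expr0n /= expr1n add0r sqrtr1 mulr1.
exists (a +i* b)%C; apply/ucvgP => eps eps0.
have epsR : eps = (complex.Re eps)%:C%C by rewrite RRe_real// ger0_real// ltW.
have e0 : 0 < complex.Re eps / 2%:R.
  by rewrite divr_gt0// -ltcR -epsR.
apply: filterS2 (ha _ e0) (hb _ e0) => N /= h1 h2.
rewrite epsR; case: (x N) h1 h2 => u v /= h1 h2.
have -> : (u +i* v - (a +i* b) = (u - a)%:C + 'i * (v - b)%:C)%C.
  by rewrite [LHS]complexE.
apply: le_lt_trans (ler_normD _ _) _.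
have nR (z : R) : `|z%:C%C| = `|z|%:C%C by rewrite normc_def /= expr0n addr0 sqrtr_sqr.
rewrite normrM !nR [`|'i%C|]normc_def /= expr0n /= expr1n add0r sqrtr1 mul1r.
rewrite -rmorphD ltcR [X in _ < X]splitr; exact: ltrD.
Qed.

Definition ulim (x : nat -> C) : C := lim ((x : nat -> C^o) @ F).

Lemma ulimP x M : (forall N, `|x N| <= M) -> ucvg x (ulim x).
Proof. by move=> /ultra_cvg[l [xl]]; split; apply: (@cvgP _ _ (l : C^o)). Qed.

Lemma ulimE x l : ucvg x l -> ulim x = l.
Proof.
move=> [xl].
exact: (@cvg_lim _ (@norm_hausdorff _ C^o) _ _ (fmap_proper_filter _ _) _ _ xl).
Qed.

End UltraLimits.

(** The operators [R_j = (C - I) A_j] of the theorem, with [C^m] in the place of [H]. *)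
Definition rmx {R : realType} {g d m : nat} (A : @mxtuple R g d)
    (T : 'M[R[i]]_(d * m)) : mxtuple g (d * m) :=
  fun j => (T - 1%:M) *m (A j *t 1%:M).

Section Ultraproduct.
Context {R : realType}.
Local Notation C := R[i].
Variable F : set_system nat.
Context {FU : UltraFilter F}.
Hypothesis F_free : forall k, F [set N | (k <= N)%N].
Variable dim : nat -> nat.

(** A family of vectors in the varying spaces [C^(dim N)] is coded as one scalar function on the
    disjoint union of the index sets, which gives it pointwise operations. *)
Local Notation seqs := ({N : nat & 'I_(dim N)} -> C^o).

Definition slice (x : seqs) (N : nat) : 'cV[C]_(dim N) :=
  \col_i x (existT _ N i).

Lemma slice_linear a x y N : slice (a *: x + y) N = a *: slice x N + slice y N.
Proof. by apply/colP => i; rewrite !mxE. Qed.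

Definition bounded_seqs : {pred seqs} := [pred x | `[< exists M : C,
  forall N, cdot (slice x N) (slice x N) <= M >]].

Lemma bounded_seqs_submod : submod_closed bounded_seqs.
Proof.
split=> [|a u v].
  apply/asboolP; exists 0 => N; have -> : slice 0 N = 0 by apply/colP => i; rewrite !mxE.
  by rewrite cdot0l.
move=> /asboolP[M hM] /asboolP[M' hM']; apply/asboolP.
exists (2%:R * (a * a^* * M) + 2%:R * M') => N.
rewrite slice_linear; apply: le_trans (cdotD_le _ _) _.
apply: lerD; last by rewrite ler_wpM2l.
by rewrite ler_wpM2l// cdotZl cdotZr mulrA ler_wpM2l// mul_conjC_ge0.
Qed.

HB.instance Definition _ :=
  GRing.isSubmodClosed.Build C seqs bounded_seqs bounded_seqs_submod.

Record bseqs := BSeqs { bseqs_val :> seqs; _ : bseqs_val \in bounded_seqs }.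
HB.instance Definition _ := [isSub for bseqs_val].
HB.instance Definition _ := [Choice of bseqs by <:].
HB.instance Definition _ := [SubChoice_isSubLmodule of bseqs by <:].

Lemma bseqsP (u : bseqs) : exists2 M : C, 0 <= M &
  forall N, cdot (slice u N) (slice u N) <= M.
Proof.
case: u => u /= /[dup] _ /asboolP[M hM]; exists M =>//.
exact: le_trans (cdot_ge0 _) (hM 0).
Qed.

Definition udot (u v : bseqs) : C :=
  ulim F (fun N => cdot (slice u N) (slice v N)).

Lemma cdot_bound m (u v : 'cV[C]_m) (M M' : C) :
  cdot u u <= M -> cdot v v <= M' -> `|cdot u v| <= sqrtC M * sqrtC M'.
Proof.
move=> uM vM'.
have M0 : 0 <= M := le_trans (cdot_ge0 _) uM.
have M'0 : 0 <= M' := le_trans (cdot_ge0 _) vM'.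
rewrite -(@ler_pXn2r _ 2) ?nnegrE ?mulr_ge0 ?sqrtC_ge0// exprMn !sqrtCK.
by apply: le_trans (cdot_cs _ _) _; rewrite ler_pM// cdot_ge0.
Qed.

Lemma udotP (u v : bseqs) : ucvg F (fun N => cdot (slice u N) (slice v N)) (udot u v).
Proof.
have [M _ uM] := bseqsP u; have [M' _ vM'] := bseqsP v.
by apply: (@ulimP _ _ _ _ (sqrtC M * sqrtC M')) => N; exact: cdot_bound.
Qed.

Lemma slice_linearS a (u v : bseqs) N :
  slice (a *: u + v) N = a *: slice u N + slice v N.
Proof. by apply/colP => i; rewrite !mxE. Qed.

Lemma slice_sub (u v : bseqs) N : slice (u - v) N = slice u N - slice v N.
Proof. by apply/colP => i; rewrite !mxE. Qed.

Lemma udot_linear a u v w : udot (a *: u + v) w = a * udot u w + udot v w.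
Proof.
apply: ulimE; apply: (ucvg_near _ (ucvgD (ucvgM (ucvg_cst a) (udotP u w)) (udotP v w))).
by apply: nearW => N /=; rewrite slice_linearS cdot_linear.
Qed.

Lemma udot_sym u v : udot u v = (udot v u)^*.
Proof.
apply: ulimE; apply: (ucvg_near _ (ucvg_conj (udotP v u))).
by apply: nearW => N /=; rewrite -cdot_sym.
Qed.

Lemma udot_ge0 u : 0 <= udot u u.
Proof. by apply: (ucvg_ge0 _ (udotP u u)); apply: nearW => N /=; exact: cdot_ge0. Qed.

(* Diagonal argument: at level N the limit agrees with the term u k for the
   largest k <= N such that u k is close at level N to all previous terms. *)
Lemma udot_complete (u : nat -> bseqs) :
  (forall k m n, (k <= m)%N -> (k <= n)%N ->
     udot (u m - u n) (u m - u n) <= (2%:R^-1 ^+ k) ^+ 2) ->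
  exists v, forall k, udot (u k - v) (u k - v) <= (2%:R * 2%:R^-1 ^+ k) ^+ 2.
Proof.
move=> u_cauchy.
pose r k : C := (2%:R^-1 ^+ k) ^+ 2.
have r0 k : 0 < r k by rewrite !exprn_gt0// invr_gt0.
pose q N k' k := cdot (slice (u k') N - slice (u k) N) (slice (u k') N - slice (u k) N).
pose S k' := [set N | (k' <= N)%N /\ forall k : 'I_k'.+1, q N k' k <= 2%:R * r k].
have FS k' : F (S k').
  apply: filterI (F_free k') _.
  apply: (@filter_forall _ _ (fun k : 'I_k'.+1 => [set N | q N k' k <= 2%:R * r k])) => k.
  (* The strict margin between [r k] and [2 * r k] is what passes from the ultralimit to the terms
     at F-many levels. *)
  have lt2 : udot (u k' - u k) (u k' - u k) < 2%:R * r k.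
    apply: le_lt_trans (u_cauchy k k' k _ _) _ => //; first by rewrite -ltnS.
    by rewrite -/(r k) ltr_pMl// ltr1n.
  apply: filterS (ucvg_lt (fun N => cdot_ge0 _) (udotP _ _) lt2).
  by move=> N /=; rewrite slice_sub => /ltW.
(* [S 0 N] always holds, so the maximum runs over a nonempty set and [K N] is itself admissible. *)
pose K N := \max_(k < N.+1 | `[< S k N >]) k.
have KS N : S 0 N -> S (K N) N.
  move=> S0; rewrite /K.
  have [|k /asboolP kS ->//] := @eq_bigmax_cond _ [pred k : 'I_N.+1 | `[< S k N >]] (fun k => k).
  by apply/card_gt0P; exists ord0; apply/asboolP.
have S0 N : S 0 N.
  split=> // k; rewrite ord1 /q subrr cdot0l mulr_ge0//; exact/ltW.
have Kmax N k : S k N -> (k <= K N)%N.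
  move=> kS; have kN : (k < N.+1)%N by case: kS.
  by apply: (@leq_bigmax_cond _ _ _ (Ordinal kN)); apply/asboolP.
pose v : seqs := fun s => u (K (tag s)) s.
have slv N : slice v N = slice (u (K N)) N by apply/colP => i; rewrite !mxE.
have vK N k : S k N -> q N (K N) k <= 2%:R * r k.
  move=> kS; have kK := Kmax _ _ kS.
  by case: (KS N (S0 N)) => _ /(_ (Ordinal (kK : (k < (K N).+1)%N))).
have vb : v \in bounded_seqs.
  have [M M0 hM] := bseqsP (u 0); apply/asboolP.
  exists (2%:R * (2%:R * r 0) + 2%:R * M) => N; rewrite slv.
  rewrite -[slice (u (K N)) N](subrK (slice (u 0) N)).
  apply: le_trans (cdotD_le _ _) _; apply: lerD; rewrite ler_wpM2l//.
  exact: (vK N 0).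
exists (BSeqs vb) => k.
apply: (ucvg_le _ (udotP _ _) (ucvg_cst _)).
apply: filterS (FS k) => N kS; rewrite /mkset slice_sub [slice (BSeqs vb) N]slv.
have := vK N k kS; rewrite /q -[_ - slice (u k) N]opprB.
rewrite -scaleN1r cdotZl cdotZr rmorphN /= conjC1 mulrA mulrNN !mul1r => /le_trans; apply.
by rewrite exprMn -/(r k) ler_pM2r// expr2 ler_peMl// ler1n.
Qed.

Variables d e : nat.

Local Notation hseq := (forall N, 'cV[C]_(d * dim N)).

Definition hbounded (Y : hseq) := exists M : C, forall N, cdot (Y N) (Y N) <= M.

Lemma hbounded_linear a Y Z :
  hbounded Y -> hbounded Z -> hbounded (fun N => a *: Y N + Z N).
Proof.
move=> [M hM] [M' hM']; exists (2%:R * (a * a^* * M) + 2%:R * M') => N.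
apply: le_trans (cdotD_le _ _) _; apply: lerD; last by rewrite ler_wpM2l.
by rewrite ler_wpM2l// cdotZl cdotZr mulrA ler_wpM2l// mul_conjC_ge0.
Qed.

Definition hcomp (Y : hseq) (i : 'I_d) : seqs :=
  fun s => Y (tag s) (mxtens_index (i, tagged s)) 0.

Lemma sum_mxtens (V : nmodType) m n (f : 'I_(m * n) -> V) :
  \sum_k f k = \sum_(i < m) \sum_(j < n) f (mxtens_index (i, j)).
Proof.
rewrite pair_big /= (reindex (@mxtens_index m n)) /=; first by apply: eq_bigr => -[].
by exists (@mxtens_unindex m n) => x _; rewrite ?mxtens_indexK ?mxtens_unindexK.
Qed.

Lemma cdot_hcomp Y Z N :
  cdot (Y N) (Z N) = \sum_i cdot (slice (hcomp Y i) N) (slice (hcomp Z i) N).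
Proof.
rewrite {1}/cdot sum_mxtens; apply: eq_bigr => i _.
by apply: eq_bigr => a _; rewrite !mxE.
Qed.

Lemma hcomp_bounded Y i : hbounded Y -> hcomp Y i \in bounded_seqs.
Proof.
move=> [M hM]; apply/asboolP; exists M => N; apply: le_trans (hM N).
rewrite cdot_hcomp (bigD1 i)//= lerDl; apply: sumr_ge0 => j _; exact: cdot_ge0.
Qed.

Lemma hbounded_comp Y : (forall i, hcomp Y i \in bounded_seqs) -> hbounded Y.
Proof.
move=> bY.
have /choice[M hM] : forall i, exists M, forall N,
    cdot (slice (hcomp Y i) N) (slice (hcomp Y i) N) <= M.
  by move=> i; apply/asboolP/bY.
by exists (\sum_i M i) => N; rewrite cdot_hcomp; apply: ler_sum.
Qed.

Definition hcompb (Y : hseq) (i : 'I_d) : bseqs := insubd 0 (hcomp Y i).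

Lemma hcompbE Y i : hbounded Y -> hcompb Y i = hcomp Y i :> seqs.
Proof. by move=> bY; rewrite /hcompb insubdK// hcomp_bounded. Qed.

Variables (H : hilbertType R) (pi : {linear bseqs -> H}).
Hypothesis pi_surj : forall x, exists v, pi v = x.
Hypothesis pi_dot : forall u v, hdot H (pi u) (pi v) = udot u v.

Definition ucls (Y : hseq) : {ffun 'I_d -> H} := [ffun i => pi (hcompb Y i)].

Lemma tdot_ucls Y Z : hbounded Y -> hbounded Z ->
  ucvg F (fun N => cdot (Y N) (Z N)) (tdot (ucls Y) (ucls Z)).
Proof.
move=> bY bZ.
have -> : tdot (ucls Y) (ucls Z) = \sum_i udot (hcompb Y i) (hcompb Z i).
  by apply: eq_bigr => i _; rewrite !ffunE pi_dot.
apply: (ucvg_near _ (ucvg_sum (index_enum 'I_d) (fun i => udotP _ _))).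
apply: nearW => N /=.
by rewrite cdot_hcomp; apply: eq_bigr => i _; rewrite !hcompbE.
Qed.

Lemma ucls_linear a Y Z : hbounded Y -> hbounded Z ->
  ucls (fun N => a *: Y N + Z N) = a *: ucls Y + ucls Z.
Proof.
move=> bY bZ; apply/ffunP => i; rewrite !ffunE -linearP; congr (pi _).
apply/val_inj; rewrite /= !hcompbE//; last exact: hbounded_linear.
by apply/funext => s; rewrite /hcomp !mxE.
Qed.

Lemma ucls_surj u : exists2 Y, hbounded Y & ucls Y = u.
Proof.
have /choice[v hv] : forall i, exists v, pi v = u i by move=> i; exact: pi_surj.
pose Y : hseq := fun N => \col_k v (mxtens_unindex k).1 (existT _ N (mxtens_unindex k).2).
have vY i N : slice (hcomp Y i) N = slice (v i) N.
  by apply/colP => a; rewrite !mxE /hcomp /= mxE mxtens_indexK.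
have bY : hbounded Y.
  apply: hbounded_comp => i; have [M _ hM] := bseqsP (v i).
  by apply/asboolP; exists M => N; rewrite vY.
exists Y => //; apply/ffunP => i; rewrite ffunE -hv; congr (pi _).
apply/val_inj; rewrite /= hcompbE//; apply/funext => -[N a].
by rewrite /hcomp mxE mxtens_indexK.
Qed.

Lemma tdot_eq0 (u : {ffun 'I_d -> H}) : tdot u u = 0 -> u = 0.
Proof.
move/eqP; rewrite psumr_eq0 => [/allP h|i _]; last by rewrite hdotE exprn_ge0.
apply/ffunP => i; rewrite ffunE; apply/eqP.
by have := h i (mem_index_enum _); rewrite hdotE expf_eq0 /= normr_eq0.
Qed.

Lemma ucls_eq Y Z : hbounded Y -> hbounded Z ->
  ucvg F (fun N => cdot (Y N - Z N) (Y N - Z N)) 0 -> ucls Y = ucls Z.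
Proof.
move=> bY bZ YZ0.
have Ed : (fun N => Y N - Z N) = (fun N => (-1) *: Z N + Y N).
  by apply: functional_extensionality_dep => N; rewrite scaleN1r addrC.
have bD : hbounded (fun N => Y N - Z N) by rewrite Ed; exact: hbounded_linear.
apply/eqP; rewrite -subr_eq0 addrC -scaleN1r -ucls_linear// -Ed; apply/eqP/tdot_eq0.
exact: ucvg_unique (tdot_ucls bD bD) YZ0.
Qed.

Definition hmul (M : forall N, 'M[C]_(d * dim N)) (Y : hseq) : hseq :=
  fun N => M N *m Y N.

Section Unitary.
Variable T : forall N, 'M[C]_(d * dim N).
Hypothesis T_unitary : forall N, (T N)^t* *m T N = 1%:M.

Lemma hmul_unitary Y Z N : cdot (hmul T Y N) (hmul T Z N) = cdot (Y N) (Z N).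
Proof. by rewrite cdot_mulmxl mulmxA T_unitary mul1mx. Qed.

Lemma hmul_bounded Y : hbounded Y -> hbounded (hmul T Y).
Proof. by move=> [M hM]; exists M => N; rewrite hmul_unitary. Qed.

Definition uop (u : {ffun 'I_d -> H}) : {ffun 'I_d -> H} :=
  ucls (hmul T (sval (cid2 (ucls_surj u)))).

(** [uop] acts on a chosen representative. The choice is immaterial because each [T N] preserves the
    norm of the difference of two representatives. *)
Lemma uop_ucls Y : hbounded Y -> uop (ucls Y) = ucls (hmul T Y).
Proof.
move=> bY; rewrite /uop; case: cid2 => Z /= bZ eZ.
apply: ucls_eq; [exact: hmul_bounded..|].
have bD : hbounded (fun N => (-1) *: Y N + Z N) by exact: hbounded_linear.
have := tdot_ucls bD bD; rewrite ucls_linear// eZ scaleN1r addNr.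
have -> : tdot (0 : {ffun 'I_d -> H}) 0 = 0.
  by rewrite /tdot big1// => i _; rewrite ffunE linear0l.
apply: ucvg_near; apply: nearW => N /=.
by rewrite scaleN1r addrC /hmul -mulmxBr cdot_mulmxl mulmxA T_unitary mul1mx.
Qed.

Lemma uop_linear : linear uop.
Proof.
move=> a u v; have [Y bY <-] := ucls_surj u; have [Z bZ <-] := ucls_surj v.
rewrite -ucls_linear// !uop_ucls//; last exact: hbounded_linear.
rewrite -ucls_linear; [|exact: hmul_bounded..]; congr ucls.
by apply: functional_extensionality_dep => N; rewrite /hmul linearP.
Qed.

Lemma uop_unitary : (forall N, T N *m (T N)^t* = 1%:M) -> unitary_op uop.
Proof.
move=> T_unitary'; split=> [u v|w].
  have [Y bY <-] := ucls_surj u; have [Z bZ <-] := ucls_surj v.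
  rewrite !uop_ucls//.
  apply: (ucvg_unique (tdot_ucls (hmul_bounded bY) (hmul_bounded bZ))).
  apply: (ucvg_near _ (tdot_ucls bY bZ)); apply: nearW => N /=.
  by rewrite hmul_unitary.
have [Z [M hM] <-] := ucls_surj w.
pose Y : hseq := fun N => (T N)^t* *m Z N.
have bY : hbounded Y.
  by exists M => N; rewrite /Y cdot_mulmxl trmxCK mulmxA T_unitary' mul1mx.
exists (ucls Y); rewrite uop_ucls//; congr ucls.
by apply: functional_extensionality_dep => N; rewrite /hmul mulmxA T_unitary' mul1mx.
Qed.

End Unitary.

Lemma hcomp_ampl (M : 'M[C]_d) Y i :
  hcomp (hmul (fun N => M *t 1%:M) Y) i = \sum_j M i j *: (hcomp Y j : seqs).
Proof.
apply/funext => -[N a]; rewrite fct_sumE /hcomp /hmul mxE sum_mxtens.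
apply: eq_bigr => j _; rewrite (bigD1 a)//= big1 => [|b ba].
  by rewrite tensmxE mxE eqxx mulr1 addr0.
by rewrite tensmxE mxE eq_sym (negbTE ba) mulr0 mul0r.
Qed.

Lemma hmul_ampl_bounded (M : 'M[C]_d) Y :
  hbounded Y -> hbounded (hmul (fun N => M *t 1%:M) Y).
Proof.
move=> bY; apply: hbounded_comp => i; rewrite hcomp_ampl.
by apply: rpred_sum => j _; rewrite rpredZ// hcomp_bounded.
Qed.

Lemma ampl_ucls (M : 'M[C]_d) Y :
  hbounded Y -> ampl M (ucls Y) = ucls (hmul (fun N => M *t 1%:M) Y).
Proof.
move=> bY; apply/ffunP => i; rewrite !ffunE.
under eq_bigr do rewrite ffunE -linearZ.
rewrite -linear_sum; congr (pi _); apply/val_inj.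
rewrite raddf_sum /= hcompbE; last exact: hmul_ampl_bounded.
by rewrite hcomp_ampl; apply: eq_bigr => j _; rewrite hcompbE.
Qed.

Section Isometry.
Variable V : forall N, 'M[C]_(d * dim N, e).
Hypothesis V_isometry : forall N, (V N)^t* *m V N = 1%:M.

Definition vseq (v : 'cV[C]_e) : hseq := fun N => V N *m v.

Lemma vseq_bounded v : hbounded (vseq v).
Proof. by exists (cdot v v) => N; rewrite cdot_mulmxl mulmxA V_isometry mul1mx. Qed.

Definition vop (v : 'cV[C]_e) : {ffun 'I_d -> H} := ucls (vseq v).

Lemma vop_linear : linear vop.
Proof.
move=> a u v; rewrite /vop -ucls_linear; [|exact: vseq_bounded..]; congr ucls.
by apply: functional_extensionality_dep => N; rewrite /vseq linearP.
Qed.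

Lemma vop_isometry : isometry_op vop.
Proof.
move=> v; apply: (ucvg_unique (tdot_ucls (vseq_bounded v) (vseq_bounded v))).
apply: (ucvg_near _ (ucvg_cst _)); apply: nearW => N /=.
by rewrite cdot_mulmxl mulmxA V_isometry mul1mx.
Qed.

(** Equality at F-many levels suffices because inner products in [H] are ultralimits; level N is
    only known to be right for words shorter than N. *)
Lemma hadj_vop Y (c : 'cV[C]_e) : hbounded Y ->
  F [set N | (V N)^t* *m Y N = c] -> hadj vop (ucls Y) = c.
Proof.
move=> bY Yc; apply/colP => a; rewrite mxE.
apply: (ucvg_unique (tdot_ucls bY (vseq_bounded _))).
apply: (ucvg_near _ (ucvg_cst _)); apply: filterS Yc => N /= <-.
by rewrite cdot_mulmxr cdot_delta.
Qed.

End Isometry.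

Section Words.
Variables (g : nat) (A : @mxtuple R g d).
Variable T : forall N, 'M[C]_(d * dim N).
Hypothesis T_unitary : forall N, (T N)^t* *m T N = 1%:M.
Variable V : forall N, 'M[C]_(d * dim N, e).
Hypothesis V_isometry : forall N, (V N)^t* *m V N = 1%:M.

(** Amplifications and [uop] act level by level on representatives, hence so does every word in the
    [R_j], and each letter keeps the sequence bounded. *)
Lemma opword_ucls w v :
  let Y : hseq := fun N => mxword (rmx A (T N)) w *m V N *m v in
  hbounded Y /\ opword (fun j u => uop T (ampl (A j) u) - ampl (A j) u) w (vop V v)
    = ucls Y.
Proof.
elim: w => [|j w [bY IHw]] Y.
  have -> : Y = vseq V v.
    apply: functional_extensionality_dep => N.
    by rewrite /Y /mxword big_nil mul1mx.
  by split=> //; exact: vseq_bounded.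
set Z : hseq := fun N => mxword (rmx A (T N)) w *m V N *m v in bY IHw.
have bA := hmul_ampl_bounded (A j) bY.
have bTA := hmul_bounded T_unitary bA.
have -> : Y = fun N => (-1) *: hmul (fun N => A j *t 1%:M) Z N
    + hmul T (hmul (fun N => A j *t 1%:M) Z) N.
  apply: functional_extensionality_dep => N.
  rewrite /Y /mxword big_cons /hmul /Z addrC scaleN1r /rmx -!mulmxA.
  by rewrite mulmxBl mul1mx.
split; first exact: hbounded_linear.
by rewrite ucls_linear// /= IHw ampl_ucls// uop_ucls// scaleN1r addrC.
Qed.

End Words.

End Ultraproduct.

(** For a fixed word the coefficient formula holds at all levels [N > size w], and these form a set
    of the ultrafilter because it is free. *)
Lemma ultraproduct_realization (R : realType) (g d e : nat) (A : @mxtuple R g d)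
    (G : word g -> 'M[R[i]]_e) (dim : nat -> nat)
    (T : forall N, 'M[R[i]]_(d * dim N)) (V : forall N, 'M[R[i]]_(d * dim N, e)) :
  (forall N, (T N)^t* *m T N = 1%:M) -> (forall N, T N *m (T N)^t* = 1%:M) ->
  (forall N, (V N)^t* *m V N = 1%:M) ->
  (forall N j w, (size w < N)%N ->
     G (j :: w) = (V N)^t* *m (T N *m ((A j *t 1%:M) *m (mxword (rmx A (T N)) w *m V N)))) ->
  exists (H : hilbertType R)
    (U : {linear {ffun 'I_d -> H} -> {ffun 'I_d -> H}})
    (V' : {linear 'cV[R[i]]_e -> {ffun 'I_d -> H}}),
  [/\ unitary_op U, isometry_op V' & forall j w v, G (j :: w) *m v =
    hadj V' (U (ampl (A j)
      (opword (fun j u => U (ampl (A j) u) - ampl (A j) u) w (V' v))))].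
Proof.
move=> T1 T2 V1 TG.
have [F [FU F_free]] := @ultraFilterLemma nat \oo _.
have Ff k : F [set N | (k <= N)%N] by apply: F_free; exists k.
have [H [pi [pi_surj pi_dot]]] :=
  PreHilbert.hilbert_quotient (@udot_linear R F FU dim) (@udot_sym R F FU dim)
    (@udot_ge0 R F FU dim) (@udot_complete R F FU Ff dim).
pose U := HB.pack_for {linear {ffun 'I_d -> H} -> {ffun 'I_d -> H}} (uop pi_surj T)
  (GRing.isLinear.Build _ _ _ _ (uop pi_surj T) (uop_linear pi_surj pi_dot T1)).
pose V' := HB.pack_for {linear 'cV[R[i]]_e -> {ffun 'I_d -> H}} (vop pi V)
  (GRing.isLinear.Build _ _ _ _ (vop pi V) (vop_linear pi V1)).
exists H, U, V'; split.
- exact: uop_unitary.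
- exact: vop_isometry.
move=> j w v; apply/esym.
have [bY ->] := opword_ucls pi_surj pi_dot A T1 V1 w v.
rewrite ampl_ucls// -[U _]/(uop pi_surj T _) uop_ucls//; last exact: hmul_ampl_bounded.
rewrite -[hadj V' _]/(hadj (vop pi V) _).
apply: hadj_vop => //; first by apply: hmul_bounded => //; exact: hmul_ampl_bounded.
apply: filterS (Ff (size w).+1) => N /= wN.
by rewrite (TG N)// /hmul !mulmxA.
Qed.

(** * Positive matrices and compactness *)

Section Psd.
Context {R : realType}.
Local Notation C := R[i].

Definition herm {n} (M : 'M[C]_n) : Prop := M^t* = M.

Lemma psdmxE n (M : 'M[C]_n) : psdmx M <-> forall v, 0 <= cdot (M *m v) v.
Proof. by split=> h v; have := h v; rewrite cdotE mulmxA. Qed.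

Lemma psdmx_gram m n (S : 'M[C]_(n, m)) : psdmx (S *m S^t*).
Proof. by apply/psdmxE => v; rewrite -mulmxA cdot_mulmxl cdot_ge0. Qed.

Lemma herm_gram m n (S : 'M[C]_(n, m)) : herm (S *m S^t*).
Proof. by rewrite /herm adjmxM trmxCK. Qed.

(** Unitary diagonalization, with square roots of the eigenvalues. *)
Lemma psd_factor n (M : 'M[C]_n) : herm M -> psdmx M ->
  exists S : 'M[C]_n, M = S *m S^t*.
Proof.
move=> Mh /psdmxE Mp.
have Mn : M \is normalmx by apply/normalmxP; rewrite Mh.
have [P [sp [Pu EM]]] : exists (P : 'M[C]_n) sp,
    P \is unitarymx /\ M = P^t* *m diag_mx sp *m P.
  exists (spectralmx M), (spectral_diag M); split; first exact: spectral_unitarymx.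
  by rewrite -invmx_unitary ?spectral_unitarymx//; apply/orthomx_spectralP.
have PP : P *m P^t* = 1%:M by apply/unitarymxP.
have sp_ge0 i : 0 <= sp 0 i.
  have := Mp (P^t* *m delta_mx i 0).
  have E : M *m P^t* = P^t* *m diag_mx sp by rewrite EM -[LHS]mulmxA PP mulmx1.
  rewrite mulmxA E cdot_mulmxr trmxCK !mulmxA PP mul1mx.
  by rewrite mul_diag_mx cdot_delta !mxE !eqxx mulr1.
exists (P^t* *m diag_mx (\row_i sqrtC (sp 0 i))).
rewrite adjmxM trmxCK !mulmxA -[_ *m diag_mx _ *m _]mulmxA {1}EM.
congr (_ *m _ *m _); apply/matrixP => i j; rewrite mul_diag_mx !mxE.
case: (eqVneq i j) => [<-|ij]; last by rewrite !mulr0n conjC0 mulr0.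
by rewrite !mulr1n conj_Creal ?ger0_real ?sqrtC_ge0// -expr2 sqrtCK.
Qed.

(** Cauchy-Schwarz for the rows of a factor [S] bounds an entry by two diagonal ones. Hence a bound
    on the trace makes a set of positive matrices bounded. *)
Lemma psd_entry n (M : 'M[C]_n) i j : herm M -> psdmx M ->
  `|M i j| <= \tr M.
Proof.
move=> Mh Mp; have [S MS] := psd_factor Mh Mp.
have cMS a b : M a b = cdot (row a S)^T (row b S)^T.
  by rewrite MS mxE; apply: eq_bigr => k _; rewrite !mxE.
have M0 k : 0 <= M k k by rewrite cMS cdot_ge0.
have dM k : M k k <= \tr M.
  by rewrite /mxtrace (bigD1 k)//= lerDl sumr_ge0.
have trM0 : 0 <= \tr M by apply: le_trans (dM i).
rewrite -(@ler_pXn2r _ 2) ?nnegrE// cMS; apply: le_trans (cdot_cs _ _) _.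
by rewrite -!cMS expr2 ler_pM.
Qed.

(** The Frobenius inner product. *)
Definition fdot {m n} (M N : 'M[C]_(m, n)) : C := \tr (N^t* *m M).

Lemma fdotE m n (M N : 'M[C]_(m, n)) : fdot M N = \sum_i \sum_j M i j * (N i j)^*.
Proof.
rewrite /fdot /mxtrace exchange_big; apply: eq_bigr => j _; rewrite mxE.
by apply: eq_bigr => i _; rewrite !mxE mulrC.
Qed.

Lemma fdot_linear m n a (u v w : 'M[C]_(m, n)) :
  fdot (a *: u + v) w = a * fdot u w + fdot v w.
Proof. by rewrite /fdot mulmxDr -scalemxAr mxtraceD mxtraceZ. Qed.

Lemma fdotZl m n a (u w : 'M[C]_(m, n)) : fdot (a *: u) w = a * fdot u w.
Proof. by rewrite /fdot -scalemxAr mxtraceZ. Qed.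

Lemma fdot_sym m n (u v : 'M[C]_(m, n)) : fdot u v = (fdot v u)^*.
Proof.
rewrite !fdotE rmorph_sum; apply: eq_bigr => i _; rewrite rmorph_sum.
by apply: eq_bigr => j _; rewrite rmorphM /= conjCK mulrC.
Qed.

Lemma fdot_ge0 m n (u : 'M[C]_(m, n)) : 0 <= fdot u u.
Proof. by rewrite fdotE !sumr_ge0// => i _; rewrite sumr_ge0// => j _; rewrite mul_conjC_ge0. Qed.

Lemma fdot_eq0 m n (u : 'M[C]_(m, n)) : fdot u u = 0 -> u = 0.
Proof.
rewrite fdotE => /eqP; rewrite psumr_eq0 => [/allP h|i _]; last first.
  by rewrite sumr_ge0// => j _; rewrite mul_conjC_ge0.
apply/matrixP => i j; rewrite mxE; apply/eqP.
have := h i (mem_index_enum _); rewrite /= psumr_eq0 => [/allP/(_ j (mem_index_enum _))|k _].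
  by rewrite /= mulf_eq0 conjC_eq0 orbb.
by rewrite mul_conjC_ge0.
Qed.
End Psd.

(** * Nearest points in compact convex sets of matrices *)

Section MinNorm.
Context {R : realType}.
Local Notation C := R[i].

Lemma ucvg_fdot (F : set_system nat) (FU : UltraFilter F) m n
    (x y : nat -> 'M[C]_(m, n)) (l l' : 'M[C]_(m, n)) :
  (forall i j, ucvg F (fun N => x N i j) (l i j)) ->
  (forall i j, ucvg F (fun N => y N i j) (l' i j)) ->
  ucvg F (fun N => fdot (x N) (y N)) (fdot l l').
Proof.
move=> xl yl; rewrite fdotE.
apply: (ucvg_near (x := fun N => \sum_i \sum_j x N i j * (y N i j)^*)).
  by apply: nearW => N /=; rewrite fdotE.
by apply: ucvg_sum => i; apply: ucvg_sum => j; apply: ucvgM => //; exact: ucvg_conj.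
Qed.

Lemma ucvg_linear (F : set_system nat) (FU : UltraFilter F) n k l
    (phi : {linear 'M[C]_n -> 'M[C]_(k, l)}) (x : nat -> 'M[C]_n) (M : 'M[C]_n) :
  (forall i j, ucvg F (fun N => x N i j) (M i j)) ->
  forall i j, ucvg F (fun N => phi (x N) i j) (phi M i j).
Proof.
move=> xM i j.
have E (Z : 'M[C]_n) : phi Z i j = \sum_a \sum_b Z a b * phi (delta_mx a b) i j.
  rewrite {1}(matrix_sum_delta Z) linear_sum summxE; apply: eq_bigr => a _.
  rewrite linear_sum summxE; apply: eq_bigr => b _.
  by rewrite linearZ mxE.
rewrite E; apply: (ucvg_near (x := fun N => \sum_a \sum_b x N a b * phi (delta_mx a b) i j)).
  by apply: nearW => N /=; rewrite E.
apply: ucvg_sum => a; apply: ucvg_sum => b; apply: ucvgM => //; exact: ucvg_cst.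
Qed.

Lemma free_ultrafilter : exists F : set_system nat,
  UltraFilter F /\ forall k, F [set N | (k <= N)%N].
Proof.
have [F [FU F_free]] := @ultraFilterLemma nat \oo _.
by exists F; split=> // k; apply: F_free; exists k.
Qed.

(** Closedness is tested on entrywise ultralimits, because the nearest point is itself produced as
    the ultralimit of a minimizing sequence. *)
Definition ultra_closed n (S : set 'M[C]_n) : Prop :=
  forall (F : set_system nat) (FU : UltraFilter F) (x : nat -> 'M[C]_n) (M : 'M[C]_n),
    (forall N, S (x N)) -> (forall i j, ucvg F (fun N => x N i j) (M i j)) -> S M.

(** The ultralimit of a minimizing sequence attains the distance from [c] to the image of [S]. The
    inequality is the first-order condition at that point along segments inside [S]. *)
Lemma min_norm n k l (S : set 'M[C]_n) (phi : {linear 'M[C]_n -> 'M[C]_(k, l)})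
    (c : 'M[C]_(k, l)) (K : C) :
  (exists M, S M) ->
  (forall M N (t : R), S M -> S N -> 0 <= t <= 1 -> S (M + t%:C%C *: (N - M))) ->
  (forall M i j, S M -> `|M i j| <= K) -> ultra_closed S ->
  exists2 M, S M & forall N, S N ->
    0 <= complex.Re (fdot (phi N - phi M) (phi M - c)).
Proof.
move=> [M0 SM0] S_convex S_bounded S_closed.
pose nm M := complex.Re (fdot (phi M - c) (phi M - c)).
have fC M : fdot (phi M - c) (phi M - c) = (nm M)%:C%C.
  by rewrite /nm RRe_real// ger0_real// fdot_ge0.
have nm0 M : 0 <= nm M by rewrite -ler0c -fC fdot_ge0.
pose delta := inf [set nm M | M in S].
have hi : has_inf [set nm M | M in S].
  split; first by exists (nm M0); exists M0.
  by exists 0 => _ [M _ <-].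
have /choice[x hx] : forall N : nat, exists M, S M /\ nm M < delta + N.+1%:R^-1.
  move=> N; have N0 : 0 < N.+1%:R^-1 :> R by rewrite invr_gt0.
  by have [_ [M SM <-] lt] := inf_adherent N0 hi; exists M.
have [F [FU F_free]] := free_ultrafilter.
have /choice[m hm] : forall ij : 'I_n * 'I_n, exists z, ucvg F (fun N => x N ij.1 ij.2) z.
  by move=> [i j]; apply: (@ultra_cvg _ _ _ _ K) => N; apply: S_bounded; case: (hx N).
pose M := \matrix_(i, j) m (i, j).
have xM i j : ucvg F (fun N => x N i j) (M i j) by rewrite mxE; exact: (hm (i, j)).
have SM : S M by apply: (S_closed F FU x) => // N; case: (hx N).
have nmM : nm M <= delta.
  rewrite -lecR -fC.
  have cx i j : ucvg F (fun N => (phi (x N) - c) i j) ((phi M - c) i j).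
    rewrite mxE; apply: (ucvg_near (x := fun N => phi (x N) i j + (- c) i j)).
      by apply: nearW => N /=; rewrite [RHS]mxE.
    by apply: ucvgD; [exact: ucvg_linear|exact: ucvg_cst].
  have cc := ucvg_fdot FU cx cx.
  apply/ler_addgt0Pr => eps eps0.
  apply: (ucvg_le _ cc (ucvg_cst (delta%:C%C + eps))).
  have epsR : eps = (complex.Re eps)%:C%C by rewrite RRe_real// ger0_real// ltW.
  have e0 : 0 < complex.Re eps by rewrite -ltcR -epsR.
  apply: filterS (F_free (Num.bound (complex.Re eps)^-1)) => N /= hN.
  rewrite fC epsR -rmorphD lecR; apply/ltW.
  case: (hx N) => _ /lt_le_trans; apply; rewrite lerD2l.
  rewrite invf_ple ?posrE//; apply: le_trans (ltW (archi_boundP _)) _.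
    by rewrite invr_ge0 ltW.
  by rewrite ler_nat ltnW.
exists M => // N SN.
set E := phi N - phi M; set D := phi M - c.
rewrite leNgt; apply/negP => lt0.
have key (t : R) : 0 <= t <= 1 ->
    0 <= 2%:R * t * complex.Re (fdot E D) + t ^+ 2 * complex.Re (fdot E E).
  move=> t01; have /andP[t0 _] := t01.
  have : nm M <= nm (M + t%:C%C *: (N - M)).
    apply: le_trans nmM _; apply: ge_inf; first by case: hi.
    by exists (M + t%:C%C *: (N - M)) => //; exact: S_convex.
  have -> : nm (M + t%:C%C *: (N - M)) =
      nm M + (2%:R * t * complex.Re (fdot E D) + t ^+ 2 * complex.Re (fdot E E)).
    rewrite /nm linearD linearZ linearB /= -/E.
    have -> : phi M + t%:C%C *: E - c = t%:C%C *: E + D by rewrite /D addrAC addrC.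
    rewrite fdot_linear fdot_sym fdot_linear [fdot D (t%:C%C *: E + D)]fdot_sym fdot_linear.
    rewrite (fdot_sym D E) -[fdot E E]RRe_real ?ger0_real ?fdot_ge0//.
    case: (fdot E D) => a b; case: (fdot D D) => a' b' /=; ring.
  by rewrite lerDl.
set p := complex.Re (fdot E D) in lt0 key *.
set q := complex.Re (fdot E E) in key.
have q0 : 0 <= q by rewrite -ler0c RRe_real ?ger0_real ?fdot_ge0.
(* This choice gives [t * q <= - p], so [2 * p + t * q <= p < 0] contradicts [key]; adding 1 to [q]
   avoids a division by 0. *)
pose t := Num.min 1 (- p / (q + 1)).
have q1 : 0 < q + 1 by rewrite ltr_wpDl.
have t0 : 0 < t by rewrite lt_min ltr01 divr_gt0// oppr_gt0.
have tp : t * (q + 1) <= - p by rewrite -ler_pdivlMr// ge_min lexx orbT.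
have := key t; rewrite (ltW t0) ge_min lexx/= => /(_ isT).
have -> : 2%:R * t * p + t ^+ 2 * q = t * (2%:R * p + t * q) by ring.
rewrite pmulr_rge0// leNgt => /negP; apply.
have : t * q <= - p by apply: le_trans tp; rewrite ler_pM2l// lerDl.
by move=> h; lra.
Qed.

End MinNorm.

(** * Operator norms *)

Section Norms.
Context {R : realType}.
Local Notation C := R[i].
Implicit Types m n : nat.

Lemma realcM (x y : R) : (x * y)%:C%C = x%:C%C * y%:C%C.
Proof. exact: rmorphM. Qed.

Lemma realcD (x y : R) : (x + y)%:C%C = x%:C%C + y%:C%C.
Proof. exact: rmorphD. Qed.

Lemma realcX (x : R) k : (x ^+ k)%:C%C = x%:C%C ^+ k.
Proof. exact: rmorphXn. Qed.

Lemma Re_normK (a : C) : (complex.Re `|a|)%:C%C = `|a|.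
Proof. by rewrite RRe_real ?normr_real. Qed.

Lemma l2normE n (v : 'cV[C]_n) : (l2norm v ^+ 2)%:C%C = cdot v v.
Proof.
rewrite sqr_sqrtr; last first.
  apply: sumr_ge0 => i _; rewrite exprn_ge0//.
  by case: `|_| (normr_ge0 (v i 0)) => a b; rewrite lecE => /andP[].
rewrite rmorph_sum; apply: eq_bigr => i _.
by rewrite -normCK -Re_normK -realcX.
Qed.

Lemma l2norm_ge0 n (v : 'cV[C]_n) : 0 <= l2norm v.
Proof. exact: sqrtr_ge0. Qed.

Lemma l2norm_le m n (u : 'cV[C]_m) (v : 'cV[C]_n) (c : R) : 0 <= c ->
  (cdot u u <= (c ^+ 2)%:C%C * cdot v v) -> l2norm u <= c * l2norm v.
Proof.
move=> c0; rewrite -!l2normE -realcM lecR -exprMn => h.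
by rewrite -(@ler_pXn2r _ 2)// nnegrE ?mulr_ge0 ?l2norm_ge0.
Qed.

Lemma l2norm_sqr_le m n (u : 'cV[C]_m) (v : 'cV[C]_n) (c : R) :
  l2norm u <= c * l2norm v -> cdot u u <= (c ^+ 2)%:C%C * cdot v v.
Proof.
move=> h; rewrite -!l2normE -realcM lecR -exprMn.
by rewrite ler_pXn2r ?nnegrE ?l2norm_ge0// (le_trans _ h) ?l2norm_ge0.
Qed.

Lemma l2normZ n a (v : 'cV[C]_n) : l2norm (a *: v) = complex.Re `|a| * l2norm v.
Proof.
have a0 : 0 <= complex.Re `|a| by rewrite -ler0c RRe_real ?normr_real.
apply/eqP; rewrite -(@eqrXn2 _ 2)// ?mulr_ge0 ?l2norm_ge0// exprMn.
apply/eqP/complexI; rewrite [RHS]realcM !l2normE cdotZl cdotZr mulrA -normCK.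
by rewrite -Re_normK -realcX.
Qed.

Lemma l2norm0 n : l2norm (0 : 'cV[C]_n) = 0.
Proof. by rewrite -(scale0r 0) l2normZ normr0 mul0r. Qed.

Lemma l2norm_eq0 n (v : 'cV[C]_n) : l2norm v = 0 -> v = 0.
Proof. by move=> v0; apply: cdot_eq0; rewrite -l2normE v0 expr0n. Qed.

Lemma l2normD n (u v : 'cV[C]_n) : l2norm (u + v) <= l2norm u + l2norm v.
Proof.
rewrite -(@ler_pXn2r _ 2)// ?nnegrE ?addr_ge0 ?l2norm_ge0//.
rewrite -lecR l2normE sqrrD !realcD !l2normE.
rewrite cdotDl !cdotDr [cdot v u]cdot_sym addrA -[_ + cdot u v + _]addrA.
rewrite lerD2r lerD2l.
have le1 : `|cdot u v| <= (l2norm u * l2norm v)%:C%C.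
  rewrite -(@ler_pXn2r _ 2) ?nnegrE ?normr_ge0 ?ler0c ?mulr_ge0 ?l2norm_ge0//.
  rewrite realcM [leRHS]exprMn -(realcX (l2norm u)) -(realcX (l2norm v)) !l2normE.
  exact: cdot_cs.
apply: le_trans (lerD le1 le1).
rewrite -[X in _ <= _ + X]norm_conjC; apply: le_trans (ler_normD _ _).
by apply: real_ler_norm; rewrite CrealE rmorphD /= conjCK addrC.
Qed.

(** The constant is the Frobenius norm of [M], by Cauchy-Schwarz on each row. It makes the supremum
    in [opnorm] finite. *)
Lemma l2norm_mul_bound m n (M : 'M[C]_(m, n)) : exists2 K : R, 0 <= K &
  forall v, l2norm (M *m v) <= K * l2norm v.
Proof.
pose S := \sum_i cdot (\col_j (M i j)^*) (\col_j (M i j)^*).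
have S0 : 0 <= S by apply: sumr_ge0 => i _; exact: cdot_ge0.
have SR : S = (complex.Re S)%:C%C by rewrite RRe_real// ger0_real.
have S0' : 0 <= complex.Re S by rewrite -ler0c -SR.
exists (Num.sqrt (complex.Re S)); first exact: sqrtr_ge0.
move=> v; apply: l2norm_le; first exact: sqrtr_ge0.
rewrite sqr_sqrtr// -SR mulr_suml; apply: ler_sum => i _.
rewrite -normCK mulrC.
have -> : (M *m v) i 0 = cdot v (\col_j (M i j)^*).
  by rewrite mxE; apply: eq_bigr => j _; rewrite mxE conjCK mulrC.
exact: cdot_cs.
Qed.

Lemma has_sup_opnorm m n (M : 'M[C]_(m, n)) :
  has_sup [set l2norm (M *m v) | v in [set v : 'cV[C]_n | l2norm v <= 1]].
Proof.
split; first by exists (l2norm (M *m 0)); exists 0 => //=; rewrite l2norm0.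
have [K K0 hK] := l2norm_mul_bound M; exists K => _ [v /= v1 <-].
by apply: le_trans (hK v) _; rewrite ler_piMr.
Qed.

Lemma opnorm_ge0 m n (M : 'M[C]_(m, n)) : 0 <= opnorm M.
Proof.
have /ubP := sup_upper_bound (has_sup_opnorm M); apply.
by exists 0 => /=; rewrite ?mulmx0 l2norm0.
Qed.

Lemma le_opnorm m n (M : 'M[C]_(m, n)) v : l2norm (M *m v) <= opnorm M * l2norm v.
Proof.
have := l2norm_ge0 v; rewrite le_eqVlt => /predU1P[v0|v0].
  by rewrite (l2norm_eq0 (esym v0)) mulmx0 !l2norm0 mulr0.
rewrite -ler_pdivrMr//.
have nu : complex.Re `|(l2norm v)^-1%:C%C| = (l2norm v)^-1.
  by rewrite ger0_norm// ler0c invr_ge0 ltW.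
have -> : l2norm (M *m v) / l2norm v = l2norm (M *m ((l2norm v)^-1%:C%C *: v)).
  by rewrite -scalemxAr l2normZ nu mulrC.
have /ubP := sup_upper_bound (has_sup_opnorm M); apply.
by exists ((l2norm v)^-1%:C%C *: v) => //=; rewrite l2normZ nu mulVf ?gt_eqF.
Qed.

Lemma opnorm_le m n (M : 'M[C]_(m, n)) (c : R) : 0 <= c ->
  (forall v, l2norm (M *m v) <= c * l2norm v) -> opnorm M <= c.
Proof.
move=> c0 h; apply: ge_sup; first by case: (has_sup_opnorm M).
by move=> _ [v /= v1 <-]; apply: le_trans (h v) _; rewrite ler_piMr.
Qed.

Lemma opnormM m n k (M : 'M[C]_(m, n)) (N : 'M[C]_(n, k)) :
  opnorm (M *m N) <= opnorm M * opnorm N.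
Proof.
apply: opnorm_le => [|v]; first by rewrite mulr_ge0 ?opnorm_ge0.
rewrite -mulmxA -mulrA; apply: le_trans (le_opnorm _ _) _.
by rewrite ler_wpM2l ?opnorm_ge0 ?le_opnorm.
Qed.

Lemma opnormD m n (M N : 'M[C]_(m, n)) : opnorm (M + N) <= opnorm M + opnorm N.
Proof.
apply: opnorm_le => [|v]; first by rewrite addr_ge0 ?opnorm_ge0.
rewrite mulmxDl mulrDl; apply: le_trans (l2normD _ _) _.
by rewrite lerD ?le_opnorm.
Qed.

Lemma opnormZ_le m n a (M : 'M[C]_(m, n)) : opnorm (a *: M) <= complex.Re `|a| * opnorm M.
Proof.
have a0 : 0 <= complex.Re `|a| by rewrite -ler0c RRe_real ?normr_real.
apply: opnorm_le => [|v]; first by rewrite mulr_ge0 ?opnorm_ge0.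
by rewrite -scalemxAl l2normZ -mulrA ler_wpM2l ?le_opnorm.
Qed.

Lemma opnorm0 m n : opnorm (0 : 'M[C]_(m, n)) = 0.
Proof.
apply/eqP; rewrite eq_le opnorm_ge0 andbT; apply: opnorm_le => // v.
by rewrite mul0mx l2norm0 mul0r.
Qed.

Lemma opnorm_sum m n (I : Type) (r : seq I) (P : pred I) (M : I -> 'M[C]_(m, n)) :
  opnorm (\sum_(i <- r | P i) M i) <= \sum_(i <- r | P i) opnorm (M i).
Proof.
elim/big_rec2: _ => [|i y x _ h]; first by rewrite opnorm0.
by apply: le_trans (opnormD _ _) _; rewrite lerD2l.
Qed.

Lemma entry_le_opnorm m n (M : 'M[C]_(m, n)) i j : `|M i j| <= (opnorm M)%:C%C.
Proof.
have l1 : l2norm (delta_mx j 0 : 'cV[C]_n) = 1.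
  apply/eqP; rewrite -(@eqrXn2 _ 2)// ?l2norm_ge0//; apply/eqP/complexI.
  by rewrite l2normE cdot_delta mxE !eqxx expr1n.
have := le_opnorm M (delta_mx j 0); rewrite l1 mulr1 => h.
apply: le_trans (_ : (l2norm (M *m delta_mx j 0))%:C%C <= _); last by rewrite lecR.
rewrite -(@ler_pXn2r _ 2) ?nnegrE ?normr_ge0 ?ler0c ?l2norm_ge0//.
rewrite -(realcX (l2norm _)) l2normE.
rewrite /cdot (bigD1 i)//= -colE mxE normCK lerDl.
by apply: sumr_ge0 => k _; rewrite mul_conjC_ge0.
Qed.

Lemma cdot_mxtens m n (v : 'cV[C]_(m * n)) : cdot v v =
  \sum_i \sum_j v (mxtens_index (i, j)) 0 * (v (mxtens_index (i, j)) 0)^*.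
Proof. by rewrite /cdot sum_mxtens. Qed.

Lemma opnorm_tens1l m n k (N : 'M[C]_(n, k)) : opnorm ((1%:M : 'M[C]_m) *t N) <= opnorm N.
Proof.
apply: opnorm_le => [|v]; first exact: opnorm_ge0.
apply: l2norm_le; first exact: opnorm_ge0.
rewrite !cdot_mxtens mulr_sumr; apply: ler_sum => i _.
have := l2norm_sqr_le (le_opnorm N (\col_j v (mxtens_index (i, j)) 0)).
rewrite {2}/cdot; under [X in _ <= _ * X -> _]eq_bigr do rewrite !mxE.
apply: le_trans; rewrite le_eqVlt; apply/orP; left; apply/eqP.
apply: eq_bigr => j _; rewrite !mxE.
have -> : \sum_l (1%:M *t N) (mxtens_index (i, j)) l * v l 0 =
    \sum_l N j l * (\col_j v (mxtens_index (i, j)) 0) l 0.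
  rewrite sum_mxtens (bigD1 i)//= [X in _ + X]big1 ?addr0 => [|a ai].
    by apply: eq_bigr => l _; rewrite tensmxE !mxE eqxx mul1r.
  by rewrite big1// => l _; rewrite tensmxE mxE eq_sym (negbTE ai) !mul0r.
by [].
Qed.

Lemma opnorm_tens1r m n k (N : 'M[C]_(n, k)) : opnorm (N *t (1%:M : 'M[C]_m)) <= opnorm N.
Proof.
apply: opnorm_le => [|v]; first exact: opnorm_ge0.
apply: l2norm_le; first exact: opnorm_ge0.
rewrite !cdot_mxtens [leLHS]exchange_big [X in _ <= _ * X]exchange_big.
rewrite mulr_sumr; apply: ler_sum => i _.
have := l2norm_sqr_le (le_opnorm N (\col_j v (mxtens_index (j, i)) 0)).
rewrite {2}/cdot; under [X in _ <= _ * X -> _]eq_bigr do rewrite !mxE.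
apply: le_trans; rewrite le_eqVlt; apply/orP; left; apply/eqP.
apply: eq_bigr => j _; rewrite !mxE.
have -> : \sum_l (N *t 1%:M) (mxtens_index (j, i)) l * v l 0 =
    \sum_l N j l * (\col_j v (mxtens_index (j, i)) 0) l 0.
  rewrite sum_mxtens; apply: eq_bigr => a _; rewrite (bigD1 i)//= big1 ?addr0 => [|l li].
    by rewrite tensmxE !mxE eqxx mulr1.
  by rewrite tensmxE mxE eq_sym (negbTE li) mulr0 mul0r.
by [].
Qed.

Lemma opnorm_tens m n k l (M : 'M[C]_(m, n)) (N : 'M[C]_(k, l)) :
  opnorm (M *t N) <= opnorm M * opnorm N.
Proof.
have -> : M *t N = (M *t 1%:M) *m (1%:M *t N) by rewrite tensmx_mul mul1mx mulmx1.
apply: le_trans (opnormM _ _) _.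
by rewrite ler_pM ?opnorm_ge0 ?opnorm_tens1l ?opnorm_tens1r.
Qed.

Lemma le_tnorm g n (X : @mxtuple R g n) j : opnorm (X j) <= tnorm X.
Proof. by rewrite /tnorm; apply: le_bigmax. Qed.

Lemma tnorm_le g n (X : @mxtuple R g n) (c : R) : 0 <= c ->
  (forall j, opnorm (X j) <= c) -> tnorm X <= c.
Proof. by move=> c0 h; apply: bigmax_le. Qed.

Lemma tnorm_ge0 g n (X : @mxtuple R g n) : 0 <= tnorm X.
Proof. exact: bigmax_ge_id. Qed.

End Norms.

(** * Conic certificates *)

Section States.
Context {R : realType}.
Local Notation C := R[i].

(** For [K = 1] and [c = 1] these are the density matrices; in [cone_certificate], [K] is the pencil
    at the scaled shift. *)
Definition psd_slice n (K : 'M[C]_n) (c : C) : set 'M[C]_n :=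
  [set M | [/\ herm M, psdmx M & \tr (K *m M) = c]].

Lemma psd_slice_convex n (K : 'M[C]_n) c M N (t : R) :
  psd_slice K c M -> psd_slice K c N -> 0 <= t <= 1 ->
  psd_slice K c (M + t%:C%C *: (N - M)).
Proof.
move=> [hM /psdmxE pM tM] [hN /psdmxE pN tN] /andP[t0 t1].
have -> : M + t%:C%C *: (N - M) = (1 - t)%:C%C *: M + t%:C%C *: N.
  by rewrite rmorphB rmorph1 scalerBl scale1r scalerBr addrAC addrA.
have rc (x : R) : (x%:C%C : C)^* = x%:C%C by rewrite conj_Creal// complex_real.
split.
- by rewrite /herm adjmxD !adjmxZ !rc hM hN.
- apply/psdmxE => v; rewrite mulmxDl cdotDl -!scalemxAl !cdotZl.
  by rewrite addr_ge0// mulr_ge0// ler0c// subr_ge0.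
- rewrite mulmxDr -!scalemxAr mxtraceD !mxtraceZ tM tN -mulrDl -rmorphD.
  by rewrite subrK rmorph1 mul1r.
Qed.

Lemma psd_slice_closed n (K : 'M[C]_n) c : ultra_closed (psd_slice K c).
Proof.
move=> F FU x M Sx xM; split.
- apply/matrixP => i j; rewrite !mxE; apply: (ucvg_unique _ (xM i j)).
  apply: (ucvg_near _ (ucvg_conj (xM j i))); apply: nearW => N /=.
  by case: (Sx N) => h _ _; rewrite -[in RHS]h !mxE.
- apply/psdmxE => v.
  have : ucvg F (fun N => cdot (x N *m v) v) (cdot (M *m v) v).
    have E Z : cdot (Z *m v) v = \sum_i (\sum_j Z i j * v j 0) * (v i 0)^*.
      by apply: eq_bigr => i _; rewrite mxE.
    rewrite E; apply: (ucvg_near (x := fun N => \sum_i (\sum_j x N i j * v j 0) * (v i 0)^*)).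
      by apply: nearW => N /=; rewrite E.
    apply: ucvg_sum => i; apply: ucvgM; last exact: ucvg_cst.
    by apply: ucvg_sum => j; apply: ucvgM => //; exact: ucvg_cst.
  by apply: ucvg_ge0; apply: nearW => N /=; case: (Sx N) => _ /psdmxE h _; exact: h.
- have E Z : \tr (K *m Z) = fdot Z (K^t*) by rewrite /fdot trmxCK.
  have h : ucvg F (fun N => fdot (x N) (K^t*)) (fdot M (K^t*)).
    by apply: ucvg_fdot => // i j; exact: ucvg_cst.
  rewrite E; apply: (ucvg_unique h); apply: (ucvg_near _ (ucvg_cst _)).
  by apply: nearW => N /=; case: (Sx N) => _ _ <-; rewrite E.
Qed.

Lemma trace_gram m n (K : 'M[C]_n) (S : 'M[C]_(n, m)) :
  \tr (K *m (S *m S^t*)) = \sum_k cdot (K *m col k S) (col k S).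
Proof.
rewrite mulmxA mxtrace_mulC /mxtrace; apply: eq_bigr => k _.
rewrite cdotE !mxE; apply: eq_bigr => i _; rewrite !mxE; congr (_ * _).
by apply: eq_bigr => j _; rewrite !mxE.
Qed.

Lemma monic_pencilE g d n (A : @mxtuple R g d) (X : mxtuple g n) :
  monic_pencil A X = 1%:M + linear_pencil A X + (linear_pencil A X)^t*.
Proof.
rewrite /monic_pencil /linear_pencil adjmx_sum; congr (_ + _).
by apply: eq_bigr => j _; rewrite adjmx_tens.
Qed.

Lemma cdot_monic_pencil g d n (A : @mxtuple R g d) (X : mxtuple g n) v :
  cdot (monic_pencil A X *m v) v =
  cdot v v + (2%:R * complex.Re (cdot (linear_pencil A X *m v) v))%:C%C.
Proof.
rewrite monic_pencilE !mulmxDl !cdotDl mul1mx -addrA; congr (_ + _).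
rewrite [cdot (_^t* *m v) v]cdot_mulmxl trmxCK [cdot v _]cdot_sym.
by rewrite realcM rmorph_nat -addcJ.
Qed.

Lemma cdot_tens_scalar m (M : 'M[C]_m) x (v : 'cV[C]_(m * 1)) :
  let w := \col_i v (mxtens_index (i, 0)) 0 in
  cdot ((M *t (x%:M : 'M_1)) *m v) v = x * cdot (M *m w) w.
Proof.
move=> w; rewrite /cdot sum_mxtens mulr_sumr; apply: eq_bigr => a _.
rewrite big_ord1 [w a 0]mxE mulrA; congr (_ * _).
rewrite mxE sum_mxtens [in RHS]mxE mulr_sumr; apply: eq_bigr => b _.
by rewrite big_ord1 tensmxE !mxE mulr1n; ring.
Qed.

(* Otherwise the point of { (\tr (A j *m rho))_j } closest to 0 is nonzero, and
   the ray it spans, conjugated, lies in the first level of the spectrahedron. *)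
Lemma free_bounded_state g d (A : @mxtuple R g d) :
  (0 < d)%N -> free_bounded (free_spectrahedron A) ->
  exists rho : 'M[C]_d,
    [/\ herm rho, psdmx rho, \tr rho = 1 & forall j, \tr (A j *m rho) = 0].
Proof.
move=> d0 [N A_bounded].
pose f (M : 'M[C]_d) : 'rV[C]_g := \row_j \tr (A j *m M).
have f_linear : linear f.
  by move=> a M M'; apply/rowP => j; rewrite !mxE mulmxDr mxtraceD -scalemxAr mxtraceZ.
pose phi := HB.pack_for {linear 'M[C]_d -> 'rV[C]_g} f (GRing.isLinear.Build _ _ _ _ f f_linear).
have phiE M : phi M = \row_j \tr (A j *m M) by [].
have phiZ a M : phi (a *: M) = a *: phi M by exact: linearZ.
have phi0 : phi 0 = 0 by exact: linear0.
clearbody phi.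
have [||||rho [hrho prho]] := @min_norm _ _ _ _ (psd_slice 1%:M 1) phi 0 1.
- exists (delta_mx (Ordinal d0) 0 *m (delta_mx (Ordinal d0) (0 : 'I_1))^t*).
  split; [exact: herm_gram|exact: psdmx_gram|].
  by rewrite trace_gram big_ord1 mul1mx col_id cdot_delta mxE !eqxx.
- by move=> *; exact: psd_slice_convex.
- move=> M i j [hM pM]; rewrite mul1mx => <-; exact: psd_entry.
- exact: psd_slice_closed.
rewrite mul1mx => trrho min; exists rho; split=>//.
suff D0 : phi rho = 0 by move=> j; have /rowP/(_ j) := D0; rewrite phiE !mxE.
set D := phi rho; apply/eqP; apply: contraT => Dn0.
(* Since the nearest point is taken to 0, minimality reads [Re <phi M, D> >= |D|^2]. *)
have {min} posD M : psd_slice 1%:M 1 M -> 0 <= complex.Re (fdot (phi M) D).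
  move=> /min; rewrite subr0 -/D -[phi M - D]addrC -scaleN1r fdot_linear mulN1r.
  rewrite [- _ + _]addrC raddfB /= subr_ge0; apply: le_trans.
  by rewrite -ler0c RRe_real ?ger0_real ?fdot_ge0.
have phi_ge0 (v : 'cV[C]_d) : 0 <= complex.Re (fdot (phi (v *m v^t*)) D).
  set c := cdot v v; have c0 : 0 <= c := cdot_ge0 v.
  case: (eqVneq c 0) => [/cdot_eq0 ->|cn0].
    by rewrite mul0mx phi0 /fdot mulmx0 mxtrace0.
  pose S := (sqrtC c)^-1 *: v.
  have vS : v = sqrtC c *: S by rewrite scalerA divff ?scale1r// sqrtC_eq0.
  have SS : psd_slice 1%:M 1 (S *m S^t*).
    split; [exact: herm_gram|exact: psdmx_gram|].
    rewrite trace_gram big_ord1 mul1mx col_id cdotZl cdotZr -/c.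
    rewrite conj_Creal ?rpredV ?ger0_real ?sqrtC_ge0//.
    by rewrite mulrA -invfM -expr2 sqrtCK mulVf.
  have -> : v *m v^t* = c *: (S *m S^t*).
    rewrite {1 2}vS adjmxZ -scalemxAl -scalemxAr scalerA.
    by rewrite conj_Creal ?ger0_real ?sqrtC_ge0// -expr2 sqrtCK.
  rewrite phiZ fdotZl.
  rewrite -(RRe_real (ger0_real c0)); have c0' : 0 <= complex.Re c.
    by rewrite -ler0c RRe_real ?ger0_real.
  have := posD _ SS; case: (fdot _ _) => a b /= a0.
  by rewrite mul0r subr0 mulr_ge0.
have [j Dj] : exists j, D 0 j != 0.
  apply/existsP; apply: contraNT Dn0 => /existsPn D0; apply/eqP/rowP => j.
  by rewrite mxE; apply/eqP; rewrite -[_ == _]negbK D0.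
pose X (s : R) : @mxtuple R g 1 := fun j => (s%:C%C * (D 0 j)^*)%:M.
have LX (s : R) (v : 'cV[C]_(d * 1)) :
    cdot (linear_pencil A (X s) *m v) v = s%:C%C *
      fdot (phi ((\col_i v (mxtens_index (i, 0)) 0) *m
                 (\col_i v (mxtens_index (i, 0)) 0)^t*)) D.
  set w := \col_i _; rewrite /linear_pencil mulmx_suml.
  rewrite fdotE big_ord1 mulr_sumr.
  have -> : cdot (\sum_j (A j *t X s j) *m v) v = \sum_j cdot ((A j *t X s j) *m v) v.
    elim/big_rec2: _ => [|k y1 y2 _ IH]; first by rewrite cdot0l.
    by rewrite cdotDl IH.
  apply: eq_bigr => k _; rewrite phiE [in RHS]mxE trace_gram big_ord1 col_id.
  rewrite cdot_tens_scalar -/w; ring.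
have Xin s : 0 <= s -> free_spectrahedron A (X s).
  move=> s0; apply/psdmxE => v; rewrite cdot_monic_pencil LX.
  rewrite addr_ge0 ?cdot_ge0// ler0c mulr_ge0//.
  have := phi_ge0 (\col_i v (mxtens_index (i, 0)) 0).
  by case: (fdot _ _) => a b /= a0; rewrite mul0r subr0 mulr_ge0.
have le_s (s : R) : 0 <= s -> s%:C%C * `|D 0 j| <= N%:C%C.
  move=> s0; have := A_bounded _ _ (Xin s s0).
  move/(le_trans (le_tnorm _ j)); rewrite -lecR; apply: le_trans.
  apply: le_trans (entry_le_opnorm (X s j) 0 0).
  by rewrite mxE eqxx mulr1n normrM norm_conjC ger0_norm// ler0c.
have Dp : 0 < complex.Re `|D 0 j| by rewrite -ltcR Re_normK normr_gt0.
have N0 : 0 <= N by have := le_s 0 (lexx _); rewrite mul0r ler0c.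
have h0 : 0 <= (N + 1) / complex.Re `|D 0 j| by rewrite divr_ge0 ?addr_ge0// ltW.
have := le_s _ h0.
rewrite -[`|D 0 j| in X in X <= _]Re_normK -realcM divfK ?gt_eqF// lecR.
by rewrite gerDl ler10.
Qed.
End States.

(** * The cone of certificates and its dual *)

Section Certificate.
Context {R : realType}.
Local Notation C := R[i].

(** The partial trace over the factor [C^d]. *)
Definition ptrace {d f} (M : 'M[C]_(d * f)) : 'M[C]_f :=
  \matrix_(x, y) \sum_i M (mxtens_index (i, x)) (mxtens_index (i, y)).

Lemma ptrace_linear d f : linear (@ptrace d f).
Proof.
move=> a M N; apply/matrixP => x y; rewrite !mxE mulr_sumr -big_split.
by apply: eq_bigr => i _; rewrite !mxE.
Qed.
HB.instance Definition _ d f :=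
  GRing.isLinear.Build C _ _ _ (@ptrace d f) (@ptrace_linear d f).

Lemma ptrace_adj d f (M : 'M[C]_(d * f)) : (ptrace M)^t* = ptrace (M^t*).
Proof.
apply/matrixP => x y; rewrite !mxE rmorph_sum; apply: eq_bigr => i _.
by rewrite !mxE.
Qed.

Lemma ptrace_tens d f (M : 'M[C]_d) (N : 'M[C]_f) : ptrace (M *t N) = \tr M *: N.
Proof.
apply/matrixP => x y; rewrite !mxE mulr_suml; apply: eq_bigr => i _.
by rewrite tensmxE.
Qed.

(** The partial trace is dual to [Y |-> 1 *t Y]; so functionals on the image of [cert_map] become
    functionals of [X]. *)
Lemma tr_mul_ptrace d f (Y : 'M[C]_f) (M : 'M[C]_(d * f)) :
  \tr (Y *m ptrace M) = \tr ((1%:M *t Y) *m M).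
Proof.
rewrite /mxtrace sum_mxtens exchange_big; apply: eq_bigr => x _.
rewrite mxE (eq_bigr (fun y => \sum_i Y x y * M (mxtens_index (i, y)) (mxtens_index (i, x)))).
  2: by move=> y _; rewrite mxE mulr_sumr.
rewrite exchange_big; apply: eq_bigr => i _; rewrite mxE sum_mxtens.
rewrite (bigD1 i)//= [X in _ = _ + X]big1 ?addr0 => [|j ji].
  by apply: eq_bigr => y _; rewrite tensmxE mxE eqxx mul1r.
by rewrite big1// => y _; rewrite tensmxE mxE eq_sym (negbTE ji) !mul0r.
Qed.

Lemma tens1 d f : (1%:M : 'M[C]_d) *t (1%:M : 'M[C]_f) = 1%:M.
Proof.
apply/matrixP => i j; case: (mxtens_indexP i) => a b; case: (mxtens_indexP j) => a' b'.
rewrite tensmxE !mxE (can_eq (@mxtens_indexK _ _)) xpair_eqE.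
by case: eqP => _; case: eqP => _; rewrite ?mulr1 ?mulr0 ?mul0r.
Qed.

Lemma inj_unitmx n (S : 'M[C]_n) : (forall x : 'cV_n, S *m x = 0 -> x = 0) -> S \in unitmx.
Proof.
move=> inj; rewrite -unitmx_tr -row_free_unit -kermx_eq0; apply/eqP/row_matrixP => i.
rewrite row0; apply: trmx_inj; rewrite trmx0; apply: inj.
by apply: trmx_inj; rewrite trmx_mul trmxK trmx0 -row_mul mulmx_ker row0.
Qed.

Section Cone.
Variables (g d f : nat) (A : @mxtuple R g d) (L : @mxtuple R g f) (T0 : 'M[C]_f).
Let M := linear_pencil A L.
Let K : 'M[C]_(d * f) := 1%:M + M + M^t*.

(** When [X] is a Gram matrix of vectors indexed by words and [L] is the scaled shift, the entries
    are, up to that scaling, the coefficients of [W^* L_A W]. The image of the positive [X] is the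
    cone in which [T0] has to lie. *)
Definition cert_map (X : 'M[C]_(d * f)) : 'M[C]_f :=
  ptrace (X + M *m X + X *m M^t*).

Lemma cert_map_linear : linear cert_map.
Proof.
move=> a X Y; rewrite /cert_map -linearP; congr ptrace.
rewrite mulmxDr mulmxDl -scalemxAr -scalemxAl !scalerDr.
by rewrite [X in X + _ = _]addrACA [LHS]addrACA.
Qed.
HB.instance Definition _ := GRing.isLinear.Build C _ _ _ cert_map cert_map_linear.

Lemma cert_map_herm X : herm X -> herm (cert_map X).
Proof.
move=> hX; rewrite /herm ptrace_adj !adjmxD !adjmxM trmxCK hX.
by rewrite addrAC.
Qed.

(** Hence only an [X] with [\tr (K *m X) = \tr T0] can be mapped to [T0]; by [tr_psd_le] this slice
    of the positive cone is bounded. *)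
Lemma tr_cert_map X : \tr (cert_map X) = \tr (K *m X).
Proof.
rewrite -[cert_map X]mul1mx tr_mul_ptrace.
rewrite tens1.
rewrite mul1mx /K !mulmxDl mul1mx !mxtraceD; congr (_ + _).
by rewrite mxtrace_mulC.
Qed.

Hypothesis K_pos : forall v : 'cV[C]_(d * f),
  2%:R^-1 * cdot v v <= cdot (K *m v) v.
Hypothesis d_gt0 : (0 < d)%N.
Hypothesis A_bounded : free_bounded (free_spectrahedron A).
Hypothesis T0_herm : herm T0.
Hypothesis T0_tr : 0 < \tr T0.
Hypothesis T0_pos : forall S : 'M[C]_f, S \in unitmx ->
  free_spectrahedron A (fun j => S *m L j *m invmx S) ->
  0 <= \tr (S^t* *m S *m T0).

Lemma tr_psd_le X : herm X -> psdmx X -> \tr X <= 2%:R * \tr (K *m X).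
Proof.
move=> hX pX; have [S ->] := psd_factor hX pX.
rewrite -[S *m S^t* in leLHS]mul1mx !trace_gram mulr_sumr; apply: ler_sum => k _.
rewrite mul1mx -ler_pdivrMl//; exact: K_pos.
Qed.

(** The pencil at [S L S^-1] and the pencil [M] at [L] are intertwined by [1 *t S]. As [1 *t S] is
    invertible, the functional with density [S^* S] is nonnegative on all rank one matrices
    precisely when the conjugated tuple lies in the spectrahedron. *)
Lemma cert_map_pencil S u : S \in unitmx ->
  cdot (monic_pencil A (fun j => S *m L j *m invmx S) *m ((1%:M *t S) *m u))
       ((1%:M *t S) *m u) =
  \tr (S^t* *m S *m cert_map (u *m u^t*)).
Proof.
move=> Su; set X := fun j => _; set w := _ *m u.
have LX : linear_pencil A X *m w = (1%:M *t S) *m (M *m u).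
  rewrite /linear_pencil !mulmx_suml mulmx_sumr; apply: eq_bigr => j _.
  rewrite /w !mulmxA !tensmx_mul mulmx1 mul1mx.
  by rewrite /X mulmxKV.
rewrite monic_pencilE !mulmxDl !cdotDl mul1mx LX.
rewrite [cdot (_^t* *m w) w]cdot_mulmxl trmxCK LX /w.
have sw x y : cdot ((1%:M *t S) *m x) ((1%:M *t S) *m y) =
    \tr ((1%:M *t (S^t* *m S)) *m (x *m y^t*)).
  rewrite cdotE -trace_mx11 adjmxM adjmx_tens adjmx1 [in RHS]mulmxA [in RHS]mxtrace_mulC.
  rewrite -mulmxA; congr (\tr (_ *m _)).
  by rewrite mulmxA tensmx_mul mul1mx.
rewrite !sw -!mxtraceD -!mulmxDr -tr_mul_ptrace /cert_map.
by rewrite adjmxM !mulmxA.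
Qed.
Lemma herm_fdot n (Z Y : 'M[C]_n) : herm Y -> fdot Z Y = \tr (Y *m Z).
Proof. by rewrite /fdot => ->. Qed.

(* If T0 is not attained, the residual D of the nearest point, shifted by a
   multiple of 1, gives a separating functional Y: it is nonnegative on the cone
   while Y(T0) < 0. Testing on rho *t (x *m x^t* ), where rho is orthogonal to all
   A j, shows that Y is positive definite, so Y = S^t* *m S, and conjugating L
   by S gives a point of the spectrahedron that contradicts T0_pos. *)
Lemma cone_certificate : exists2 X, herm X /\ psdmx X & cert_map X = T0.
Proof.
have [rho [hrho prho tr_rho A_rho]] := free_bounded_state d_gt0 A_bounded.
have trT0 := T0_tr; set c0 := \tr T0 in trT0.
have c0R : c0 = (complex.Re c0)%:C%C by rewrite RRe_real// gtr0_real.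
have c0p : 0 < complex.Re c0 by rewrite -ltcR -c0R.
have f_gt0 : (0 < f)%N.
  rewrite lt0n; apply/eqP => f0; move: trT0; rewrite /c0 /mxtrace.
  rewrite big1 ?ltxx// => i _; exfalso; have := ltn_ord i; by rewrite {2}f0.
have herm1 : herm (1%:M : 'M[C]_(d * f)) by rewrite /herm adjmx1.
have psd1 : psdmx (1%:M : 'M[C]_(d * f)).
  by apply/psdmxE => v; rewrite mul1mx cdot_ge0.
have trK : 0 < \tr K.
  have := tr_psd_le herm1 psd1; rewrite mulmx1 mxtrace1 => h.
  have : 0 < 2%:R * \tr K.
    by apply: lt_le_trans h; rewrite ltr0n muln_gt0 d_gt0.
  by rewrite pmulr_rgt0.
pose S := psd_slice K c0.
have [|M1 M2 t|||X [hX pX tX] min] :=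
    @min_norm _ _ _ _ S cert_map T0 (2%:R * c0).
- exists ((c0 / \tr K) *: 1%:M); split.
  + by rewrite /herm adjmxZ adjmx1 conj_Creal// ger0_real// divr_ge0// ltW.
  + apply/psdmxE => v; rewrite -scalemxAl mul1mx cdotZl mulr_ge0 ?cdot_ge0//.
    by rewrite divr_ge0// ltW.
  + by rewrite -scalemxAr mulmx1 mxtraceZ divfK// gt_eqF.
- exact: psd_slice_convex.
- move=> X i j [hX pX tX]; apply: le_trans (psd_entry i j hX pX) _.
  by apply: le_trans (tr_psd_le hX pX) _; rewrite tX.
- exact: psd_slice_closed.
exists X => //; set D := cert_map X - T0 in min.
apply/eqP; rewrite -subr_eq0 -/D; apply: contraT => Dn0; exfalso.
have hD : herm D by rewrite /herm /D -scaleN1r adjmxD adjmxZ rmorphN1 T0_herm cert_map_herm.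
pose q := complex.Re (fdot D D).
have q0 : 0 < q.
  rewrite lt_neqAle eq_sym; apply/andP; split; last by rewrite -ler0c RRe_real ?ger0_real ?fdot_ge0.
  apply: contra Dn0 => /eqP q0; apply/eqP/fdot_eq0.
  by rewrite -[LHS]RRe_real ?ger0_real ?fdot_ge0// -/q q0.
pose a := complex.Re (fdot T0 D).
(* On the slice the pairing with [D] is at least [a + q], while it is [a] at [T0]. All these images
   have trace [c0], so a multiple of the trace can subtract the midpoint [a + q / 2] and make the
   separation homogeneous. *)
pose lam := - (a + q / 2%:R) / complex.Re c0.
pose Y := D + lam%:C%C *: 1%:M.
have lamR : (lam%:C%C : C)^* = lam%:C%C by rewrite conj_Creal// complex_real.
have hY : herm Y by rewrite /herm adjmxD adjmxZ adjmx1 hD lamR.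
have fY Z : fdot Z Y = fdot Z D + lam%:C%C * \tr Z.
  rewrite !herm_fdot// mulmxDl mxtraceD -scalemxAl mul1mx mxtraceZ//.
have lamc : lam * complex.Re c0 = - (a + q / 2%:R) by rewrite divfK// gt_eqF.
have T0Y : complex.Re (fdot T0 Y) = - (q / 2%:R).
  rewrite fY -/c0 c0R -realcM raddfD /= -/a lamc; ring.
have posS Z : S Z -> 0 < complex.Re (fdot (cert_map Z) Y).
  move=> SZ; have := min _ SZ; case: (SZ) => hZ pZ tZ.
  rewrite fY tr_cert_map tZ c0R -realcM raddfD /= lamc.
  have -> : fdot (cert_map Z - cert_map X) D = fdot (cert_map Z) D - (fdot D D + fdot T0 D).
    rewrite /fdot -mxtraceD -mulmxDr /D subrK mulmxBr raddfB//.
  rewrite !raddfB raddfD /= -/q -/a => h; lra.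
(* By homogeneity, positivity spreads from the slice to every ray that meets it. *)
have pos0 Z : herm Z -> psdmx Z -> 0 < \tr (K *m Z) ->
    0 < complex.Re (fdot (cert_map Z) Y).
  move=> hZ pZ tZ; set k := \tr _ in tZ.
  have kR : k = (complex.Re k)%:C%C by rewrite RRe_real// gtr0_real.
  have kp : 0 < complex.Re k by rewrite -ltcR -kR.
  pose s := complex.Re c0 / complex.Re k.
  have s0 : 0 < s by rewrite divr_gt0.
  have sR : (s%:C%C : C)^* = s%:C%C by rewrite conj_Creal// complex_real.
  have : S (s%:C%C *: Z).
    split.
    - by rewrite /herm adjmxZ hZ sR.
    - apply/psdmxE => v; rewrite -scalemxAl cdotZl mulr_ge0 ?ler0c ?(ltW s0)//.
      by move/psdmxE : pZ; apply.
    - by rewrite -scalemxAr mxtraceZ -/k kR -realcM divfK ?gt_eqF// -c0R.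
  move=> /posS; rewrite linearZ fdotZl; case: (fdot _ _) => x y /=.
  by rewrite mul0r subr0 pmulr_rgt0.
have pos1 Z : herm Z -> psdmx Z -> 0 <= complex.Re (fdot (cert_map Z) Y).
  move=> hZ pZ; have tr0 : 0 <= \tr Z.
    have [Q ->] := psd_factor hZ pZ; rewrite -[_ *m _]mul1mx trace_gram.
    by rewrite sumr_ge0// => k _; rewrite mul1mx cdot_ge0.
  have : 0 <= \tr (K *m Z).
    have := le_trans tr0 (tr_psd_le hZ pZ); by rewrite pmulr_rge0.
  rewrite le_eqVlt => /predU1P[k0|]; last by move/(pos0 _ hZ pZ)/ltW.
  have Z0 : Z = 0.
    apply/matrixP => i j; rewrite [RHS]mxE; apply/eqP; rewrite -normr_le0.
    apply: le_trans (psd_entry i j hZ pZ) _.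
    by apply: le_trans (tr_psd_le hZ pZ) _; rewrite -k0 mulr0.
  by rewrite Z0 linear0 /fdot mulmx0 mxtrace0.
have Ypos (x : 'cV[C]_f) : x != 0 -> 0 < cdot (Y *m x) x.
  move=> x0; have [Q rQ] := psd_factor hrho prho.
  pose Z := rho *t (x *m x^t*).
  have ZE : Z = (Q *t x) *m (Q *t x)^t* by rewrite adjmx_tens tensmx_mul -rQ.
  have hZ : herm Z by rewrite ZE; exact: herm_gram.
  have pZ : psdmx Z by rewrite ZE; exact: psdmx_gram.
  have MZ : ptrace (M *m Z) = 0.
    rewrite /M /linear_pencil mulmx_suml linear_sum big1// => j _.
    by rewrite /= /Z tensmx_mul ptrace_tens A_rho scale0r.
  have cZ : cert_map Z = x *m x^t*.
    rewrite /cert_map !linearD /= MZ -[Z *m _]trmxCK adjmxM trmxCK hZ -ptrace_adj MZ.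
    rewrite trmx0 map_mx0 !addr0 ptrace_tens tr_rho scale1r//.
  have xx : \tr (x *m x^t*) = cdot x x.
    by rewrite -[x *m _]mul1mx trace_gram big_ord1 mul1mx col_id.
  have xp : 0 < cdot x x.
    rewrite lt_neqAle cdot_ge0 andbT eq_sym; apply: contra x0 => /eqP/cdot_eq0->//.
  have YR : cdot (Y *m x) x \is Num.real.
    by rewrite CrealE -cdot_sym -{1}hY -cdot_mulmxl.
  have := pos0 Z hZ pZ; rewrite -tr_cert_map cZ xx => /(_ xp).
  rewrite herm_fdot// trace_gram big_ord1 col_id.
  by rewrite -ltcR RRe_real.
have pY : psdmx Y.
  apply/psdmxE => x; case: (eqVneq x 0) => [->|/Ypos/ltW//].
  by rewrite mulmx0 cdot0l.
have [Q YQ] := psd_factor hY pY.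
have Qu : Q^t* \in unitmx.
  apply: inj_unitmx => x Qx; apply/eqP; apply: contraT => /Ypos.
  by rewrite YQ -mulmxA Qx mulmx0 cdot0l ltxx.
have YE : (Q^t*)^t* *m Q^t* = Y by rewrite trmxCK -YQ.
have := T0_pos Qu; rewrite YE -(herm_fdot _ hY) => h.
have Xin : free_spectrahedron A (fun j => Q^t* *m L j *m invmx (Q^t*)).
  apply/psdmxE => v.
  pose u := (1%:M *t invmx (Q^t*)) *m v.
  have vu : v = (1%:M *t Q^t*) *m u.
    rewrite /u mulmxA tensmx_mul mulmxV// mulmx1.
    rewrite tens1 mul1mx//.
  have := cert_map_pencil u Qu; rewrite -vu YE => E.
  move: (E); rewrite cdot_monic_pencil -(herm_fdot _ hY) => E'.
  have := pos1 _ (herm_gram u) (psdmx_gram u); rewrite -E'.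
  rewrite -[cdot v v]RRe_real ?ger0_real ?cdot_ge0// -rmorphD ler0c.
  by rewrite raddfD /=.
by have := h Xin; rewrite lecE T0Y /= => /andP[_]; rewrite oppr_ge0 leNgt divr_gt0.
Qed.
End Cone.
End Certificate.

(** * The lurking isometry *)

Section Lurking.
Context {R : realType}.
Local Notation C := R[i].

Local Notation "B ^!" := (orthomx Num.conj (mx_of_hermitian (hermitian1mx _)) B)
  : matrix_set_scope.

(** An orthonormal basis of the complement of the row space of [U] completes the rows of [U] to an
    orthonormal basis. *)
Lemma coisometry_complement r n (U : 'M[C]_(r, n)) : U *m U^t* = 1%:M ->
  exists Q : 'M[C]_(n - r, n),
    [/\ Q *m Q^t* = 1%:M, U *m Q^t* = 0 & U^t* *m U + Q^t* *m Q = 1%:M].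
Proof.
move=> /unitarymxP Uu; have rU := mxrank_unitary Uu.
pose B := row_base U^!%MS.
have [s [sE [Q [Qu QU]]]] : exists s, s = (n - r)%N /\ exists Q : 'M[C]_(s, n),
    Q \is unitarymx /\ (Q <= U^!)%MS.
  exists (\rank U^!); split; first by rewrite rank_ortho rU.
  exists (schmidt B); split; first by rewrite schmidt_unitarymx// rank_leq_col.
  by rewrite eqmx_schmidt_free ?row_base_free// eq_row_base.
move: Q Qu QU; rewrite sE => Q Qu QU.
have UQ : U *m Q^t* = 0.
  have /orthomx1P h := QU.
  by rewrite -[LHS]trmxCK adjmxM trmxCK h trmx0 map_mx0.
exists Q; split=> //; first exact/unitarymxP.
set E := _ + _; pose F := col_mx U Q.
have Fu : F \is unitarymx.
  apply/unitarymxP; rewrite tr_col_mx map_row_mx mul_col_row UQ.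
  have QU0 : Q *m U^t* = 0 by rewrite -[LHS]trmxCK adjmxM trmxCK UQ trmx0 map_mx0.
  move/unitarymxP: Uu => ->; move/unitarymxP: Qu => ->.
  by rewrite QU0 -scalar_mx_block.
have rn : (r <= n)%N by rewrite -rU rank_leq_col.
have Ff : row_full F by rewrite /row_full (mxrank_unitary Fu) subnKC.
have [D DF] := submxP (submx_full (1%:M : 'M[C]_n) Ff).
(* [F] has the left inverse [D], so [F E = F] forces [E = 1]. *)
have FE : F *m E = F.
  rewrite mul_col_mx !mulmxDr !mulmxA UQ; move/unitarymxP: Uu => ->.
  have QU0 : Q *m U^t* = 0 by rewrite -[LHS]trmxCK adjmxM trmxCK UQ trmx0 map_mx0.
  by rewrite QU0; move/unitarymxP: Qu => ->; rewrite !mul1mx !mul0mx addr0 add0r.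
by rewrite -[E]mul1mx DF -mulmxA FE.
Qed.

(** An orthonormal basis of the row space of [P'] has the form [Z P']. The Gram matrices agree, so
    the same combinations [Z Q'] are orthonormal; the unitary matches these two bases, and bases of
    the complements, which have the same dimension. *)
Lemma isometry_extension n k (P Q : 'M[C]_(n, k)) : P^t* *m P = Q^t* *m Q ->
  exists T : 'M[C]_n, [/\ T^t* *m T = 1%:M, T *m T^t* = 1%:M & T *m P = Q].
Proof.
move=> PQ; pose P' := P^t*; pose Q' := Q^t*.
have PQ' : P' *m P'^t* = Q' *m Q'^t* by rewrite !trmxCK.
pose r := \rank P'; pose U1 := schmidt (row_base P').
have U1u : U1 *m U1^t* = 1%:M.
  by apply/unitarymxP; rewrite schmidt_unitarymx// rank_leq_col.
have U1P : (U1 :=: P')%MS.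
  by apply: (eqmx_trans (eqmx_schmidt_free (row_base_free _))); exact: eq_row_base.
have [X XE] : exists X, P' = X *m U1 by apply/submxP; rewrite U1P.
have [Z ZE] : exists Z, U1 = Z *m P' by apply/submxP; rewrite U1P.
pose U2 := Z *m Q'.
have U2u : U2 *m U2^t* = 1%:M.
  by rewrite adjmxM -mulmxA [Q' *m (_ *m _)]mulmxA -PQ' -mulmxA [Z *m _]mulmxA -ZE -adjmxM -ZE.
(* The difference is [Y Q'] for a [Y] that annihilates [P']; its norm depends only on the common
   Gram matrix, so it vanishes. *)
have QX : Q' = X *m U2.
  apply/eqP; rewrite -subr_eq0; apply/eqP.
  pose Y : 'M_k := 1%:M - X *m Z.
  have YE (S : 'M[C]_(k, n)) : S - X *m (Z *m S) = Y *m S.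
    by rewrite mulmxBl mul1mx mulmxA.
  have YP : Y *m P' = 0 by rewrite -YE -ZE -XE subrr.
  rewrite YE; have : fdot ((Y *m Q')^t*) ((Y *m Q')^t*) = 0.
    rewrite /fdot trmxCK adjmxM -mulmxA [Q' *m (_ *m _)]mulmxA -PQ'.
    by rewrite !mulmxA YP !mul0mx mxtrace0.
  by move/fdot_eq0 => h; rewrite -[LHS]trmxCK h trmx0 map_mx0.
have [R1 [R1u UR1 E1]] := coisometry_complement U1u.
have [R2 [R2u UR2 E2]] := coisometry_complement U2u.
pose T := U1^t* *m U2 + R1^t* *m R2.
have TE : T^t* = U2^t* *m U1 + R2^t* *m R1 by rewrite adjmxD !adjmxM !trmxCK.
have adj0 m1 m2 (S : 'M[C]_(m1, n)) (S' : 'M_(m2, n)) : S *m S'^t* = 0 -> S' *m S^t* = 0.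
  by move=> h; rewrite -[LHS]trmxCK adjmxM trmxCK h trmx0 map_mx0.
have k0 m1 m2 (a : 'M[C]_(n, m1)) (b : 'M_(m1, n)) (c : 'M_(n, m2)) (s : 'M[C]_(m2, n)) :
    b *m c = 0 -> a *m b *m (c *m s) = 0.
  by move=> h; rewrite -mulmxA (mulmxA b) h mul0mx mulmx0.
have k1 m1 (a : 'M[C]_(n, m1)) (b : 'M_(m1, n)) (c : 'M_(n, m1)) (s : 'M[C]_(m1, n)) :
    b *m c = 1%:M -> a *m b *m (c *m s) = a *m s.
  by move=> h; rewrite -mulmxA (mulmxA b) h mul1mx.
have T1 : T^t* *m T = 1%:M.
  rewrite TE mulmxDl !mulmxDr (k1 _ _ _ _ _ U1u) (k1 _ _ _ _ _ R1u).
  by rewrite (k0 _ _ _ _ _ _ UR1) (k0 _ _ _ _ _ _ (adj0 _ _ _ _ UR1)) addr0 add0r.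
have T2 : T *m T^t* = 1%:M.
  rewrite TE mulmxDl !mulmxDr (k1 _ _ _ _ _ U2u) (k1 _ _ _ _ _ R2u).
  by rewrite (k0 _ _ _ _ _ _ UR2) (k0 _ _ _ _ _ _ (adj0 _ _ _ _ UR2)) addr0 add0r.
have PT : P' *m T = Q'.
  have PS (S : 'M[C]_n) : P' *m S = X *m (U1 *m S) by rewrite mulmxA -XE.
  rewrite PS mulmxDr [U1 *m (_ *m _)]mulmxA U1u mul1mx [U1 *m (_ *m _)]mulmxA UR1.
  by rewrite mul0mx addr0 -QX.
exists (T^t*); rewrite trmxCK; split=>//.
by rewrite -[LHS]trmxCK adjmxM trmxCK PT trmxCK.
Qed.

Lemma col_mulmx m n k (M : 'M[C]_(m, n)) (S : 'M[C]_(n, k)) j :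
  col j (M *m S) = M *m col j S.
Proof. by rewrite !colE mulmxA. Qed.

(* By the last hypothesis A_j w_u |-> w_{ju} + A_j w_u is isometric; extended to a
   unitary T it gives w_{ju} = (T - 1) A_j w_u. *)
Lemma lurking_isometry g d e m N (A : @mxtuple R g d) (G : word g -> 'M[C]_e)
    (w : word g -> 'I_e -> 'cV[C]_(d * m)) :
  let a j : 'M[C]_(d * m) := A j *t 1%:M in
  (forall b b', cdot (w [::] b') (w [::] b) = (b' == b)%:R) ->
  (forall j u b b', (size u < N)%N ->
     cdot (w (j :: u) b' + a j *m w u b') (w [::] b) = G (j :: u) b b') ->
  (forall j u b' k v b, (size u < N)%N -> (size v < N)%N ->
     cdot (w (j :: u) b' + a j *m w u b') (w (k :: v) b + a k *m w v b)
     = cdot (a j *m w u b') (a k *m w v b)) ->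
  exists (T : 'M[C]_(d * m)) (V : 'M[C]_(d * m, e)),
    [/\ T^t* *m T = 1%:M, T *m T^t* = 1%:M, V^t* *m V = 1%:M
      & forall j u, (size u < N)%N ->
        G (j :: u) = V^t* *m (T *m (a j *m (mxword (rmx A T) u *m V)))].
Proof.
move=> a E0 E1 E2.
pose J := ('I_g * N.-bseq 'I_g * 'I_e)%type.
(* The index type also contains the words of length N, whose successors leave the truncation; both
   families are 0 there. *)
pose pc (z : J) := if (size z.1.2 < N)%N then a z.1.1 *m w z.1.2 z.2 else 0.
pose qc (z : J) := if (size z.1.2 < N)%N
  then w (z.1.1 :: z.1.2) z.2 + a z.1.1 *m w z.1.2 z.2 else 0.
pose P := \matrix_(i < d * m, y < #|{: J}|) pc (enum_val y) i 0.
pose Q := \matrix_(i < d * m, y < #|{: J}|) qc (enum_val y) i 0.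
have [|T [T1 T2 TPQ]] := @isometry_extension _ _ P Q.
  apply/matrixP => x y.
  have -> : (P^t* *m P) x y = cdot (pc (enum_val y)) (pc (enum_val x)).
    by rewrite mxE; apply: eq_bigr => i _; rewrite !mxE mulrC.
  have -> : (Q^t* *m Q) x y = cdot (qc (enum_val y)) (qc (enum_val x)).
    by rewrite mxE; apply: eq_bigr => i _; rewrite !mxE mulrC.
  rewrite /pc /qc; case: ifP => uN; case: ifP => vN; rewrite ?cdot0l ?cdot0r//.
  by rewrite E2.
have Ta j u b : (size u < N)%N -> T *m (a j *m w u b) = w (j :: u) b + a j *m w u b.
  move=> uN; pose z : J := (j, Bseq (ltnW uN), b).
  have := congr1 (col (enum_rank z)) TPQ; rewrite col_mulmx.
  have -> : col (enum_rank z) P = a j *m w u b.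
    by apply/colP => i; rewrite !mxE enum_rankK /pc /= uN mxE.
  move=> ->; apply/colP => i; rewrite !mxE enum_rankK /qc /= uN !mxE//.
pose V := \matrix_(i < d * m, b < e) w [::] b i 0.
have colV b : col b V = w [::] b by apply/colP => i; rewrite !mxE.
have V1 : V^t* *m V = 1%:M.
  apply/matrixP => b b'; rewrite mxE [RHS]mxE eq_sym -E0.
  by apply: eq_bigr => i _; rewrite !mxE mulrC.
exists T, V; split=> // j u uN.
have wE u' b : (size u' <= N)%N -> mxword (rmx A T) u' *m w [::] b = w u' b.
  elim: u' => [|k u' IH] /= u'N; first by rewrite /mxword big_nil mul1mx.
  rewrite /mxword big_cons -mulmxA IH 1?ltnW// /rmx -mulmxA mulmxBl mul1mx.
  by rewrite Ta// addrK.
apply/matrixP => b b'.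
rewrite -[LHS](E1 j u b b' uN) -Ta// -(wE u b' (ltnW uN)) -colV.
rewrite -!col_mulmx mxE; apply: eq_bigr => i _.
by rewrite -colV !mxE mulrC.
Qed.

End Lurking.

(** * Truncated Fock space *)

Section Fock.
Context {R : realType}.
Local Notation C := R[i].
Variables (g N e : nat).

(** A basis of Fock space truncated at length N, with e independent vacuum vectors because [G] has e
    by e coefficients; scalar functions use [e = 1]. *)
Definition fock : predArgType := (N.-bseq 'I_g * 'I_e)%type.
Local Notation f := #|{: fock}|.

Definition fword (x : 'I_f) : word g := (enum_val x).1.
Definition fslot (x : 'I_f) : 'I_e := (enum_val x).2.

Definition fvec (w : word g) (b : 'I_e) : 'cV[C]_f :=
  \col_x ((fword x == w) && (fslot x == b))%:R.

Definition fshift (j : 'I_g) : 'M[C]_f :=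
  \matrix_(x, y) ((fword x == j :: fword y) && (fslot x == fslot y))%:R.

Lemma fword_size x : (size (fword x) <= N)%N.
Proof. exact: size_bseq. Qed.

Lemma fword_inj x y : fword x = fword y -> fslot x = fslot y -> x = y.
Proof.
move=> xy1 xy2; apply: enum_val_inj; apply: injective_projections =>//.
exact: val_inj.
Qed.

Lemma fock_index w b : (size w <= N)%N -> exists2 x, fword x = w & fslot x = b.
Proof.
move=> wN; exists (enum_rank ((Bseq wN, b) : fock)); by rewrite /fword /fslot enum_rankK.
Qed.

Lemma fvec_index x : fvec (fword x) (fslot x) = delta_mx x 0.
Proof.
apply/colP => y; rewrite !mxE andbT; congr (_%:R); congr nat_of_bool.
apply/andP/eqP => [[/eqP xy1 /eqP xy2]|->]; last by rewrite !eqxx.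
exact: fword_inj.
Qed.

Lemma fvec_out w b : (N < size w)%N -> fvec w b = 0.
Proof.
move=> Nw; apply/colP => x; rewrite !mxE; case: eqP => //= xw.
by move: Nw; rewrite -xw ltnNge fword_size.
Qed.

Lemma fshift_fvec j w b : fshift j *m fvec w b = fvec (j :: w) b.
Proof.
have [wN|Nw] := leqP (size w) N; last by rewrite !fvec_out ?mulmx0//= ltnW.
have [x <- <-] := fock_index b wN; rewrite fvec_index -colE.
by apply/colP => y; rewrite !mxE.
Qed.

Lemma fshift_word w v b : mxword fshift w *m fvec v b = fvec (w ++ v) b.
Proof.
elim: w => [|j w IH]; first by rewrite /mxword big_nil mul1mx.
by rewrite /mxword big_cons -mulmxA IH fshift_fvec.
Qed.

Lemma fshift_nilp w : (N < size w)%N -> mxword fshift w = 0.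
Proof.
move=> Nw; apply/matrixP => x y; rewrite [RHS]mxE.
have -> : mxword fshift w x y = (mxword fshift w *m delta_mx y (0 : 'I_1)) x 0.
  by rewrite -colE mxE.
by rewrite -fvec_index fshift_word fvec_out ?mxE// size_cat ltn_addr.
Qed.

Lemma fshift_row0 j x : fword x = [::] -> (row x (fshift j))^T = 0.
Proof. by move=> x0; apply/colP => y; rewrite !mxE x0. Qed.

(** Read by rows, the shift deletes the first letter. The entries of the certificate involve rows,
    which is how the vector of [u] comes to stand beside that of [k :: u]. *)
Lemma fshift_rowS j k u x : fword x = k :: u ->
  (row x (fshift j))^T = (j == k)%:R *: fvec u (fslot x).
Proof.
move=> xu; apply/colP => y; rewrite !mxE xu eqseq_cons eq_sym -natrM mulnb.
by rewrite -andbA [u == _]eq_sym [fslot x == _]eq_sym.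
Qed.

Lemma sum_words (V : lmodType C) (F : word g -> V) u : (size u <= N)%N ->
  \sum_(k < N.+1) \sum_(w : k.-tuple 'I_g) (u == w :> seq _)%:R *: F w = F u.
Proof.
move=> uN; rewrite (bigD1 (Ordinal (uN : (size u < N.+1)%N)))//=.
rewrite (bigD1 (in_tuple u))//= eqxx scale1r !big1 ?addr0//.
  move=> k kn; apply: big1 => w _; case: eqP => [uw|]; rewrite ?scale0r//.
  by case/eqP: kn; apply: val_inj; rewrite /= uw size_tuple.
move=> w; rewrite -val_eqE /= eq_sym => /negbTE ->; exact: scale0r.
Qed.

End Fock.

(** * Scaled pencils and finite-dimensional realizations *)

Section Pencils.
Context {R : realType}.
Local Notation C := R[i].

Lemma tensmxZr m n k l (c : C) (M : 'M[C]_(m, n)) (S : 'M[C]_(k, l)) :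
  M *t (c *: S) = c *: (M *t S).
Proof. by apply/matrixP => i j; rewrite !mxE mulrCA. Qed.

Lemma linear_pencilZ g d n (A : @mxtuple R g d) (X : mxtuple g n) c :
  linear_pencil A (fun j => c *: X j) = c *: linear_pencil A X.
Proof. by rewrite /linear_pencil scaler_sumr; apply: eq_bigr => j _; rewrite tensmxZr. Qed.

Lemma mxword_nil g n (X : @mxtuple R g n) : mxword X [::] = 1%:M.
Proof. by rewrite /mxword big_nil. Qed.

Lemma mxword_cons g n (X : @mxtuple R g n) j w :
  mxword X (j :: w) = X j *m mxword X w.
Proof. by rewrite /mxword big_cons. Qed.

Lemma mxwordZ g n (X : @mxtuple R g n) c w :
  mxword (fun j => c *: X j) w = c ^+ size w *: mxword X w.
Proof.
elim: w => [|j w IH]; first by rewrite !mxword_nil scale1r.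
by rewrite !mxword_cons IH -scalemxAl -scalemxAr scalerA exprS.
Qed.

Lemma mxword_conj g n (S : 'M[C]_n) (X : @mxtuple R g n) w : S \in unitmx ->
  mxword (fun j => S *m X j *m invmx S) w = S *m mxword X w *m invmx S.
Proof.
move=> Su; elim: w => [|j w IH]; first by rewrite !mxword_nil mulmx1 mulmxV.
by rewrite !mxword_cons IH !mulmxA mulmxKV.
Qed.

Lemma abs_cdot_le n (u v : 'cV[C]_n) : complex.Re `|cdot u v| <= l2norm u * l2norm v.
Proof.
rewrite -lecR Re_normK -(@ler_pXn2r _ 2) ?nnegrE ?normr_ge0 ?ler0c ?mulr_ge0 ?l2norm_ge0//.
rewrite realcM [leRHS]exprMn -(realcX (l2norm u)) -(realcX (l2norm v)) !l2normE.
exact: cdot_cs.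
Qed.

Lemma ReN_le (z : C) : - complex.Re `|z| <= complex.Re z.
Proof.
rewrite lerNl -lecR Re_normK -[`|z|]normrN.
by apply: le_trans (normc_ge_Re (- z)); rewrite lecR raddfN /= ler_norm.
Qed.

Lemma small_pencil_pos n (M : 'M[C]_n) : exists2 t : R, 0 < t &
  forall v, 2%:R^-1 * cdot v v <=
    cdot ((1%:M + t%:C%C *: M + (t%:C%C *: M)^t*) *m v) v.
Proof.
have [K K0 hK] := l2norm_mul_bound M.
(* Then [t * K <= 1/4], so the two adjoint terms together cost at most half of [cdot v v]. *)
pose t := (4%:R * (K + 1))^-1.
have K1 : 0 < 4%:R * (K + 1) by rewrite mulr_gt0// ltr_wpDl.
have t0 : 0 < t by rewrite invr_gt0.
exists t => // v.
rewrite adjmxZ [(t%:C%C)^*]conj_Creal ?complex_real//.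
rewrite !mulmxDl !cdotDl mul1mx -!scalemxAl !cdotZl.
rewrite [cdot (_^t* *m v) v]cdot_mulmxl trmxCK [cdot v (M *m v)]cdot_sym -addrA -mulrDr.
set z := cdot (M *m v) v.
have -> : z + z^* = (2%:R * complex.Re z)%:C%C by rewrite realcM rmorph_nat -addcJ.
rewrite -l2normE -realcM -realcD.
have -> : 2%:R^-1 * (l2norm v ^+ 2)%:C%C = (2%:R^-1 * l2norm v ^+ 2)%:C%C :> C.
  rewrite [RHS]realcM; congr (_ * _).
  by apply: (can_inj (@invrK _)); rewrite invrK -[RHS]fmorphV /= invrK rmorph_nat.
rewrite lecR.
have h1 : - (K * l2norm v ^+ 2) <= complex.Re z.
  apply: le_trans (ReN_le z); rewrite lerN2; apply: le_trans (abs_cdot_le _ _) _.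
  by rewrite expr2 mulrA ler_wpM2r ?l2norm_ge0.
have tK : t * K <= 4%:R^-1.
  rewrite /t invfM -mulrA; apply: ler_piMr; first by rewrite invr_ge0.
  by rewrite ler_pdivrMl ?ltr_wpDl// mulr1 lerDl.
have h2 : - (t * K * l2norm v ^+ 2) <= t * complex.Re z.
  by rewrite -mulrA -mulrN ler_pM2l.
have h3 : t * K * l2norm v ^+ 2 <= 4%:R^-1 * l2norm v ^+ 2.
  by rewrite ler_wpM2r// exprn_ge0// l2norm_ge0.
have h4 : - (4%:R^-1 * l2norm v ^+ 2) <= t * complex.Re z.
  by apply: le_trans h2; rewrite lerN2.
rewrite [t * (2%:R * _)]mulrCA; move: h4.
move: (l2norm v ^+ 2) (t * complex.Re z) => L y h; lra.
Qed.

Definition slot {e f} (b : 'I_e) (v : 'cV[C]_(e * f)) : 'cV[C]_f :=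
  \col_i v (mxtens_index (b, i)) 0.

Lemma slot_linear e f b : linear (@slot e f b).
Proof. by move=> a u v; apply/colP => i; rewrite !mxE. Qed.
HB.instance Definition _ e f b := GRing.isLinear.Build C _ _ _ (@slot e f b) (slot_linear b).

Lemma slot_tens e e' f f' b (M : 'M[C]_(e, e')) (Z : 'M[C]_(f, f')) v :
  slot b ((M *t Z) *m v) = \sum_b' M b b' *: (Z *m slot b' v).
Proof.
apply/colP => i; rewrite mxE mxE sum_mxtens summxE; apply: eq_bigr => b' _.
rewrite !mxE mulr_sumr; apply: eq_bigr => k _.
by rewrite tensmxE !mxE mulrA.
Qed.

Lemma cdot_slot e f (u v : 'cV[C]_(e * f)) : cdot u v = \sum_b cdot (slot b u) (slot b v).
Proof.
rewrite /cdot sum_mxtens; apply: eq_bigr => b _; apply: eq_bigr => i _.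
by rewrite !mxE.
Qed.

Lemma cdot_suml n (I : Type) (r : seq I) (P : pred I) (u : I -> 'cV[C]_n) v :
  cdot (\sum_(i <- r | P i) u i) v = \sum_(i <- r | P i) cdot (u i) v.
Proof.
elim/big_rec2: _ => [|i y x _ <-]; first by rewrite cdot0l.
by rewrite cdotDl.
Qed.

Lemma tr_adj n (M : 'M[C]_n) : \tr (M^t*) = (\tr M)^*.
Proof. by rewrite /mxtrace rmorph_sum; apply: eq_bigr => i _; rewrite !mxE. Qed.

(** Words of length N are included, so this is the exact value of the series at a tuple whose words
    longer than N vanish. *)
Definition trunc_eval {g e n} N (G : word g -> 'M[C]_e) (X : mxtuple g n) : 'M[C]_(e * n) :=
  \sum_(k < N.+1) \sum_(w : k.-tuple 'I_g) G w *t mxword X w.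

(* The vectors W_y are the rows of a square root S of the Gram matrix. *)
Lemma ptrace_gram d f m (S : 'M[C]_(d * f, m)) (B : 'M[C]_d) (Z : 'M[C]_f) y x :
  let W := \matrix_(k < d * m, y < f)
    S (mxtens_index ((mxtens_unindex k).1, y)) (mxtens_unindex k).2 in
  ptrace ((B *t Z) *m (S *m S^t*)) y x =
  cdot ((B *t 1%:M) *m (W *m (row y Z)^T)) (col x W).
Proof.
move=> W; rewrite mxE cdot_slot; apply: eq_bigr => i _.
have slotW l z : slot l (col z W) = (row (mxtens_index (l, z)) S)^T.
  by apply/colP => a; rewrite !mxE mxtens_indexK.
rewrite slot_tens cdot_suml mxE sum_mxtens; apply: eq_bigr => l _.
rewrite mul1mx.
have -> : W *m (row y Z)^T = \sum_z Z y z *: col z W.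
  apply/colP => k; rewrite mxE summxE; apply: eq_bigr => z _.
  by rewrite !mxE mulrC.
rewrite linear_sum cdotZl cdot_suml mulr_sumr; apply: eq_bigr => z _.
rewrite linearZ cdotZl /= !slotW tensmxE -mulrA; congr (_ * (_ * _)).
by rewrite mxE; apply: eq_bigr => a _; rewrite !mxE.
Qed.

(* The vectors w_u fed to the lurking isometry are read off a Gram matrix, the
   certificate for the truncated shift. The shift is scaled by a small t so that
   its pencil is positive, which the factors s ^+ size u undo. *)
Lemma finite_realization g d e N (A : @mxtuple R g d) (G : word g -> 'M[C]_e) :
  (0 < d)%N -> free_bounded (free_spectrahedron A) -> G [::] = 0 ->
  (forall n (X : mxtuple g n), free_spectrahedron A X ->
     (forall w, (N < size w)%N -> mxword X w = 0) ->
     psdmx (1%:M + trunc_eval N G X + (trunc_eval N G X)^t*)) ->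
  exists m (T : 'M[C]_(d * m)) (V : 'M[C]_(d * m, e)),
    [/\ T^t* *m T = 1%:M, T *m T^t* = 1%:M, V^t* *m V = 1%:M
      & forall j u, (size u < N)%N ->
        G (j :: u) = V^t* *m (T *m ((A j *t 1%:M) *m (mxword (rmx A T) u *m V)))].
Proof.
move=> d_gt0 A_bounded G0 Gpos; have [e0|e_gt0] := posnP e.
  (* For [e = 0] the trace of [T0] would be 0, and [cone_certificate] needs it positive. *)
  subst e; exists 0, 1%:M, 0; rewrite adjmx1 mulmx1.
  by split=> // *; apply/matrixP => -[].
have [t t0 t_pos] := small_pencil_pos (linear_pencil A (@fshift R g N e)).
pose f := #|{: fock g N e}|.
pose L j : 'M[C]_f := t%:C%C *: fshift N e j.
pose V0 : 'M[C]_(f, e) := \matrix_(x, b) fvec N [::] b x 0.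
(* Column b is slot b of the truncated series at [L] applied to the vacuum vectors. *)
pose G1 : 'M[C]_(f, e) :=
  \matrix_(x, b) (t%:C%C ^+ size (fword x) * G (fword x) b (fslot x)).
(* Its pairing with [S^* S] is the quadratic form of [1 + G + G^*] at the conjugated shift, in the
   vector [xi] whose slots are the images under [S] of the vacuum vectors. *)
pose T0 := V0 *m V0^t* + G1 *m V0^t* + (G1 *m V0^t*)^t*.
have colV0 b : col b V0 = fvec N [::] b by apply/colP => x; rewrite !mxE.
have fock0 b : exists2 x : 'I_f, fword x = [::] & fslot x = b by exact: fock_index.
have V0G1 : V0^t* *m G1 = 0.
  apply/matrixP => b b'; rewrite [RHS]mxE.
  have -> : (V0^t* *m G1) b b' = cdot (col b' G1) (col b V0).
    by rewrite mxE; apply: eq_bigr => x _; rewrite !mxE mulrC.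
  have [x x1 x2] := fock0 b; rewrite colV0 -x1 -x2 fvec_index cdot_delta !mxE x1.
  by rewrite G0 mxE mulr0.
have T0_herm : herm T0.
  have hV : (V0 *m V0^t*)^t* = V0 *m V0^t* := herm_gram V0.
  by rewrite /herm !adjmxD trmxCK hV addrAC.
have trT0 : \tr T0 = e%:R.
  rewrite !mxtraceD tr_adj [\tr (G1 *m _)]mxtrace_mulC V0G1 mxtrace0 conjC0 !addr0.
  rewrite -[V0 *m _]mul1mx trace_gram (eq_bigr (fun=> 1)) ?sumr_const ?card_ord// => b _.
  have [x x1 x2] := fock0 b; rewrite mul1mx colV0 -x1 -x2 fvec_index cdot_delta.
  by rewrite mxE !eqxx.
have T0_pos (S : 'M[C]_f) : S \in unitmx ->
    free_spectrahedron A (fun j => S *m L j *m invmx S) ->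
    0 <= \tr (S^t* *m S *m T0).
  move=> Su XA; set X := fun j => _ in XA.
  have wX w : mxword X w = S *m (t%:C%C ^+ size w *: mxword (@fshift R g N e) w) *m invmx S.
    by rewrite /X mxword_conj// mxwordZ.
  have X_nil w : (N < size w)%N -> mxword X w = 0.
    by move=> Nw; rewrite wX fshift_nilp// scaler0 mulmx0 mul0mx.
  pose xi : 'cV[C]_(e * f) :=
    \col_k (S *m fvec N [::] (mxtens_unindex k).1) (mxtens_unindex k).2 0.
  have slot_xi b : slot b xi = S *m fvec N [::] b.
    by apply/colP => i; rewrite !mxE mxtens_indexK.
  have slot_G b : slot b (trunc_eval N G X *m xi) = S *m col b G1.
    have -> : slot b (trunc_eval N G X *m xi) =
        S *m \sum_(k < N.+1) \sum_(w : k.-tuple 'I_g)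
          \sum_b' (G w b b' * t%:C%C ^+ size w) *: fvec N w b'.
      rewrite /trunc_eval mulmx_suml linear_sum mulmx_sumr; apply: eq_bigr => k _.
      rewrite mulmx_suml linear_sum mulmx_sumr; apply: eq_bigr => w _.
      rewrite /= slot_tens mulmx_sumr; apply: eq_bigr => b' _.
      rewrite slot_xi wX mulmxA mulmxKV// -mulmxA -scalemxAl fshift_word cats0.
      by rewrite -!scalemxAr scalerA.
    congr (S *m _); apply/colP => x; rewrite [RHS]mxE [RHS]mxE.
    rewrite -(sum_words (V := C^o) (fun w => t%:C%C ^+ size w * G w b (fslot x)) (fword_size x)).
    rewrite summxE; apply: eq_bigr => k _; rewrite summxE; apply: eq_bigr => w _.
    rewrite summxE (bigD1 (fslot x))//= [X in _ + X]big1 ?addr0 => [|b' bx].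
      by rewrite !mxE eqxx andbT mulrC [G _ _ _ * _]mulrC.
    by rewrite !mxE [fslot x == b']eq_sym (negbTE bx) andbF mulr0.
  have /psdmxE/(_ xi) := Gpos _ X XA X_nil.
  rewrite !mulmxDl !cdotDl mul1mx [cdot (_^t* *m xi) xi]cdot_mulmxl trmxCK.
  rewrite [cdot xi (_ *m xi)]cdot_sym.
  have trS (Z : 'M[C]_(f, e)) :
      \tr (S^t* *m S *m (Z *m V0^t*)) = \sum_b cdot (S *m col b Z) (S *m col b V0).
    rewrite mulmxA mxtrace_mulC /mxtrace; apply: eq_bigr => b _.
    rewrite [RHS]cdot_mulmxr [S^t* *m (_ *m _)]mulmxA -col_mulmx mxE.
    move: (S^t* *m S *m Z) => Z'.
    by apply: eq_bigr => i _; rewrite [in RHS]mxE [col b V0 i 0]mxE mulrC 2!mxE.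
  rewrite /T0 !mulmxDr !mxtraceD.
  have -> : \tr (S^t* *m S *m (V0 *m V0^t*)) = cdot xi xi.
    by rewrite trS cdot_slot; apply: eq_bigr => b _; rewrite slot_xi colV0.
  have -> : \tr (S^t* *m S *m (G1 *m V0^t*)^t*) = (\tr (S^t* *m S *m (G1 *m V0^t*)))^*.
    by rewrite -tr_adj (adjmxM (S^t* *m S)) (adjmxM (S^t*)) trmxCK [RHS]mxtrace_mulC.
  suff -> : \tr (S^t* *m S *m (G1 *m V0^t*)) = cdot (trunc_eval N G X *m xi) xi by [].
  by rewrite trS cdot_slot; apply: eq_bigr => b _; rewrite slot_xi slot_G colV0.
have K_pos v : 2%:R^-1 * cdot v v <=
    cdot ((1%:M + linear_pencil A L + (linear_pencil A L)^t*) *m v) v.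
  by rewrite linear_pencilZ; exact: t_pos.
have trT0p : 0 < \tr T0 by rewrite trT0 ltr0n.
have [X [hX pX] XT0] := cone_certificate K_pos d_gt0 A_bounded T0_herm trT0p T0_pos.
have [S XS] := psd_factor hX pX.

pose a j : 'M[C]_(d * (d * f)) := A j *t 1%:M.
pose W := \matrix_(k < d * (d * f), y < f)
  S (mxtens_index ((mxtens_unindex k).1, y)) (mxtens_unindex k).2.
(* The equation [cert_map X = T0] at one entry, with column y of [W] as the vector attached to the
   basis element y. *)
have entry y x : T0 y x = cdot (col y W) (col x W)
    + \sum_j cdot (a j *m (W *m (row y (L j))^T)) (col x W)
    + \sum_j cdot (col y W) (a j *m (W *m (row x (L j))^T)).
  have pencil_entry y' x' : ptrace (linear_pencil A L *m X) y' x' =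
      \sum_j cdot (a j *m (W *m (row y' (L j))^T)) (col x' W).
    rewrite /linear_pencil mulmx_suml linear_sum summxE; apply: eq_bigr => j _.
    by rewrite XS /= ptrace_gram.
  have addE (P Q Z : 'M[C]_f) : (P + Q + Z) y x = P y x + Q y x + Z y x by rewrite !mxE.
  rewrite -XT0 /cert_map !linearD addE /=; congr (_ + _ + _).
  - rewrite -[X in ptrace X]mul1mx -tens1 XS ptrace_gram tens1 mul1mx.
    by rewrite row1 trmx_delta -colE.
  - exact: pencil_entry.
  - have := congr1 Num.conj (pencil_entry x y).
    have <- : (ptrace (linear_pencil A L *m X))^t* y x = (ptrace (linear_pencil A L *m X) x y)^*.
      by rewrite !mxE.
    rewrite ptrace_adj adjmxM hX => ->.
    by rewrite rmorph_sum; apply: eq_bigr => j _; rewrite /= -cdot_sym.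
have rowL0 j x : fword x = [::] -> (row x (L j))^T = 0.
  by move=> x0; rewrite linearZ linearZ /= fshift_row0// scaler0.
have rowLS j k u x : fword x = k :: u ->
    (row x (L j))^T = (j == k)%:R *: (t%:C%C *: fvec N u (fslot x)).
  by move=> xu; rewrite linearZ linearZ /= (fshift_rowS _ xu) scalerA mulrC -scalerA.
have Wcol u b x : fword x = u -> fslot x = b -> W *m fvec N u b = col x W.
  by move=> <- <-; rewrite fvec_index -colE.
have sumL y k u (z : 'cV[C]_(d * (d * f))) : fword y = k :: u ->
    \sum_j cdot (a j *m (W *m (row y (L j))^T)) z =
    t%:C%C * cdot (a k *m (W *m fvec N u (fslot y))) z.
  move=> yu; rewrite (bigD1 k)//= (rowLS k _ _ _ yu) eqxx scale1r.
  rewrite -!scalemxAr cdotZl big1 ?addr0// => j jk.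
  by rewrite (rowLS j _ _ _ yu) (negbTE jk) scale0r !mulmx0 cdot0l.
have sumL0 y (z : 'cV[C]_(d * (d * f))) : fword y = [::] ->
    \sum_j cdot (a j *m (W *m (row y (L j))^T)) z = 0.
  by move=> y0; rewrite big1// => j _; rewrite rowL0// !mulmx0 cdot0l.
have sumC y x : \sum_j cdot (col y W) (a j *m (W *m (row x (L j))^T)) =
    (\sum_j cdot (a j *m (W *m (row x (L j))^T)) (col y W))^*.
  by rewrite rmorph_sum; apply: eq_bigr => j _; rewrite /= -cdot_sym.
have V0x x b : V0 x b = ((fword x == [::]) && (fslot x == b))%:R by rewrite !mxE.
have G1V0 y x : (G1 *m V0^t*) y x = (fword x == [::])%:R * G1 y (fslot x).
  rewrite mxE (bigD1 (fslot x))//= big1 ?addr0 => [|b bx].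
    by rewrite [_^t* _ _]mxE [_^T _ _]mxE V0x eqxx andbT rmorph_nat mulrC.
  by rewrite [_^t* _ _]mxE [_^T _ _]mxE V0x [fslot x == b]eq_sym (negbTE bx) andbF conjC0 mulr0.
have T0E y x : T0 y x = ((fword y == [::]) && (fword x == [::]) && (fslot y == fslot x))%:R
    + (fword x == [::])%:R * G1 y (fslot x)
    + ((fword y == [::])%:R * G1 x (fslot y))^*.
  have adjE (Z : 'M[C]_f) : Z^t* y x = (Z x y)^* by rewrite !mxE.
  rewrite /T0 mxE [in LHS]mxE adjE !G1V0; congr (_ + _ + _).
  rewrite mxE (bigD1 (fslot x))//= big1 ?addr0 => [|b bx].
    rewrite [_^t* _ _]mxE [_^T _ _]mxE !V0x eqxx andbT rmorph_nat -natrM mulnb.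
    by rewrite andbAC.
  by rewrite [_^t* _ _]mxE [_^T _ _]mxE !V0x [fslot x == b]eq_sym (negbTE bx) andbF conjC0 mulr0.
pose s : C := t%:C%C^-1.
have tn0 : t%:C%C != 0 :> C by rewrite gt_eqF// ltcR.
have st : s * t%:C%C = 1 by rewrite mulVf.
have sR : s^* = s by rewrite conj_Creal// realV complex_real.
have tR : (t%:C%C)^* = t%:C%C :> C by rewrite conj_Creal// complex_real.
pose w u b := s ^+ size u *: (W *m fvec N u b).
have G1x x b : G1 x b = t%:C%C ^+ size (fword x) * G (fword x) b (fslot x) by rewrite mxE.
(* The three conditions are the entries of the certificate at two empty words, at [j :: u] and the
   empty word, and at [j :: u] and [k :: v]. *)
exists (d * f)%N; apply: (@lurking_isometry _ _ _ _ _ N A G w) => /=.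
- move=> b b'; have [x x1 x2] := fock0 b; have [y y1 y2] := fock0 b'.
  rewrite /w !scale1r (Wcol _ _ _ x1 x2) (Wcol _ _ _ y1 y2).
  have := entry y x; rewrite T0E sumC !sumL0// conjC0 !addr0 => <-.
  by rewrite x1 y1 x2 y2 !eqxx !mul1r !G1x x1 y1 G0 !mxE !mulr0 conjC0 !addr0.
- move=> j u b b' uN; have [x x1 x2] := fock0 b.
  have [y y1 y2] := fock_index (w := j :: u) b' uN.
  rewrite /w !scale1r (Wcol _ _ _ x1 x2) (Wcol _ _ _ y1 y2) /=.
  have := entry y x; rewrite T0E sumC (sumL0 x _ x1) conjC0 addr0 (sumL y _ _ _ y1).
  rewrite x1 y1 x2 y2 eqxx /= mul1r mul0r conjC0 add0r addr0 G1x y1 y2 /= => E.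
  rewrite -!scalemxAr cdotDl !cdotZl exprSr -mulrA.
  have -> : s ^+ size u * cdot (a j *m (W *m fvec N u b')) (col x W) =
      s ^+ size u * (s * (t%:C%C * cdot (a j *m (W *m fvec N u b')) (col x W))).
    by rewrite (mulrA s) st mul1r.
  rewrite -!mulrDr -E mulrA -exprSr mulrA -exprMn st expr1n mul1r//.
- move=> j u b' k v b uN vN.
  have [x x1 x2] := fock_index (w := k :: v) b vN.
  have [y y1 y2] := fock_index (w := j :: u) b' uN.
  rewrite /w (Wcol _ _ _ x1 x2) (Wcol _ _ _ y1 y2) /=.
  have := entry y x; rewrite T0E sumC (sumL y _ _ _ y1) (sumL x _ _ _ x1).
  rewrite x1 y1 x2 y2 /= !mul0r conjC0 !addr0 => E.
  set p := a j *m (W *m fvec N u b') in E *; set p' := a k *m (W *m fvec N v b) in E *.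
  have -> : a j *m (s ^+ size u *: (W *m fvec N u b')) = s ^+ (size u).+1 *: (t%:C%C *: p).
    by rewrite -scalemxAr scalerA exprSr -mulrA st mulr1.
  have -> : a k *m (s ^+ size v *: (W *m fvec N v b)) = s ^+ (size v).+1 *: (t%:C%C *: p').
    by rewrite -scalemxAr scalerA exprSr -mulrA st mulr1.
  rewrite -!scalerDr !cdotZl !cdotZr [t%:C%C * (_ * _)]mulrCA; congr (_ * (_ * _)).
  (* The entry of [T0] at two nonempty words is 0, so all terms but the product of the two vectors
     with a factor [A] cancel. *)
  rewrite !cdotDl !cdotDr !cdotZl !cdotZr tR addrA -[RHS]add0r; congr (_ + _).
  rewrite [RHS]E addrAC; congr (_ + _ + _).
  by rewrite rmorphM /= tR -cdot_sym.
Qed.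

End Pencils.

(** * Power series of free functions *)

Section GeometricConvergence.
Context {R : realType}.
Local Notation C := R[i].
Variables (K q : R) (N0 : nat).
Hypotheses (q0 : 0 <= q) (q1 : q < 1).

Lemma geometric_small (eps : C) : 0 < eps ->
  \forall N \near \oo, (K * q ^+ N)%:C%C < eps.
Proof.
move=> e0; have eR : eps = (complex.Re eps)%:C%C.
  by case: eps e0 => a b; rewrite ltcE /= => /andP[/eqP -> _].
have e0' : 0 < complex.Re eps by rewrite -ltcR -eR.
have q1' : `|q| < 1 by rewrite ger0_norm.
have /cvgr0Pnorm_lt/(_ _ e0') := cvg_geometric K q1'.
apply: filterS => N h; rewrite eR ltcR; apply: le_lt_trans h; exact: ler_norm.
Qed.

Lemma geometric_cvg (V : normedModType C) (u : nat -> V) (l : V) :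
  (forall N, (N0 <= N)%N -> `|l - u N| <= (K * q ^+ N)%:C%C) -> u @ \oo --> l.
Proof.
move=> h; apply/cvgrPdist_lt => eps e0.
have : \forall N \near \oo, (N0 <= N)%N by exact: nbhs_infty_ge.
have := geometric_small e0; apply: filterS2 => N h1 h2.
exact: le_lt_trans (h N h2) h1.
Qed.

End GeometricConvergence.

Section GeometricSeries.
Context {R : realType}.
Local Notation C := R[i].
Variables (K q : R) (N0 : nat).
Hypotheses (K0 : 0 <= K) (q0 : 0 <= q) (q1 : q < 1).

Lemma geometric_series_cvg (V : completeNormedModType C) (s : nat -> V) :
  (forall k, (N0 <= k)%N -> `|s k| <= (K * q ^+ k)%:C%C) ->
  exists l : V, (fun N => \sum_(k < N) s k) @ \oo --> l.
Proof.
move=> h.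
have tail N m : (N0 <= N)%N ->
    `|\sum_(k < N + m) s k - \sum_(k < N) s k| <= (K * (1 - q)^-1 * (q ^+ N - q ^+ (N + m)))%:C%C.
  move=> N0N; elim: m => [|m IH]; first by rewrite addn0 !subrr mulr0 normr0.
  rewrite addnS big_ord_recr /= addrAC; apply: le_trans (ler_normD _ _) _.
  apply: le_trans (lerD IH (h _ _)) _; first by rewrite (leq_trans N0N)// leq_addr.
  have q1n : 1 - q != 0 by rewrite subr_eq0 eq_sym lt_eqF.
  by rewrite -realcD lecR le_eqVlt; apply/orP; left; apply/eqP; rewrite exprS; field.
suff : cvg ((fun N => \sum_(k < N) s k) @ \oo) by move=> /cvg_ex.
apply: cauchy_cvg; apply: cauchy_exP => eps e0.
have q1' : 0 < 1 - q by rewrite subr_gt0.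
have KN N m : (N0 <= N)%N -> `|\sum_(k < N + m) s k - \sum_(k < N) s k| <=
    (K * (1 - q)^-1 * q ^+ N)%:C%C.
  move=> N0N; apply: le_trans (tail N m N0N) _; rewrite lecR mulrBr lerBlDr lerDl.
  by rewrite !mulr_ge0 ?invr_ge0 ?(ltW q1') ?exprn_ge0.
have : \forall N \near \oo, (N0 <= N)%N by exact: nbhs_infty_ge.
move=> [N1 _ hN1]; have [N2 _ hN2] := geometric_small (K * (1 - q)^-1) q0 q1 e0.
pose N := maxn N1 N2.
exists (\sum_(k < N) s k); exists N => // M /= NM.
rewrite -ball_normE /ball_ /= distrC -(subnKC NM).
apply: le_lt_trans (KN _ _ _) _; first by apply: hN1; rewrite /= leq_maxl.
by apply: hN2; rewrite /= leq_maxr.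
Qed.

End GeometricSeries.

Lemma cvg_mx_entries (R : realType) m n (u : nat -> 'M[R[i]^o]_(m, n)) (l : 'M[R[i]^o]_(m, n)) :
  (forall i j, ((fun N => u N i j) : nat -> R[i]^o) @ \oo --> (l i j : R[i]^o)) ->
  u @ \oo --> l.
Proof.
move=> h; apply/cvg_ballP => eps e0.
have hN i j : \forall N \near \oo, ball (l i j : R[i]^o) eps (u N i j : R[i]^o).
  by have /cvg_ballP := h i j; apply.
have : \forall N \near \oo, forall i, forall j, ball (l i j : R[i]^o) eps (u N i j : R[i]^o).
  by apply: filter_forall => i; exact: filter_forall (hN i).
by apply: filterS => N hN'; split.
Qed.

Section PowerSeries.
Context {R : realType}.
Local Notation C := R[i].
Variables (g : nat) (D : @free_set R g) (f : @graded_fun R g) (eps : R).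
Hypotheses (f_resp : respects_intertwinings D f) (eps_gt0 : 0 < eps)
  (ball_D : forall n (X : mxtuple g n), tnorm X < eps -> D X).

Lemma tnormZ_le n a (X : @mxtuple R g n) :
  tnorm (fun j => a *: X j) <= complex.Re `|a| * tnorm X.
Proof.
have a0 : 0 <= complex.Re `|a| by rewrite -ler0c RRe_real ?normr_real.
apply: tnorm_le => [|j]; first by rewrite mulr_ge0 ?tnorm_ge0.
by apply: le_trans (opnormZ_le _ _) _; rewrite ler_wpM2l ?le_tnorm.
Qed.

Lemma Re_normr (t : R) : complex.Re `|t%:C%C : C| = `|t|.
Proof. by apply: complexI; rewrite Re_normK normc_def /= expr0n addr0 sqrtr_sqr. Qed.

Lemma scale_into_ball n (X : @mxtuple R g n) : exists2 t : R, 0 < t &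
  tnorm (fun j => t%:C%C *: X j) < eps.
Proof.
have X1 : 0 < tnorm X + 1 by rewrite ltr_wpDl ?tnorm_ge0.
exists (eps / (tnorm X + 1)); first by rewrite divr_gt0.
apply: le_lt_trans (tnormZ_le _ _) _.
rewrite Re_normr ger0_norm ?divr_ge0 ?ltW// -mulrA gtr_pMr// mulrC ltr_pdivrMr//.
by rewrite mul1r ltrDl.
Qed.

Lemma fword_inj1 N : injective (@fword g N 1).
Proof.
move=> x y xy; apply: fword_inj =>//.
by case: (fslot x) (fslot y) => [[]// ?] [[]// ?]; exact: val_inj.
Qed.

(** The coefficient of [w] is the matrix entry of [f] at the scaled shift from the vacuum to the
    basis vector of [w]. At this stage it may depend on N. *)
Lemma nilpotent_expansion_at N : exists a : word g -> C,
  forall n (X : mxtuple g n), D X -> (forall w, (N < size w)%N -> mxword X w = 0) ->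
    f X = \sum_(k < N.+1) \sum_(w : k.-tuple 'I_g) a w *: mxword X w.
Proof.
have [t t0 tL] := scale_into_ball (@fshift R g N 1).
pose L j := t%:C%C *: @fshift R g N 1 j.
have tn0 : t%:C%C != 0 :> C by rewrite gt_eqF// ltcR.
pose e0 := @fvec R g N 1 [::] ord0.
(* With [e = 1] at most one index carries the word [w]; the sum is a lookup that gives 0 for words
   longer than N. *)
pose a (w : word g) := t%:C%C ^- size w * \sum_(x | fword x == w) (f L *m e0) x 0.
exists a => n X DX X_nil.
(* S v maps e_w to t^-|w| X^w v. *)
pose S (v : 'cV[C]_n) : 'M[C]_(n, #|{: fock g N 1}|) :=
  \matrix_(i, x) (t%:C%C ^- size (fword x) *: (mxword X (fword x) *m v)) i 0.
have S_fvec v w : S v *m fvec N w ord0 = t%:C%C ^- size w *: (mxword X w *m v).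
  have [wN|Nw] := leqP (size w) N; last by rewrite fvec_out// X_nil// mul0mx scaler0 mulmx0.
  have [x <- x2] := fock_index (ord0 : 'I_1) wN.
  have -> : fvec N (fword x) ord0 = delta_mx x 0 :> 'cV[C]_#|{: fock g N 1}|.
    by rewrite -fvec_index x2.
  by apply/colP => i; rewrite -colE !mxE.
have XS v j : X j *m S v = S v *m L j.
  have col_eq x : (X j *m S v) *m delta_mx x (0 : 'I_1) = (S v *m L j) *m delta_mx x 0.
    have -> : delta_mx x 0 = fvec N (fword x) ord0 :> 'cV[C]_#|{: fock g N 1}|.
      by rewrite -fvec_index; congr fvec; rewrite [LHS]ord1.
    rewrite -!mulmxA (S_fvec v) -[L j *m _]scalemxAl fshift_fvec.
    rewrite -[S v *m _]scalemxAr (S_fvec v) -[X j *m _]scalemxAr.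
    by rewrite scalerA mxword_cons mulmxA /= exprS invfM mulrA mulfV// mul1r.
  apply/matrixP => i x; have := congr1 (fun M : 'cV[C]_n => M i 0) (col_eq x).
  by rewrite -!colE !mxE.
apply/matrixP => i l; pose v : 'cV[C]_n := delta_mx l 0.
have := congr1 (fun M => (M *m e0) i 0) (f_resp DX (ball_D tL) (XS v)).
rewrite -!mulmxA S_fvec /= invr1 scale1r mxword_nil mul1mx -colE mxE => ->.
rewrite summxE.
under [RHS]eq_bigr => k _ do rewrite summxE.
have aE x : t%:C%C ^- size (fword x) * (f L *m e0) x 0 = a (fword x).
  congr (_ * _); rewrite (bigD1 x)//= big1 ?addr0// => y /andP[/eqP xy].
  by rewrite (fword_inj1 xy) eqxx.
transitivity (\sum_(x : 'I_#|{: fock g N 1}|) a (fword x) * mxword X (fword x) i l).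
  rewrite [LHS]mxE; apply: eq_bigr => x _; rewrite -aE /S mxE mxE -colE mxE.
  by rewrite -/(L) mulrAC.
under [LHS]eq_bigr => x _ do
  rewrite -(@sum_words R g N C^o (fun w => a w * mxword X w i l) _ (fword_size x)).
rewrite exchange_big; apply: eq_bigr => k _; rewrite exchange_big; apply: eq_bigr => w _.
have wN : (size w <= N)%N by rewrite size_tuple -ltnS.
have [x x1 x2] := fock_index (ord0 : 'I_1) wN.
rewrite (bigD1 x)//= x1 eqxx scale1r big1 ?addr0 ?mxE// => y yx.
case: eqP => [yw|_]; last by rewrite scale0r.
by case/eqP: yx; apply: fword_inj1; rewrite yw x1.
Qed.

(** The expansions found for different N agree: evaluated at the scaled shift of order [size w],
    each of order at least [size w] returns its own coefficient of [w]. So the coefficient may be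
    taken at order [size w]. *)
Lemma nilpotent_expansion : exists a : word g -> C,
  forall N n (X : mxtuple g n), D X -> (forall w, (N < size w)%N -> mxword X w = 0) ->
    f X = \sum_(k < N.+1) \sum_(w : k.-tuple 'I_g) a w *: mxword X w.
Proof.
have [a aP] := choice nilpotent_expansion_at.
pose b w := a (size w) w; exists b => N n X DX X_nil; rewrite (aP N)//.
apply: eq_bigr => k _; apply: eq_bigr => w _; congr (_ *: _).
have wN : (size w <= N)%N by rewrite size_tuple -ltnS.
rewrite /b; move: (tval w) wN => {k w X DX X_nil n} w wN.
have [t t0 tL] := scale_into_ball (@fshift R g (size w) 1).
pose L j := t%:C%C *: @fshift R g (size w) 1 j.
have tn0 : t%:C%C ^+ size w != 0 :> C by rewrite expf_neq0// gt_eqF// ltcR.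
pose e0 := @fvec R g (size w) 1 [::] ord0.
have [x xw x2] := @fock_index g (size w) 1 w ord0 (leqnn _).
have entry M (c : word g -> C) : (size w <= M)%N ->
    ((\sum_(k < M.+1) \sum_(u : k.-tuple 'I_g) c u *: mxword L u) *m e0) x 0 =
    t%:C%C ^+ size w * c w.
  move=> wM; rewrite -(@sum_words R g M C^o (fun w => t%:C%C ^+ size w * c w) _ wM).
  rewrite mulmx_suml summxE; apply: eq_bigr => k _.
  rewrite mulmx_suml summxE; apply: eq_bigr => u _.
  rewrite mxwordZ -!scalemxAl fshift_word cats0 !mxE xw x2 eqxx andbT.
  by rewrite mulrA mulrC [c _ * _]mulrC.
have L_nil M : (size w <= M)%N -> forall u, (M < size u)%N -> mxword L u = 0.
  by move=> wM u Mu; rewrite mxwordZ fshift_nilp ?scaler0// (leq_ltn_trans wM).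
have := aP N _ L (ball_D tL) (L_nil _ wN).
rewrite (aP _ _ L (ball_D tL) (L_nil _ (leqnn _))).
move=> /(congr1 (fun M => (M *m e0) x 0)); rewrite !entry// => /(mulfI tn0)//.
Qed.

End PowerSeries.

(** * Nilpotent and bordered Jordan blocks *)

Section JordanBlocks.
Context {R : realType}.
Local Notation C := R[i].

(** The k-th power of the nilpotent Jordan block. *)
Definition shift_mx m (k : nat) : 'M[C]_m := \matrix_(i, j) (j == (i + k)%N :> nat)%:R.

(* The last diagonal entry makes (1, r, ..., r^m) an eigenvector. *)
Definition bordered_shift m (r : C) : 'M[C]_m.+1 :=
  \matrix_(i, j) ((j == i.+1 :> nat)%:R + ((i == ord_max) && (j == ord_max))%:R * r).

Lemma shift_mxS m k : shift_mx m 1 *m shift_mx m k = shift_mx m k.+1.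
Proof.
apply/matrixP => i j; rewrite !mxE.
have [im|im] := ltnP i.+1 m.
  rewrite (bigD1 (Ordinal im))//= !mxE addn1 eqxx mul1r big1 ?addr0.
    by rewrite addSnnS.
  by move=> l; rewrite -val_eqE !mxE addn1 => /negbTE /= ->; rewrite mul0r.
rewrite big1 => [|l _]; last first.
  by rewrite !mxE addn1 ltn_eqF ?mul0r// (leq_trans (ltn_ord l)).
by rewrite ltn_eqF// -addSnnS (leq_trans (ltn_ord j))// (leq_trans im)// leq_addr.
Qed.

Lemma shift_mx0 m : shift_mx m 0 = 1%:M.
Proof. by apply/matrixP => i j; rewrite !mxE addn0 eq_sym. Qed.

Lemma shift_mx_ge m k : (m <= k)%N -> shift_mx m k = 0.
Proof.
move=> mk; apply/matrixP => i j; rewrite !mxE ltn_eqF//.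
by rewrite (leq_trans (ltn_ord j))// (leq_trans mk)// leq_addl.
Qed.

Lemma mxword_shift g m n (X : @mxtuple R g n) w :
  mxword (fun j => shift_mx m 1 *t X j) w = shift_mx m (size w) *t mxword X w.
Proof.
elim: w => [|j w IH]; first by rewrite !mxword_nil shift_mx0 tens1.
by rewrite !mxword_cons IH tensmx_mul shift_mxS.
Qed.

Lemma bordered_shiftE m r (v : 'cV[C]_m.+1) i :
  (bordered_shift m r *m v) i 0 =
  if unlift ord_max i is Some k then v (lift ord0 k) 0 else r * v ord_max 0.
Proof.
rewrite mxE; case: unliftP => [k|] ->.
  rewrite (bigD1 (lift ord0 k))//= mxE [lift ord_max k == _]eq_sym (negbTE (neq_lift _ _)).
  rewrite mul0r addr0 lift_max lift0 eqxx mul1r big1 ?addr0// => j.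
  rewrite -val_eqE [val (lift _ _)]lift0 => jk.
  rewrite mxE [lift ord_max k == _]eq_sym (negbTE (neq_lift _ _)) mul0r addr0.
  by rewrite lift_max (negbTE jk) mul0r.
rewrite (bigD1 ord_max)//= mxE !eqxx ltn_eqF//= mul1r add0r big1 ?addr0// => j jm.
by rewrite mxE (negbTE jm) andbF mul0r addr0 ltn_eqF ?mul0r// ltnS leq_ord.
Qed.

(** The last row and the shifted rows each contribute at most the square of the norm of [v], and 2
    fits into [2 ^+ 2]. *)
Lemma opnorm_bordered_shift m r : `|r| <= 1 -> opnorm (bordered_shift m r) <= 2%:R.
Proof.
move=> r1; apply: opnorm_le => // v; apply: l2norm_le =>//.
have bound i : v i 0 * (v i 0)^* <= cdot v v.
  by rewrite /cdot (bigD1 i)//= lerDl sumr_ge0// => j _; rewrite mul_conjC_ge0.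
have -> : (2%:R ^+ 2)%:C%C * cdot v v = (cdot v v + cdot v v) *+ 2 :> C.
  by rewrite rmorphXn /= rmorph_nat; ring.
have c0 := cdot_ge0 v.
apply: le_trans (_ : cdot v v + cdot v v <= _); last first.
  by rewrite mulr2n lerDl addr_ge0.
rewrite {1}/cdot (bigD1_ord ord_max)//= bordered_shiftE unlift_none; apply: lerD.
  rewrite rmorphM /= mulrACA -!normCK; apply: le_trans (bound ord_max).
  by rewrite -normCK ler_piMl ?exprn_ge0// exprn_ile1.
rewrite /cdot big_ord_recl /= -[leLHS]add0r; apply: lerD; first exact: mul_conjC_ge0.
by apply: ler_sum => k _; rewrite bordered_shiftE liftK.
Qed.

End JordanBlocks.

Section PowerSeriesNear0.
Context {R : realType}.
Local Notation C := R[i].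
Variables (g : nat) (D : @free_set R g) (f : @graded_fun R g) (eps M : R).
Hypotheses (f_resp : respects_intertwinings D f) (eps_gt0 : 0 < eps)
  (ball_D : forall n (X : mxtuple g n), tnorm X < eps -> D X)
  (f_bounded : forall n (X : mxtuple g n), tnorm X < eps -> opnorm (f X) <= M).

Lemma opnorm_shift_mx m : opnorm (shift_mx m 1 : 'M[C]_m) <= 2%:R.
Proof.
case: m => [|m]; first by rewrite [shift_mx _ _]flatmx0 opnorm0.
have -> : shift_mx m.+1 1 = bordered_shift m 0 :> 'M[C]_m.+1.
  by apply/matrixP => i j; rewrite !mxE mulr0 addr0 addn1.
by apply: opnorm_bordered_shift; rewrite normr0.
Qed.

Definition inj_mx m : 'M[C]_(m.+1, m) := \matrix_(i, j) (i == j :> nat)%:R.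

Lemma bordered_shift_inj m r :
  bordered_shift m r *m inj_mx m = inj_mx m *m shift_mx m 1.
Proof.
apply/matrixP => i j.
have -> : (bordered_shift m r *m inj_mx m) i j = (j == i.+1 :> nat)%:R.
  rewrite mxE (bigD1 (lift ord_max j))//= !mxE [lift _ _ == _]eq_sym.
  rewrite (negbTE (neq_lift _ _)) andbF mul0r addr0 lift_max eqxx mulr1.
  rewrite big1 ?addr0// => l; rewrite -val_eqE [val (lift _ _)]lift_max !mxE => /negbTE ->.
  by rewrite mulr0.
rewrite mxE; case: (unliftP ord_max i) => [k|] ->.
  rewrite lift_max (bigD1 k)// !mxE lift_max eqxx mul1r addn1 big1 /= ?addr0// => l.
  by rewrite -val_eqE !mxE lift_max eq_sym => /negbTE ->; rewrite mul0r.
rewrite ltn_eqF ?big1 // => [l _|]; last by rewrite ltnS ltnW// ltn_ord.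
by rewrite !mxE gtn_eqF ?mul0r.
Qed.

(* With X = r Y, the tuple J *t Y is intertwined with X by the eigenvector
   (1, r, ..., r^m) of J and with a nilpotent tuple by the first m coordinates.
   Comparing the first rows leaves r^m times one entry of f (J *t Y). *)
Lemma power_expansion_error (a : word g -> C) :
  (forall N n (X : mxtuple g n), D X -> (forall w, (N < size w)%N -> mxword X w = 0) ->
    f X = \sum_(k < N.+1) \sum_(w : k.-tuple 'I_g) a w *: mxword X w) ->
  forall n (X : mxtuple g n) m i j, tnorm X < eps / 4%:R ->
    `|f X i j - (\sum_(k < m) \sum_(w : k.-tuple 'I_g) a w *: mxword X w) i j|
      <= (M * 2%:R^-1 ^+ m)%:C%C.
Proof.
move=> a_exp n X m i j Xeps.
(* [Y = 2 X] has norm below [eps / 2], and tensoring with a block of norm at most 2 stays below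
   [eps]; hence the radius [eps / 4]. *)
pose r : C := 2%:R^-1.
have r1 : `|r| <= 1 by rewrite ger0_norm ?invr_ge0// invf_le1// ler1n.
pose Y j := 2%:R *: X j.
have XY j' : X j' = r *: Y j' by rewrite /Y scalerA mulVf ?scale1r ?pnatr_eq0.
have Yeps : tnorm Y < eps / 2%:R.
  apply: le_lt_trans (tnormZ_le _ _) _.
  have -> : complex.Re `|2%:R : C| = 2%:R by apply: complexI; rewrite Re_normK normr_nat rmorph_nat.
  rewrite mulrC -ltr_pdivlMr//; apply: lt_le_trans Xeps _.
  by rewrite -mulrA -invfM -natrM.
have XYw w : mxword X w = r ^+ size w *: mxword Y w.
  by rewrite -mxwordZ; congr mxword; apply/funext.
clearbody Y.
have tensY k (J : 'M[C]_k) : opnorm J <= 2%:R -> tnorm (fun j => J *t Y j) < eps.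
  move=> J2; apply: le_lt_trans (_ : 2%:R * tnorm Y < eps); last by rewrite mulrC -ltr_pdivlMr.
  apply: tnorm_le => [|j']; first by rewrite mulr_ge0 ?tnorm_ge0.
  apply: le_trans (opnorm_tens _ _) _.
  by apply: ler_pM; rewrite ?opnorm_ge0 ?le_tnorm.
pose J := bordered_shift m r.
pose JY j := J *t Y j; pose SY j := shift_mx m 1 *t Y j.
have JYeps : tnorm JY < eps by apply/tensY/opnorm_bordered_shift.
have SYeps : tnorm SY < eps by exact/tensY/opnorm_shift_mx.
have Xeps' : tnorm X < eps.
  by apply: lt_trans Xeps _; rewrite ltr_pdivrMr// ltr_pMr// ltr1n.
pose S : 'M[C]_(m.+1 * n, n) :=
  \matrix_(k, l) (r ^+ (mxtens_unindex k).1 * ((mxtens_unindex k).2 == l)%:R).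
have SE i' l l' : S (mxtens_index (i', l)) l' = r ^+ i' * (l == l')%:R.
  by rewrite mxE mxtens_indexK.
have mulS k (Z : 'M[C]_(k, m.+1 * n)) x l :
    (Z *m S) x l = \sum_i' Z x (mxtens_index (i', l)) * r ^+ i'.
  rewrite mxE sum_mxtens; apply: eq_bigr => i' _.
  rewrite (bigD1 l)//= SE eqxx mulr1 big1 ?addr0// => l' ll'.
  by rewrite SE (negbTE ll') !mulr0.
have JS j' : JY j' *m S = S *m X j'.
  apply/matrixP => k l; case: (mxtens_indexP k) => i' l'.
  have -> : (S *m X j') (mxtens_index (i', l')) l = r ^+ i' * X j' l' l.
    rewrite mxE (bigD1 l')//= SE eqxx mulr1 big1 ?addr0// => l'' ll'.
    by rewrite SE eq_sym (negbTE ll') mulr0 mul0r.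
  rewrite mulS; under eq_bigr => l'' _ do rewrite tensmxE mulrAC.
  rewrite -mulr_suml XY mxE mulrA; congr (_ * _).
  have := bordered_shiftE r (\col_i r ^+ i : 'cV[C]_m.+1) i'.
  rewrite mxE; under eq_bigr => l'' _ do rewrite mxE; move=> ->.
  case: unliftP => [k'|] ->; first by rewrite mxE lift0 lift_max exprSr.
  by rewrite mxE mulrC.
have JI j' : JY j' *m (inj_mx m *t 1%:M) = (inj_mx m *t 1%:M) *m SY j'.
  by rewrite !tensmx_mul mul1mx mulmx1 bordered_shift_inj.
have SY_nil w : (m < size w)%N -> mxword SY w = 0.
  by move=> mw; rewrite mxword_shift shift_mx_ge ?(ltnW mw)// tens0mx.
have := f_resp (ball_D JYeps) (ball_D SYeps) JI.
rewrite (a_exp m _ SY (ball_D SYeps) SY_nil) => fI.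
have := congr1 (fun Z : 'M[C]_(_, n) => Z (mxtens_index (ord0, i)) j)
  (f_resp (ball_D JYeps) (ball_D Xeps') JS).
have -> : (S *m f X) (mxtens_index (ord0, i)) j = f X i j.
  rewrite mxE (bigD1 i)//= SE eqxx expr0 mulr1 mul1r big1 ?addr0// => l il.
  by rewrite SE eq_sym (negbTE il) mulr0 mul0r.
(* By [fI] the block of column [k < m] is the part of degree k of the series at [Y]; the factor
   [r ^+ k] turns it into the part of degree k at [X]. *)
rewrite mulS (bigD1_ord ord_max)//=.
under eq_bigr => k _.
  have -> : f JY (mxtens_index (ord0, i)) (mxtens_index (lift ord_max k, j)) * r ^+ lift ord_max k =
    \sum_(w : k.-tuple 'I_g) a w * mxword X w i j.
    have := congr1 (fun Z : 'M[C]_(_, m * n) => Z (mxtens_index (ord0, i)) (mxtens_index (k, j))) fI.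
    have -> : (f JY *m (inj_mx m *t 1%:M)) (mxtens_index (ord0, i)) (mxtens_index (k, j)) =
      f JY (mxtens_index (ord0, i)) (mxtens_index (lift ord_max k, j)).
      rewrite mxE (bigD1 (mxtens_index (lift ord_max k, j)))//= tensmxE !mxE lift_max !eqxx !mulr1.
      rewrite big1 ?addr0// => z; case: (mxtens_indexP z) => x y zx.
      rewrite tensmxE !mxE; have [xk|] := eqVneq (x : nat) k; last by rewrite mul0r mulr0.
      have [yj|] := eqVneq y j; last by rewrite mulr0 mulr0.
      case/eqP: zx; congr mxtens_index; rewrite yj; congr pair.
      by apply: val_inj; rewrite [val (lift _ _)]lift_max.
    move=> ->.
    have k0 : (0 < m)%N by exact: leq_ltn_trans (ltn_ord k).
    pose o : 'I_m := Ordinal k0.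
    have -> (Z : 'M[C]_(m * n)) : (inj_mx m *t 1%:M *m Z) (mxtens_index (ord0, i)) (mxtens_index (k, j)) =
        Z (mxtens_index (o, i)) (mxtens_index (k, j)).
      rewrite mxE (bigD1 (mxtens_index (o, i)))//= tensmxE !mxE !eqxx !mul1r.
      rewrite big1 ?addr0// => z; case: (mxtens_indexP z) => x y zx.
      rewrite tensmxE !mxE; have [x0|] := eqVneq (0%N) (x : nat); last by rewrite !mul0r.
      have [yi|] := eqVneq i y; last by rewrite mulr0 mul0r.
      by case/eqP: zx; congr mxtens_index; rewrite yi; congr pair; apply: val_inj.
    rewrite summxE lift_max mulr_suml.
    have km : (k < m.+1)%N by rewrite ltnS ltnW.
    rewrite (bigD1 (Ordinal km))//= [X in _ + X]big1 ?addr0 => [|l kl].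
      rewrite summxE mulr_suml; apply: eq_bigr => w _.
      rewrite mxE mxword_shift tensmxE mxE size_tuple add0n eqxx mul1r.
      by rewrite XYw mxE size_tuple -mulrA [_ * r ^+ _]mulrC.
    rewrite summxE big1 ?mul0r// => w _.
    rewrite mxE mxword_shift tensmxE mxE size_tuple add0n.
    by rewrite eq_sym -[_ == _]/(l == Ordinal km) (negbTE kl) mul0r mulr0.
  over.
rewrite addrC => <-.
have -> : (\sum_(k < m) \sum_(w : k.-tuple 'I_g) a w *: mxword X w) i j =
    \sum_(k < m) \sum_(w : k.-tuple 'I_g) a w * mxword X w i j.
  rewrite summxE; apply: eq_bigr => k _; rewrite summxE; apply: eq_bigr => w _.
  by rewrite mxE.
rewrite [X in X - _]addrC addrK normrM realcM realcX.
have -> : (2%:R^-1)%:C%C = `|r| :> C.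
  rewrite ger0_norm ?invr_ge0//; apply: (can_inj (@invrK _)).
  by rewrite [RHS]invrK -[LHS]fmorphV /= invrK rmorph_nat.
rewrite -normrX; apply: ler_wpM2r =>//.
by apply: le_trans (entry_le_opnorm _ _ _) _; rewrite lecR f_bounded.
Qed.

Lemma power_series_near0 : exists a : word g -> C,
  power_series_at0 f a /\
  forall N n (X : mxtuple g n), D X -> (forall w, (N < size w)%N -> mxword X w = 0) ->
    f X = \sum_(k < N.+1) \sum_(w : k.-tuple 'I_g) a w *: mxword X w.
Proof.
have [a a_exp] := nilpotent_expansion f_resp eps_gt0 ball_D; exists a; split =>//.
exists (eps / 4%:R); split => [|n X Xeps]; first by rewrite divr_gt0.
apply: cvg_mx_entries => i j.
apply: (@geometric_cvg _ M 2%:R^-1 0) => [||N _].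
- by rewrite invr_ge0.
- by rewrite invf_lt1// ltr1n.
- exact: power_expansion_error.
Qed.

End PowerSeriesNear0.

(** * Rational and pseudoconvex maps near the origin *)

Section LocalBounds.
Context {R : realType}.
Local Notation C := R[i].

(** What the rational and the pseudoconvex hypothesis have in common: [D'] is the domain of the
    expression or the pseudoconvex set, and [eps], [M] serve all matrix sizes at once. *)
Definition bounded_near0 {g : nat} (D : @free_set R g) (f : @graded_fun R g) : Prop :=
  exists D' eps M, [/\ free_subset D D', respects_intertwinings D' f, 0 < eps
    & forall n (X : mxtuple g n), tnorm X < eps -> D' n X /\ opnorm (f n X) <= M].

Lemma castmx_mulmx m m' n n' k k' (em : m = m') (en : n = n') (ek : k = k')
    (M : 'M[C]_(m, n)) (N : 'M[C]_(n, k)) :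
  castmx (em, en) M *m castmx (en, ek) N = castmx (em, ek) (M *m N).
Proof. by case: m' / em; case: n' / en; case: k' / ek; rewrite !castmx_id. Qed.

Lemma opnorm_castmx m m' n n' (em : m = m') (en : n = n') (M : 'M[C]_(m, n)) :
  opnorm (castmx (em, en) M) = opnorm M.
Proof. by case: m' / em; case: n' / en; rewrite castmx_id. Qed.

Lemma castmx_tens1 m n (S : 'M[C]_(m, n)) :
  castmx (mul1n m, mul1n n) ((1%:M : 'M[C]_1) *t S) = S.
Proof.
apply/matrixP => i j; rewrite castmxE.
have cast_index k (l : 'I_k) : cast_ord (esym (mul1n k)) l = mxtens_index (ord0, l).
  by apply: val_inj; rewrite /= mul0n.
by rewrite !cast_index tensmxE mxE mul1r.
Qed.

Lemma linear_pencil_intertwine g m k n (E : @mxtuple R g m) (X : @mxtuple R g k)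
    (Y : @mxtuple R g n) (S : 'M[C]_(k, n)) : (forall j, X j *m S = S *m Y j) ->
  linear_pencil E X *m (1%:M *t S) = (1%:M *t S) *m linear_pencil E Y.
Proof.
move=> XY; rewrite mulmx_suml mulmx_sumr; apply: eq_bigr => j _.
by rewrite !tensmx_mul mulmx1 mul1mx XY.
Qed.

Lemma rational_intertwine g m (E : @mxtuple R g m) (b c : 'cV[C]_m) :
  respects_intertwinings (rational_domain E) (rational_eval E b c).
Proof.
move=> k n X Y S DX DY XY; rewrite /rational_domain /= in DX DY.
pose X' := 1%:M - linear_pencil E X; pose Y' := 1%:M - linear_pencil E Y.
rewrite -/X' in DX; rewrite -/Y' in DY.
have XY' : X' *m (1%:M *t S) = (1%:M *t S) *m Y'.
  by rewrite mulmxBl mulmxBr mul1mx mulmx1 (linear_pencil_intertwine E XY).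
have inv : invmx X' *m (1%:M *t S) = (1%:M *t S) *m invmx Y'.
  by rewrite -[LHS](mulmxK DY) -(mulmxA (invmx X')) -XY' mulmxA mulVmx ?mul1mx.
rewrite /rational_eval -/X' -/Y' -{1 2}(castmx_tens1 S) !castmx_mulmx.
congr castmx.
have bS : (b *t 1%:M) *m (1%:M *t S) = (1%:M *t S) *m (b *t 1%:M).
  by rewrite !tensmx_mul !mulmx1 !mul1mx.
have cS : (c^t* *t 1%:M) *m (1%:M *t S) = (1%:M *t S) *m (c^t* *t 1%:M).
  by rewrite !tensmx_mul !mulmx1 !mul1mx.
by rewrite -[LHS]mulmxA bS [LHS]mulmxA -(mulmxA (c^t* *t 1%:M)) inv !mulmxA cS.
Qed.

Lemma opnorm_linear_pencil g m n (E : @mxtuple R g m) (X : @mxtuple R g n) :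
  opnorm (linear_pencil E X) <= (\sum_j opnorm (E j)) * tnorm X.
Proof.
apply: le_trans (opnorm_sum _ _ _) _; rewrite mulr_suml; apply: ler_sum => j _.
by apply: le_trans (opnorm_tens _ _) _; rewrite ler_wpM2l ?opnorm_ge0 ?le_tnorm.
Qed.

(** The lower bound [|v| <= 2 |(1 - M) v|] gives injectivity, and then the norm of the inverse. *)
Lemma neumann n (M : 'M[C]_n) : opnorm M <= 2%:R^-1 ->
  (1%:M - M) \in unitmx /\ opnorm (invmx (1%:M - M)) <= 2%:R.
Proof.
move=> M2.
have low v : l2norm v <= 2%:R * l2norm ((1%:M - M) *m v).
  have : l2norm v <= l2norm ((1%:M - M) *m v) + 2%:R^-1 * l2norm v.
    have {1}-> : v = (1%:M - M) *m v + M *m v by rewrite mulmxBl mul1mx subrK.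
    apply: le_trans (l2normD _ _) _; apply: lerD =>//.
    by apply: le_trans (le_opnorm _ _) _; rewrite ler_wpM2r ?l2norm_ge0.
  by lra.
have u : (1%:M - M) \in unitmx.
  apply: inj_unitmx => v v0; apply: l2norm_eq0; apply/eqP.
  by have := low v; rewrite v0 l2norm0 mulr0 eq_le l2norm_ge0 andbT.
split=> //; apply: opnorm_le => // v.
by apply: le_trans (low _) _; rewrite mulmxA mulmxV// mul1mx.
Qed.

Lemma rational_bounded_near0 g (D : @free_set R g) (f : @graded_fun R g) :
  rational_on D f -> bounded_near0 D f.
Proof.
move=> [m [E [b [c [DE fE]]]]].
pose K := \sum_j opnorm (E j).
have K0 : 0 <= K by apply: sumr_ge0 => j _; exact: opnorm_ge0.
(* Below this radius the pencil of [E] has norm at most 1/2, so [neumann] bounds its resolvent by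
   2. *)
exists (rational_domain E), (2%:R^-1 / (K + 1)), (opnorm (c^t*) * 2%:R * opnorm b).
have K1 : 0 < K + 1 by rewrite ltr_wpDl.
split=>//.
- move=> k n X Y S DX DY XY; rewrite !fE//; exact: rational_intertwine.
- by rewrite divr_gt0// invr_gt0.
move=> n X Xeps.
have [|u hu] := @neumann _ (linear_pencil E X).
  apply: le_trans (opnorm_linear_pencil _ _) _; rewrite -/K.
  apply: le_trans (_ : K * (2%:R^-1 / (K + 1)) <= _); first by rewrite ler_wpM2l// ltW.
  by rewrite mulrCA ler_piMr ?invr_ge0// ler_pdivrMr// mul1r lerDl.
split=> //; rewrite fE// /rational_eval opnorm_castmx.
apply: le_trans (opnormM _ _) _.
apply: ler_pM; rewrite ?opnorm_ge0//; last exact: opnorm_tens1r.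
apply: le_trans (opnormM _ _) _.
by apply: ler_pM; rewrite ?opnorm_ge0//; exact: opnorm_tens1r.
Qed.

Lemma opnorm1_le n : opnorm (1%:M : 'M[C]_n) <= 1.
Proof. by apply: opnorm_le => // v; rewrite mul1mx mul1r. Qed.

Lemma opnorm_mxword g n (X : @mxtuple R g n) w : opnorm (mxword X w) <= tnorm X ^+ size w.
Proof.
elim: w => [|j w IH]; first by rewrite mxword_nil expr0 opnorm1_le.
rewrite mxword_cons exprS; apply: le_trans (opnormM _ _) _.
by apply: ler_pM; rewrite ?opnorm_ge0 ?le_tnorm.
Qed.

(** Used to read [|Q [::]| < 1] off the membership of the zero tuple of size 1. *)
Lemma opnorm_le_tens1 m n (M : 'M[C]_(m, n)) : opnorm M <= opnorm (M *t (1%:M : 'M[C]_1)).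
Proof.
apply: opnorm_le => [|v]; first exact: opnorm_ge0.
pose lift1 k (u : 'cV[C]_k) : 'cV[C]_(k * 1) := \col_i u (mxtens_unindex i).1 0.
have lift1_norm k (u : 'cV[C]_k) : l2norm (lift1 k u) = l2norm u.
  rewrite /l2norm; congr Num.sqrt; rewrite sum_mxtens; apply: eq_bigr => i _.
  by rewrite big_ord1 mxE mxtens_indexK.
have -> : l2norm (M *m v) = l2norm ((M *t (1%:M : 'M[C]_1)) *m lift1 _ v).
  rewrite -lift1_norm; congr l2norm; apply/colP => k; case: (mxtens_indexP k) => i j.
  rewrite mxE mxtens_indexK mxE [RHS]mxE sum_mxtens; apply: eq_bigr => l _.
  by rewrite big_ord1 tensmxE mxE !ord1 eqxx mulr1 mxE mxtens_indexK.
by rewrite -(lift1_norm _ v) le_opnorm.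
Qed.

Lemma sum_tuple0 g (V : nmodType) (F : 0.-tuple 'I_g -> V) : \sum_w F w = F [tuple].
Proof. by rewrite (bigD1 [tuple])//= big1 ?addr0// => w /eqP[]; exact: tuple0. Qed.

(** Membership of 0 bounds the constant term strictly below 1, and the remaining terms are linearly
    small in [tnorm X], uniformly in the size. *)
Lemma pseudoconvex_ball g s r N (Q : word g -> 'M[C]_(s, r)) :
  pseudoconvex_set N Q (fun=> 0 : 'M[C]_1) ->
  exists2 eps : R, 0 < eps & forall n (X : @mxtuple R g n), tnorm X < eps -> pseudoconvex_set N Q X.
Proof.
case: N => [_|N].
  by exists 1 => // n X _; rewrite /pseudoconvex_set /= /mxpoly_eval big_ord0 opnorm0.
have evalE n (X : @mxtuple R g n) : mxpoly_eval N.+1 Q X =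
    Q [::] *t 1%:M + \sum_(k < N) \sum_(w : k.+1.-tuple 'I_g) Q w *t mxword X w.
  by rewrite /mxpoly_eval big_ord_recl sum_tuple0 mxword_nil.
rewrite /pseudoconvex_set /= evalE big1 => [|k _]; last first.
  rewrite big1// => w _; case/tupleP: w => j w /=.
  by rewrite mxword_cons mul0mx tensmx0.
rewrite addr0 => Q1.
have {}Q1 : opnorm (Q [::]) < 1 by apply: le_lt_trans Q1; exact: opnorm_le_tens1.
pose K := \sum_(k < N) \sum_(w : k.+1.-tuple 'I_g) opnorm (Q w).
have K0 : 0 <= K by apply: sumr_ge0 => k _; apply: sumr_ge0 => w _; exact: opnorm_ge0.
have K1 : 0 < K + 1 by rewrite ltr_wpDl.
pose del := 1 - opnorm (Q [::]).
have del0 : 0 < del by rewrite subr_gt0.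
exists (del / (K + 1)) => [|n X Xeps]; first by rewrite divr_gt0.
(* Then every positive power of [tnorm X] is at most [tnorm X], so [K * tnorm X] dominates all
   higher terms. *)
have X1 : tnorm X <= 1.
  apply: le_trans (ltW Xeps) _; rewrite ler_pdivrMr// mul1r.
  by apply: le_trans (_ : 1 <= _); rewrite ?lerDr// gerBl opnorm_ge0.
rewrite evalE; apply: le_lt_trans (opnormD _ _) _.
apply: le_lt_trans (_ : opnorm (Q [::]) + K * tnorm X < 1).
  apply: lerD; first exact: opnorm_tens1r.
  rewrite mulr_suml; apply: le_trans (opnorm_sum _ _ _) _; apply: ler_sum => k _.
  rewrite mulr_suml; apply: le_trans (opnorm_sum _ _ _) _; apply: ler_sum => w _.
  apply: le_trans (opnorm_tens _ _) _; apply: ler_wpM2l; first exact: opnorm_ge0.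
  apply: le_trans (opnorm_mxword _ _) _; rewrite size_tuple exprS.
  by rewrite ler_piMr ?tnorm_ge0// exprn_ile1 ?tnorm_ge0.
rewrite -ltrBrDl -/del; apply: le_lt_trans (_ : K * (del / (K + 1)) < _).
  by rewrite ler_wpM2l// ltW.
by rewrite mulrCA gtr_pMr// ltr_pdivrMr// mul1r ltrDl.
Qed.

Lemma free_spectrahedron0 g d (A : @mxtuple R g d) n :
  free_spectrahedron A (fun=> 0 : 'M[C]_n).
Proof.
rewrite /free_spectrahedron /= monic_pencilE /linear_pencil big1 => [|j _]; last first.
  by rewrite tensmx0.
rewrite addr0 trmx0 map_mx0 addr0; apply/psdmxE => v.
by rewrite mul1mx cdot_ge0.
Qed.

Lemma pseudoconvex_bounded_near0 g h d s r N (A : @mxtuple R g d) (p : @graded_map R g h)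
    (Q : word g -> 'M[C]_(s, r)) t :
  free_subset (free_spectrahedron A) (pseudoconvex_set N Q) ->
  free_analytic (pseudoconvex_set N Q) (component p t) ->
  bounded_on (pseudoconvex_set N Q) p ->
  bounded_near0 (free_spectrahedron A) (component p t).
Proof.
move=> AQ [p_resp _] [M pM].
have [eps eps0 ballQ] := pseudoconvex_ball (AQ _ _ (@free_spectrahedron0 _ _ A 1)).
exists (pseudoconvex_set N Q), eps, M; split=> // n X Xeps.
have QX := ballQ _ _ Xeps; split=>//.
exact: le_trans (le_tnorm _ _) (pM _ _ QX).
Qed.

Lemma bounded_near0_power_series g (D : @free_set R g) f : bounded_near0 D f ->
  exists a : word g -> C, power_series_at0 f a /\
  forall N n (X : mxtuple g n), D n X -> (forall w, (N < size w)%N -> mxword X w = 0) ->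
    f n X = \sum_(k < N.+1) \sum_(w : k.-tuple 'I_g) a w *: mxword X w.
Proof.
move=> [D' [eps [M [DD' f_resp eps0 fM]]]].
have [||a [a_ser a_exp]] := @power_series_near0 _ _ D' f eps M f_resp eps0.
- by move=> n X /fM[].
- by move=> n X /fM[].
by exists a; split=> // N n X /DD'; exact: a_exp.
Qed.

End LocalBounds.

(** * Identities between formal series *)

Section SeriesProducts.
Context {R : realType} {g : nat}.
Variables V V' V'' : zmodType.

Lemma ser_mul_constl (T : V' -> V'') (F : opseries V V') w v :
  @ser_mul g _ _ _ (ser_const T) F w v = T (F w v).
Proof.
rewrite /ser_mul big_ord_recl take0 drop0 /= big1 ?addr0// => i _.
by case: w i => [|j w] [].
Qed.

Lemma ser_mul_linearl (T : 'I_g -> V' -> V'') (F : opseries V V') w v :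
  ser_mul (ser_linear T) F w v = if w is j :: w' then T j (F w' v) else 0.
Proof.
case: w => [|j w]; first by rewrite /ser_mul big_ord_recl big_ord0 addr0.
rewrite /ser_mul !big_ord_recl /= take0 drop0 add0r big1 ?addr0// => i _.
by case: w i => [|k w] [].
Qed.

Lemma ser_mul_constr (F : word g -> {additive V' -> V''}) (T : V -> V') w v :
  ser_mul (fun u => F u : V' -> V'') (ser_const T) w v = F w (T v).
Proof.
rewrite /ser_mul big_ord_recr /= take_size drop_size big1 ?add0r// => i _.
have : (size (drop i w) != 0)%N by rewrite size_drop subn_eq0 -ltnNge.
by case: (drop i w) => //= *; rewrite raddf0.
Qed.

Lemma ser_mul_linearr_nil (F : word g -> {additive V' -> V''}) (T : 'I_g -> V -> V') v :
  ser_mul (fun u => F u : V' -> V'') (ser_linear T) [::] v = 0.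
Proof. by rewrite /ser_mul big_ord_recl big_ord0 addr0 /= raddf0. Qed.

Lemma ser_mul_linearr_rcons (F : word g -> {additive V' -> V''}) (T : 'I_g -> V -> V') w j v :
  ser_mul (fun u => F u : V' -> V'') (ser_linear T) (rcons w j) v = F w (T j v).
Proof.
have last2 : drop (size w) (rcons w j) = [:: j] by rewrite -cats1 drop_size_cat.
rewrite /ser_mul size_rcons 2!big_ord_recr /= -[(size w).+1](size_rcons w j) drop_size.
rewrite last2 /= raddf0 addr0 -cats1 take_size_cat// big1 ?add0r// => i _.
have : (1 < size (drop i (w ++ [:: j])))%N.
  by rewrite size_drop size_cat /= addn1 ltn_subRL addn1 ltnS.
by case: (drop i _) => [|a [|b u]]//= _; rewrite raddf0.
Qed.

Lemma ser_mul_subl (F F' : opseries V' V'') (E : opseries V V') w v :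
  @ser_mul g _ _ _ (ser_sub F F') E w v = ser_mul F E w v - ser_mul F' E w v.
Proof. by rewrite /ser_mul -sumrB; apply: eq_bigr. Qed.

Lemma ser_mul_subr (F : word g -> {additive V' -> V''}) (E E' : opseries V V') w v :
  ser_mul (fun u => F u : V' -> V'') (ser_sub E E') w v =
  ser_mul (fun u => F u : V' -> V'') E w v - ser_mul (fun u => F u : V' -> V'') E' w v.
Proof. by rewrite /ser_mul -sumrB; apply: eq_bigr => i _; rewrite raddfB. Qed.

End SeriesProducts.

(** The coefficients are words in [T]: one product peels off the first letter and the other the
    last. The second needs [J] to map 0 to 0, since almost all coefficients of [1 - T] vanish. *)
Lemma neumann_series (R : realType) g (V : lmodType R[i]) (T : 'I_g -> V -> V)
    (J : word g -> {linear V -> V}) : (forall w, J w =1 opword T w) ->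
  ser_inverse (ser_sub (ser_const id) (ser_linear T)) (fun w => J w : V -> V).
Proof.
move=> JE; split=> w v.
  rewrite ser_mul_subl ser_mul_constl ser_mul_linearl; case: w => [|j w].
    by rewrite subr0 JE.
  by rewrite !JE subrr.
rewrite ser_mul_subr ser_mul_constr; case/lastP: w => [|w j].
  by rewrite ser_mul_linearr_nil subr0; exact: JE.
rewrite ser_mul_linearr_rcons.
transitivity (opword T (rcons w j) v - opword T w (T j v)).
  by congr (_ - _); exact: JE.
by rewrite /opword foldr_rcons subrr; case: w.
Qed.

Section Hermitian.
Context {R : realType} {g : nat}.
Local Notation C := R[i].

Lemma ser_pencilE h e (B : @mxtuple R h e) (pc : 'I_h -> word g -> C) :
  ser_pencil B pc =1 ser_hermitian (fun w => \sum_(t < h) pc t w *: B t).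
Proof.
have xE w : xseries (fun w => \sum_(t < h) pc t w *: B t) w =
    \sum_(t < h) xseries (pc t) w *: B t.
  rewrite /xseries /=; case: ifP => // _; rewrite big1// => t _; exact: scale0r.
move=> w; rewrite /ser_pencil /ser_hermitian !xE adjmx_sum; congr (_ + _).
by apply: eq_bigr => t _; rewrite adjmxZ.
Qed.

End Hermitian.

(** * Adjoints and polarization on [H \otimes C^k] *)

Section HilbertTensor.
Context {R : realType} {H : hilbertType R}.
Local Notation C := R[i].

Lemma tdotDl d (u v w : {ffun 'I_d -> H}) : tdot (u + v) w = tdot u w + tdot v w.
Proof. by rewrite /tdot -big_split; apply: eq_bigr => i _; rewrite ffunE linearDl. Qed.

Lemma tdotZl d a (u w : {ffun 'I_d -> H}) : tdot (a *: u) w = a * tdot u w.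
Proof. by rewrite /tdot mulr_sumr; apply: eq_bigr => i _; rewrite ffunE linearZl_LR. Qed.

Lemma tdotDr d (u v w : {ffun 'I_d -> H}) : tdot w (u + v) = tdot w u + tdot w v.
Proof. by rewrite /tdot -big_split; apply: eq_bigr => i _; rewrite ffunE linearDr. Qed.

Lemma tdotZr d a (u w : {ffun 'I_d -> H}) : tdot w (a *: u) = a^* * tdot w u.
Proof. by rewrite /tdot mulr_sumr; apply: eq_bigr => i _; rewrite ffunE linearZr_LR. Qed.

Lemma tdotBl d (u v w : {ffun 'I_d -> H}) : tdot (u - v) w = tdot u w - tdot v w.
Proof. by rewrite tdotDl -scaleN1r tdotZl mulN1r. Qed.

Lemma tdotBr d (u v w : {ffun 'I_d -> H}) : tdot w (u - v) = tdot w u - tdot w v.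
Proof. by rewrite tdotDr -scaleN1r tdotZr rmorphN1 mulN1r. Qed.

Lemma ampl_linear m d (M : 'M[C]_(m, d)) : linear (@ampl R H m d M).
Proof.
move=> a u v; apply/ffunP => i; rewrite !ffunE scaler_sumr -big_split.
by apply: eq_bigr => j _; rewrite !ffunE scalerDr !scalerA mulrC.
Qed.
HB.instance Definition _ m d (M : 'M[C]_(m, d)) :=
  GRing.isLinear.Build C _ _ _ (@ampl R H m d M) (ampl_linear M).

Lemma tdot_ampl m d (M : 'M[C]_(m, d)) (u : {ffun 'I_m -> H}) (v : {ffun 'I_d -> H}) :
  tdot (ampl (M^t*) u) v = tdot u (ampl M v).
Proof.
rewrite /tdot; under eq_bigr => i _.
  rewrite ffunE linear_sumlz; under eq_bigr => j _ do rewrite linearZl_LR /= !mxE.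
  over.
rewrite exchange_big; apply: eq_bigr => j _; rewrite ffunE linear_sumr.
by apply: eq_bigr => i _; rewrite linearZr_LR.
Qed.

Lemma hadj_linear m k (T : 'cV[C]_m -> {ffun 'I_k -> H}) : linear (hadj T).
Proof. by move=> a u v; apply/colP => i; rewrite !mxE tdotDl tdotZl. Qed.
HB.instance Definition _ m k (T : 'cV[C]_m -> {ffun 'I_k -> H}) :=
  GRing.isLinear.Build C _ _ _ (hadj T) (hadj_linear T).

(** Polarization: the defect [b] is sesquilinear and vanishes on the diagonal. Testing [u + v] gives
    [b u v = - b v u], and replacing [v] by ['i *: v] gives [b u v = b v u]. *)
Lemma isometry_dot m d (V : {linear 'cV[C]_m -> {ffun 'I_d -> H}}) u v :
  isometry_op V -> tdot (V u) (V v) = cdot u v.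
Proof.
move=> V1.
pose b u v := tdot (V u) (V v) - cdot u v.
have b0 w : b w w = 0 by rewrite /b V1 subrr.
have bD x y z : b (x + y) z = b x z + b y z.
  by rewrite /b linearD tdotDl cdotDl; ring.
have bD' x y z : b z (x + y) = b z x + b z y.
  by rewrite /b linearD tdotDr cdotDr; ring.
have bZ a x y : b (a *: x) y = a * b x y.
  by rewrite /b linearZ tdotZl cdotZl; ring.
have bZ' a x y : b x (a *: y) = a^* * b x y.
  by rewrite /b linearZ tdotZr cdotZr; ring.
have h1 x y : b x y + b y x = 0.
  by have := b0 (x + y); rewrite bD !bD' !b0 add0r addr0.
have h2 := h1 u ('i *: v); rewrite bZ bZ' conjCi mulNr addrC -mulrBr in h2.
have /eqP := h2; rewrite mulf_eq0 (negbTE (neq0Ci _)) /= subr_eq0 => /eqP h3.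
have := h1 u v; rewrite h3.
move=> /eqP; rewrite -mulr2n mulrn_eq0 /= => /eqP; rewrite /b => /eqP.
by rewrite subr_eq0 => /eqP.
Qed.

End HilbertTensor.

(** * From a realization to the formal identities *)

Section Realization.
Context {R : realType} {g d e : nat} {H : hilbertType R}.
Local Notation C := R[i].
Variables (A : @mxtuple R g d) (G : word g -> 'M[C]_e).
Variables (U : {linear {ffun 'I_d -> H} -> {ffun 'I_d -> H}})
  (V : {linear 'cV[C]_e -> {ffun 'I_d -> H}}).
Hypotheses (U_unitary : unitary_op U) (V_isometry : isometry_op V).

Definition ramp (j : 'I_g) (u : {ffun 'I_d -> H}) : {ffun 'I_d -> H} :=
  U (ampl (A j) u) - ampl (A j) u.

Lemma ramp_linear j : linear (ramp j).
Proof. by move=> a u v; rewrite /ramp (linearP (ampl (A j))) (linearP U) scalerBr opprD addrACA. Qed.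

Lemma opword_linear w : linear (opword ramp w).
Proof. by elim: w => [|j w IH] a u v //=; rewrite IH ramp_linear. Qed.

Lemma opwordV_linear w : linear (fun v => opword ramp w (V v)).
Proof. by move=> a u v; rewrite linearP opword_linear. Qed.

Hypothesis G_coef : forall j w v,
  G (j :: w) *m v = hadj V (U (ampl (A j) (opword ramp w (V v)))).

Variable W : word g -> {linear 'cV[C]_e -> {ffun 'I_d -> H}}.
Hypothesis WE : forall w v, W w v = opword ramp w (V v).

Lemma W_nil v : W [::] v = V v.
Proof. by rewrite WE. Qed.

Lemma W_cons j w v : W (j :: w) v = U (ampl (A j) (W w v)) - ampl (A j) (W w v).
Proof. by rewrite !WE. Qed.

(** With [a = A_j W_alpha v] and [b = A_k W_beta x], the three terms pair to [<Ua - a, b> + <a, Ub -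
    b> + <Ua - a, Ub - b>], which is [<Ua, Ub> - <a, b> = 0]. *)
Lemma realization_formal_identity : formal_identity A G (fun w => W w : _ -> _).
Proof.
have [U1 _] := U_unitary.
have nondeg (u : 'cV[C]_e) : (forall x, cdot u x = 0) -> u = 0.
  by move=> /(_ u) /cdot_eq0.
split=> [a b j k v|w k v|v].
- apply: nondeg => x; rewrite !cdotDl !hadjP tdot_ampl !W_cons.
  rewrite !tdotBl !tdotBr U1; ring.
- rewrite G_coef -WE W_cons addrC subrK.
  by congr (\col_i _); apply/funext => i; rewrite W_nil.
- apply/eqP; rewrite -subr_eq0; apply/eqP/nondeg => x.
  by rewrite cdotBl hadjP !W_nil isometry_dot// subrr.
Qed.

Lemma realization_series : G [::] = 0 -> (fun w v => G w *m v) =2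
  ser_mul (ser_const (hadj V))
    (ser_mul (ser_const U) (ser_mul (ser_linear (fun j u => ampl (A j) u)) (fun w => W w : _ -> _))).
Proof.
move=> G0 w v; rewrite !ser_mul_constl ser_mul_linearl; case: w => [|j w].
  by rewrite G0 mul0mx !linear0.
by rewrite G_coef WE.
Qed.

End Realization.

(** * Evaluation on small spectral radius *)

Section SpectralRadius.
Context {R : realType}.
Local Notation C := R[i].

(** The limsup is the infimum of the tail suprema, so one of these is already below [tau]; raising
    to the power [size w] undoes the root. *)
Lemma spectral_radius_lt g n (X : @mxtuple R g n) (tau : R) : spectral_radius X < tau ->
  exists N0, forall w, (N0 <= size w)%N -> opnorm (mxword X w) <= tau ^+ size w.
Proof.
rewrite /spectral_radius; set u := fun N => _.
have u_ge0 N : 0 <= u N by exact: bigmax_ge_id.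
have leu (w : word g) : opnorm (mxword X w) `^ ((size w)%:R^-1) <= u (size w).
  exact: (le_bigmax _ (fun v : (size w).-tuple 'I_g => opnorm (mxword X v) `^ ((size w)%:R^-1)) (in_tuple w)).
have u_le N : u N <= Num.max 1 (tnorm X).
  apply: bigmax_le => [|w _]; first by rewrite le_max ler01.
  case: N w => [|N] w; first by rewrite invr0 powRr0 le_max lexx.
  rewrite le_max; apply/orP; right.
  have -> : tnorm X = (tnorm X ^+ N.+1) `^ (N.+1%:R^-1).
    by rewrite -powR_mulrn ?tnorm_ge0// -powRrM mulfV ?pnatr_eq0// powRr1 ?tnorm_ge0.
  apply: ge0_ler_powR; rewrite ?nnegrE ?invr_ge0 ?opnorm_ge0 ?exprn_ge0 ?tnorm_ge0//.
  by have := opnorm_mxword X w; rewrite size_tuple.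
have u_bounded : bounded_fun u.
  exists (Num.max 1 (tnorm X)); split; first exact: num_real.
  by move=> M hM N _ /=; rewrite ger0_norm// (le_trans (u_le N))// ltW.
rewrite limn_supE// => h.
have [|_ [m _ <-] um] := inf_lt _ h.
  by exists (sups u 0%N), 0%N.
(* The successor keeps [w] nonempty: at length 0 the exponent is 0 and the root cannot be undone. *)
exists m.+1 => w mw.
have uw : u (size w) <= sups u m.
  apply: ub_le_sup; last by exists (size w) => //=; exact: ltnW.
  by exists (Num.max 1 (tnorm X)) => _ [k _ <-].
have w0 : (0 < size w)%N by exact: leq_ltn_trans mw.
have opw : opnorm (mxword X w) = (opnorm (mxword X w) `^ ((size w)%:R^-1)) ^+ size w.
  by rewrite -powR_mulrn ?powR_ge0// -powRrM mulVf ?powRr1 ?opnorm_ge0// pnatr_eq0 -lt0n.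
rewrite opw; apply: lerXn2r; rewrite ?nnegrE ?powR_ge0//.
  by apply: le_trans (ltW um); apply: le_trans uw.
by apply: le_trans (leu w) _; apply: le_trans uw _; exact: ltW um.
Qed.

End SpectralRadius.

(** * Slices of tensors along [C^n] *)

Section Slices.
Context {R : realType} {H : hilbertType R} {n : nat}.
Local Notation C := R[i].

(** [X] mixes the slices along [C^n] with scalar weights, while the amplified [A_j], [U] and [V] act
    inside each slice. *)
Definition hslice {d} (a : 'I_n) (u : {ffun 'I_(d * n) -> H}) : {ffun 'I_d -> H} :=
  [ffun i => u (mxtens_index (i, a))].

Definition vslice {e} (a : 'I_n) (v : 'cV[C]_(e * n)) : 'cV[C]_e :=
  \col_b v (mxtens_index (b, a)) 0.

Lemma hslice_linear d a : linear (@hslice d a).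
Proof. by move=> c u v; apply/ffunP => i; rewrite !ffunE. Qed.
HB.instance Definition _ d a := GRing.isLinear.Build C _ _ _ (@hslice d a) (hslice_linear a).

Lemma vslice_linear e a : linear (@vslice e a).
Proof. by move=> c u v; apply/colP => i; rewrite !mxE. Qed.
HB.instance Definition _ e a := GRing.isLinear.Build C _ _ _ (@vslice e a) (vslice_linear a).

Lemma hslice_inj d (u v : {ffun 'I_(d * n) -> H}) :
  (forall a, hslice a u = hslice a v) -> u = v.
Proof.
move=> uv; apply/ffunP => k; case: (mxtens_indexP k) => i a.
by have /ffunP/(_ i) := uv a; rewrite !ffunE.
Qed.

Lemma tdot_hslice d (u v : {ffun 'I_(d * n) -> H}) :
  tdot u v = \sum_a tdot (hslice a u) (hslice a v).
Proof.
rewrite /tdot sum_mxtens exchange_big; apply: eq_bigr => a _.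
by apply: eq_bigr => i _; rewrite !ffunE.
Qed.

Lemma cdot_vslice e (u v : 'cV[C]_(e * n)) :
  cdot u v = \sum_a cdot (vslice a u) (vslice a v).
Proof.
rewrite /cdot sum_mxtens exchange_big; apply: eq_bigr => a _.
by apply: eq_bigr => i _; rewrite !mxE.
Qed.

Lemma hslice_ampl d (A : 'M[C]_d) (X : 'M[C]_n) u a :
  hslice a (ampl (A *t X) u) = \sum_c X a c *: ampl A (hslice c u).
Proof.
apply/ffunP => i; rewrite sum_ffunE !ffunE sum_mxtens exchange_big.
apply: eq_bigr => c _; rewrite !ffunE scaler_sumr; apply: eq_bigr => j _.
by rewrite tensmxE !ffunE scalerA mulrC.
Qed.

Lemma vslice_tens e e' (A : 'M[C]_(e, e')) (X : 'M[C]_n) v a :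
  vslice a ((A *t X) *m v) = \sum_c X a c *: (A *m vslice c v).
Proof.
apply/colP => i; rewrite summxE !mxE sum_mxtens exchange_big.
apply: eq_bigr => c _; rewrite !mxE mulr_sumr; apply: eq_bigr => j _.
by rewrite tensmxE !mxE mulrCA mulrA.
Qed.

Lemma hslice_htens e d (T : 'cV[C]_e -> {ffun 'I_d -> H}) (X : 'M[C]_n) v a :
  hslice a (htens T X v) = \sum_c X a c *: T (vslice c v).
Proof.
apply/ffunP => i; rewrite sum_ffunE !ffunE; apply: eq_bigr => c _.
by rewrite ffunE mxtens_indexK.
Qed.

Lemma htens_linear e d (T : {linear 'cV[C]_e -> {ffun 'I_d -> H}}) (X : 'M[C]_n) :
  linear (htens T X).
Proof.
move=> c u v; apply: hslice_inj => a; rewrite [RHS]linearP /= !hslice_htens scaler_sumr -big_split.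
by apply: eq_bigr => j _; rewrite (linearP (vslice j)) (linearP T) scalerDr !scalerA mulrC.
Qed.

End Slices.

(** * Bounded operators and convergence on [H \otimes C^k] *)

Section OneNorm.
Context {R : realType} {H : hilbertType R}.
Local Notation C := R[i].

(** Equivalent to the Hilbert norm on a finite power of [H], and directly tied to the entrywise
    convergence used in [converges_op]. *)
Definition norm1 {k} (u : {ffun 'I_k -> H}) : C := \sum_i `|u i|.

Lemma norm1_ge0 k (u : {ffun 'I_k -> H}) : 0 <= norm1 u.
Proof. by apply: sumr_ge0. Qed.

Lemma norm1D k (u v : {ffun 'I_k -> H}) : norm1 (u + v) <= norm1 u + norm1 v.
Proof. by rewrite -big_split; apply: ler_sum => i _; rewrite ffunE ler_normD. Qed.

Lemma norm1Z k c (u : {ffun 'I_k -> H}) : norm1 (c *: u) = `|c| * norm1 u.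
Proof. by rewrite /norm1 mulr_sumr; apply: eq_bigr => i _; rewrite ffunE normrZ. Qed.

Lemma entry_le_norm1 k (u : {ffun 'I_k -> H}) i : `|u i| <= norm1 u.
Proof. by rewrite /norm1 (bigD1 i)//= lerDl sumr_ge0. Qed.

Lemma norm1_sum k (I : Type) (r : seq I) (P : pred I) (u : I -> {ffun 'I_k -> H}) :
  norm1 (\sum_(i <- r | P i) u i) <= \sum_(i <- r | P i) norm1 (u i).
Proof.
elim/big_rec2: _ => [|i y x _ h].
  by rewrite /norm1 big1// => i _; rewrite ffunE normr0.
by apply: le_trans (norm1D _ _) _; rewrite lerD2l.
Qed.

Lemma tdot_le_norm1 k (u : {ffun 'I_k -> H}) : tdot u u <= norm1 u ^+ 2.
Proof.
rewrite expr2 {2}/norm1 mulr_sumr; apply: ler_sum => i _.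
by rewrite hdotE expr2 ler_wpM2r// entry_le_norm1.
Qed.

Lemma tdot_cs k (u v : {ffun 'I_k -> H}) : `|tdot u v| <= norm1 u * norm1 v.
Proof.
rewrite -(@ler_pXn2r _ 2) ?nnegrE ?mulr_ge0 ?norm1_ge0//.
have lin a (x y z : {ffun 'I_k -> H}) : tdot (a *: x + y) z = a * tdot x z + tdot y z.
  by rewrite tdotDl tdotZl.
have sym (x y : {ffun 'I_k -> H}) : tdot x y = (tdot y x)^*.
  by rewrite /tdot rmorph_sum; apply: eq_bigr => i _; rewrite [LHS]hermC expr0 mul1r.
have ge0 (x : {ffun 'I_k -> H}) : 0 <= tdot x x.
  by apply: sumr_ge0 => i _; rewrite hdotE exprn_ge0.
apply: le_trans (PreHilbert.cauchy_schwarz lin sym ge0 u v) _.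
by rewrite exprMn; apply: ler_pM; rewrite ?tdot_le_norm1.
Qed.

Definition norm1_bounded {k l} (T : {ffun 'I_k -> H} -> {ffun 'I_l -> H}) : Prop :=
  exists2 K : R, 0 <= K & forall u, norm1 (T u) <= K%:C%C * norm1 u.

Lemma norm1_bounded_comp k l m (T : {ffun 'I_l -> H} -> {ffun 'I_m -> H})
    (S : {ffun 'I_k -> H} -> {ffun 'I_l -> H}) :
  norm1_bounded T -> norm1_bounded S -> norm1_bounded (fun u => T (S u)).
Proof.
move=> [K K0 hK] [L L0 hL]; exists (K * L) => [|u]; first exact: mulr_ge0.
by apply: le_trans (hK _) _; rewrite realcM -mulrA ler_wpM2l ?ler0c.
Qed.

Lemma norm1_boundedD k l (T S : {ffun 'I_k -> H} -> {ffun 'I_l -> H}) :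
  norm1_bounded T -> norm1_bounded S -> norm1_bounded (fun u => T u + S u).
Proof.
move=> [K K0 hK] [L L0 hL]; exists (K + L) => [|u]; first exact: addr_ge0.
by apply: le_trans (norm1D _ _) _; rewrite realcD mulrDl; apply: lerD.
Qed.

Lemma norm1_boundedN k l (T : {ffun 'I_k -> H} -> {ffun 'I_l -> H}) :
  norm1_bounded T -> norm1_bounded (fun u => - T u).
Proof. by move=> [K K0 hK]; exists K => // u; rewrite -scaleN1r norm1Z normrN1 mul1r. Qed.

Lemma norm1_bounded_sum k l (I : Type) (r : seq I) (T : I -> {ffun 'I_k -> H} -> {ffun 'I_l -> H}) :
  (forall i, norm1_bounded (T i)) -> norm1_bounded (fun u => \sum_(i <- r) T i u).
Proof.
move=> hT; elim: r => [|i r [K K0 hK]].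
  exists 0 => // u; rewrite big_nil mul0r /norm1 big1// => i _; by rewrite ffunE normr0.
have [L L0 hL] := hT i.
exists (L + K) => [|u]; first exact: addr_ge0.
rewrite big_cons; apply: le_trans (norm1D _ _) _; rewrite realcD mulrDl; exact: lerD.
Qed.

Lemma norm1_bounded_ampl k l (M : 'M[C]_(l, k)) : norm1_bounded (@ampl R H l k M).
Proof.
exists (\sum_i \sum_j complex.Re `|M i j|) => [|u].
  by apply: sumr_ge0 => i _; apply: sumr_ge0 => j _; rewrite -ler0c Re_normK.
rewrite rmorph_sum mulr_suml; apply: ler_sum => i _; rewrite ffunE.
apply: le_trans (ler_norm_sum _ _ _) _.
rewrite rmorph_sum mulr_suml; apply: ler_sum => j _.
by rewrite normrZ /= Re_normK ler_wpM2l// entry_le_norm1.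
Qed.

Lemma norm1_bounded_unitary k (U : {ffun 'I_k -> H} -> {ffun 'I_k -> H}) :
  unitary_op U -> norm1_bounded U.
Proof.
(* Each of the k entries of [U u] is bounded by the Hilbert norm of [u], which is at most
   [norm1 u]. *)
move=> [U1 _]; exists k%:R => // u.
rewrite rmorph_nat mulr_natl -[X in _ *+ X]card_ord -sumr_const; apply: ler_sum => i _.
rewrite -(@ler_pXn2r _ 2) ?nnegrE ?norm1_ge0//.
apply: le_trans (tdot_le_norm1 u); rewrite -U1 -hdotE /tdot (bigD1 i)//= lerDl.
by apply: sumr_ge0 => j _; rewrite hdotE exprn_ge0.
Qed.

Lemma norm1_bounded_hslice n d (a : 'I_n) : norm1_bounded (@hslice R H n d a).
Proof.
exists 1 => // u; rewrite mul1r /norm1 [leRHS]sum_mxtens; apply: ler_sum => i _.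
by rewrite ffunE (bigD1 a)//= lerDl sumr_ge0.
Qed.

Definition cvgs {k} (x : nat -> {ffun 'I_k -> H}) (l : {ffun 'I_k -> H}) : Prop :=
  forall i, (fun N => x N i) @ \oo --> l i.

Lemma cvgs_norm1 k (x : nat -> {ffun 'I_k -> H}) l (eps : C) : cvgs x l -> 0 < eps ->
  \forall N \near \oo, norm1 (l - x N) < eps.
Proof.
move=> xl e0; pose del := eps / k.+1%:R.
have d0 : 0 < del by rewrite divr_gt0// ltr0n.
have near_i i : \forall N \near \oo, `|l i - x N i| < del.
  by have /cvgrPdist_lt := xl i; apply.
have : \forall N \near \oo, forall i, `|l i - x N i| < del by apply: filter_forall near_i.
apply: filterS => N h; apply: le_lt_trans (_ : \sum_(i < k) del < eps).
  by apply: ler_sum => i _; rewrite !ffunE ltW.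
rewrite sumr_const card_ord -mulr_natr /del -mulrA gtr_pMr//.
by rewrite mulrC ltr_pdivrMr ?ltr0n// mul1r ltr_nat.
Qed.

Lemma cvgs_bounded k l (T : {linear {ffun 'I_k -> H} -> {ffun 'I_l -> H}}) x y :
  norm1_bounded T -> cvgs x y -> cvgs (fun N => T (x N)) (T y).
Proof.
move=> [K K0 hK] xy i; apply/cvgrPdist_lt => eps e0.
have K1 : 0 < (K + 1)%:C%C :> C by rewrite ltcR ltr_wpDl.
have := cvgs_norm1 xy (divr_gt0 e0 K1); apply: filterS => N h.
have -> : T y i - T (x N) i = T (y - x N) i by rewrite linearB !ffunE.
apply: le_lt_trans (entry_le_norm1 _ _) _; apply: le_lt_trans (hK _) _.
apply: le_lt_trans (_ : (K + 1)%:C%C * norm1 (y - x N) < _).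
  by apply: ler_wpM2r; rewrite ?norm1_ge0// lecR lerDl.
by rewrite mulrC -ltr_pdivlMr.
Qed.

Lemma cvg_tdot k (x : nat -> {ffun 'I_k -> H}) l z : cvgs x l ->
  ((fun N => tdot (x N) z) : nat -> C^o) @ \oo --> (tdot l z : C^o).
Proof.
move=> xl; apply/cvgrPdist_lt => eps e0.
have z1 : 0 < norm1 z + 1 by rewrite ltr_wpDl ?norm1_ge0.
have := cvgs_norm1 xl (divr_gt0 e0 z1); apply: filterS => N h.
rewrite -tdotBl; apply: le_lt_trans (tdot_cs _ _) _.
apply: le_lt_trans (_ : norm1 (l - x N) * (norm1 z + 1) < _).
  by apply: ler_wpM2l; rewrite ?norm1_ge0// lerDl.
by rewrite -ltr_pdivlMr.
Qed.

Lemma cvgs_unique k (x : nat -> {ffun 'I_k -> H}) l l' : cvgs x l -> cvgs x l' -> l = l'.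
Proof. by move=> xl xl'; apply/ffunP => i; apply: cvg_unique (xl i) (xl' i). Qed.

Lemma cvgsD k (x y : nat -> {ffun 'I_k -> H}) l m :
  cvgs x l -> cvgs y m -> cvgs (fun N => x N + y N) (l + m).
Proof.
move=> xl ym i; rewrite ffunE.
by under eq_fun do rewrite ffunE; apply: cvgD (xl i) (ym i).
Qed.

Lemma cvgsZ k (x : nat -> {ffun 'I_k -> H}) l c :
  cvgs x l -> cvgs (fun N => c *: x N) (c *: l).
Proof.
move=> xl i; rewrite ffunE.
by under eq_fun do rewrite ffunE; apply: cvgZl_tmp (xl i).
Qed.

Lemma cvgs_cst k (l : {ffun 'I_k -> H}) : cvgs (fun=> l) l.
Proof. by move=> i; exact: cvg_cst. Qed.

Lemma cvgs_shift k (x : nat -> {ffun 'I_k -> H}) l : cvgs x l -> cvgs (fun N => x N.+1) l.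
Proof. by move=> xl i; have := xl i; rewrite -(cvg_shiftS (fun N => x N i)). Qed.

End OneNorm.

Lemma sum_tupleS g k (V : nmodType) (F : word g -> V) :
  \sum_(w : k.+1.-tuple 'I_g) F w = \sum_j \sum_(w : k.-tuple 'I_g) F (j :: w).
Proof.
rewrite pair_big /= (reindex (fun q : 'I_g * k.-tuple 'I_g => [tuple of q.1 :: q.2])) //=.
exists (fun w : k.+1.-tuple 'I_g => (thead w, [tuple of behead w])) => [[j w] _|w _] /=.
  by congr pair; apply: val_inj.
by case/tupleP: w => j w; apply: val_inj.
Qed.

(** * Limits of the partial sums and the identity at a point *)

Section Evaluation.
Context {R : realType} {g d e : nat} {H : hilbertType R}.
Local Notation C := R[i].
Variables (A : @mxtuple R g d) (G : word g -> 'M[C]_e).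
Variables (U : {linear {ffun 'I_d -> H} -> {ffun 'I_d -> H}})
  (V : {linear 'cV[C]_e -> {ffun 'I_d -> H}}).
Hypotheses (U_unitary : unitary_op U) (V_isometry : isometry_op V).
Variable W : word g -> {linear 'cV[C]_e -> {ffun 'I_d -> H}}.
Hypothesis W_nil : forall v, W [::] v = V v.
Hypothesis W_cons : forall j w v,
  W (j :: w) v = U (ampl (A j) (W w v)) - ampl (A j) (W w v).
Hypothesis G_nil : G [::] = 0.
Hypothesis G_cons : forall j w v,
  G (j :: w) *m v = hadj V (U (ampl (A j) (W w v))).

(** [kappa] is the sum of bounds for the operators [R_j], so one constant serves every letter of a
    word. *)
Lemma norm1_W_bound : exists2 kappa : R, 0 <= kappa &
  forall w v, norm1 (W w v) <= (kappa ^+ size w)%:C%C * norm1 (V v).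
Proof.
have bT j : norm1_bounded (fun u => U (ampl (A j) u) - ampl (A j) u).
  apply: norm1_boundedD; last exact/norm1_boundedN/norm1_bounded_ampl.
  apply: norm1_bounded_comp; [exact: norm1_bounded_unitary | exact: norm1_bounded_ampl].
have /choice[K hK] : forall j, exists K : R, 0 <= K /\
    forall u, norm1 (U (ampl (A j) u) - ampl (A j) u) <= K%:C%C * norm1 u.
  by move=> j; have [K K0 hK] := bT j; exists K.
have K0 j : 0 <= K j by have [] := hK j.
exists (\sum_j K j) => [|w v]; first exact: sumr_ge0.
elim: w => [|j w IH]; first by rewrite W_nil mul1r.
rewrite W_cons; have [_ /(_ (W w v)) h] := hK j; apply: le_trans h _.
rewrite /= exprS realcM -mulrA; apply: ler_pM; rewrite ?ler0c ?norm1_ge0// lecR.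
by rewrite (bigD1 j)//= lerDl sumr_ge0.
Qed.

Variables (n : nat) (X : @mxtuple R g n).

Definition pencil_op (u : {ffun 'I_(d * n) -> H}) : {ffun 'I_(d * n) -> H} :=
  \sum_j ampl (A j *t X j) u.

Lemma pencil_op_linear : linear pencil_op.
Proof.
move=> c u v; rewrite /pencil_op scaler_sumr -big_split; apply: eq_bigr => j _.
exact: linearP.
Qed.
HB.instance Definition _ := GRing.isLinear.Build C _ _ _ pencil_op pencil_op_linear.

Definition partial (N : nat) (v : 'cV[C]_(e * n)) : {ffun 'I_(d * n) -> H} :=
  \sum_(k < N) \sum_(w : k.-tuple 'I_g) htens (W w) (mxword X w) v.

Lemma pencil_op_partial a N v : hslice a (pencil_op (partial N v)) =
  \sum_(k < N) \sum_j \sum_(w : k.-tuple 'I_g) \sum_b mxword X (j :: w) a b *: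
    ampl (A j) (W w (vslice b v)).
Proof.
rewrite linear_sum exchange_big; apply: eq_bigr => j _ /=.
rewrite !linear_sum; apply: eq_bigr => k _ /=.
rewrite !linear_sum; apply: eq_bigr => w _ /=.
rewrite hslice_ampl.
under [LHS]eq_bigr => c _ do rewrite hslice_htens linear_sum scaler_sumr.
rewrite exchange_big; apply: eq_bigr => b _ /=.
rewrite mxword_cons mxE scaler_suml; apply: eq_bigr => c _.
by rewrite linearZ scalerA.
Qed.

(** Splitting off the first letter gives, for partial sums, the fixed-point equation of [W(X)]: it
    is [V] plus [U - 1] applied to the pencil of [A] at [X] times [W(X)]. *)
Lemma partialS a N v : hslice a (partial N.+1 v) =
  V (vslice a v) + U (hslice a (pencil_op (partial N v))) - hslice a (pencil_op (partial N v)).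
Proof.
rewrite /partial big_ord_recl sum_tuple0 linearD /= hslice_htens mxword_nil.
rewrite (bigD1 a)//= mxE eqxx scale1r W_nil big1 ?addr0 => [|c ca]; last first.
  by rewrite mxE eq_sym (negbTE ca) scale0r.
rewrite -addrA; congr (_ + _); rewrite -/(partial N v) pencil_op_partial.
rewrite [LHS]linear_sum (linear_sum U) -sumrB; apply: eq_bigr => k _ /=.
rewrite (sum_tupleS _ (fun w => htens (W w) (mxword X w) v)).
rewrite [LHS]linear_sum (linear_sum U) -sumrB; apply: eq_bigr => j _ /=.
rewrite [LHS]linear_sum (linear_sum U) -sumrB; apply: eq_bigr => w _ /=.
rewrite hslice_htens (linear_sum U) -sumrB; apply: eq_bigr => b _ /=.
by rewrite W_cons linearZ scalerBr.
Qed.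

Definition eval_partial (N : nat) : 'M[C]_(e * n) :=
  \sum_(k < N) \sum_(w : k.-tuple 'I_g) G w *t mxword X w.

Lemma eval_partialS a N v : vslice a (eval_partial N.+1 *m v) =
  hadj V (U (hslice a (pencil_op (partial N v)))).
Proof.
rewrite /eval_partial big_ord_recl sum_tuple0 G_nil tens0mx add0r.
rewrite mulmx_suml linear_sum pencil_op_partial !linear_sum; apply: eq_bigr => k _ /=.
rewrite (sum_tupleS _ (fun w => G w *t mxword X w)).
rewrite mulmx_suml !linear_sum; apply: eq_bigr => j _ /=.
rewrite mulmx_suml !linear_sum; apply: eq_bigr => w _ /=.
rewrite vslice_tens !linear_sum; apply: eq_bigr => b _ /=.
by rewrite G_cons !linearZ.
Qed.

Lemma partial_linear N : linear (partial N).
Proof.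
move=> c u v; rewrite /partial scaler_sumr -big_split; apply: eq_bigr => k _.
rewrite scaler_sumr -big_split; apply: eq_bigr => w _; exact: htens_linear.
Qed.

Lemma norm_htens (T : 'cV[C]_e -> {ffun 'I_d -> H}) (M : 'M[C]_n) v i :
  `|htens T M v i| <= (opnorm M)%:C%C * \sum_c norm1 (T (vslice c v)).
Proof.
case: (mxtens_indexP i) => j a.
have -> : htens T M v (mxtens_index (j, a)) = hslice a (htens T M v) j by rewrite [RHS]ffunE.
apply: le_trans (entry_le_norm1 _ _) _; rewrite hslice_htens.
apply: le_trans (norm1_sum _ _ _) _; rewrite mulr_sumr; apply: ler_sum => c _.
by rewrite norm1Z ler_wpM2r ?norm1_ge0// entry_le_opnorm.
Qed.

(** There are [g ^ k] words of length k, each contributing at most a multiple of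
    [kappa ^+ k * tau ^+ k]; so the degree k parts are dominated by a geometric series. *)
Lemma partial_cvg (kappa tau : R) (N0 : nat) : 0 <= kappa -> 0 <= tau ->
  g%:R * kappa * tau < 1 ->
  (forall w v, norm1 (W w v) <= (kappa ^+ size w)%:C%C * norm1 (V v)) ->
  (forall w, (N0 <= size w)%N -> opnorm (mxword X w) <= tau ^+ size w) ->
  exists WX : {linear 'cV[C]_(e * n) -> {ffun 'I_(d * n) -> H}},
    forall v, cvgs (fun N => partial N v) (WX v).
Proof.
move=> kappa0 tau0 q1 hW hX.
have q0 : 0 <= g%:R * kappa * tau by rewrite !mulr_ge0.
have lim v i : exists l : H, (fun N => partial N v i) @ \oo --> l.
  pose Kv : C := \sum_c norm1 (V (vslice c v)).
  have Kv0 : 0 <= Kv by apply: sumr_ge0 => c _; exact: norm1_ge0.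
  have KvE : Kv = (complex.Re Kv)%:C%C by rewrite RRe_real// ger0_real.
  pose s k := (\sum_(w : k.-tuple 'I_g) htens (W w) (mxword X w) v) i.
  have -> : (fun N => partial N v i) = (fun N => \sum_(k < N) s k).
    by apply/funext => N; rewrite /partial sum_ffunE.
  apply: (geometric_series_cvg (K := complex.Re Kv) (q := g%:R * kappa * tau) (N0 := N0)) =>//.
    by rewrite -ler0c -KvE.
  move=> k N0k; rewrite /s sum_ffunE; apply: le_trans (ler_norm_sum _ _ _) _.
  rewrite realcM -KvE mulrC.
  have -> : ((g%:R * kappa * tau) ^+ k)%:C%C * Kv =
      \sum_(w : k.-tuple 'I_g) ((tau ^+ k)%:C%C * ((kappa ^+ k)%:C%C * Kv)).
    rewrite sumr_const card_tuple card_ord.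
    have -> : (g%:R * kappa * tau) ^+ k = (g ^ k)%:R * (tau ^+ k * kappa ^+ k).
      by rewrite natrX !exprMn; ring.
    rewrite -[RHS]mulr_natl; move: (tau ^+ k) (kappa ^+ k) => x y.
    by rewrite [in LHS]realcM [in LHS]realcM rmorph_nat !mulrA.
  apply: ler_sum => w _; apply: le_trans (norm_htens _ _ _ _) _.
  apply: ler_pM; rewrite ?ler0c ?opnorm_ge0//.
  - by apply: sumr_ge0 => c _; exact: norm1_ge0.
  - by rewrite lecR; have := hX w; rewrite size_tuple; apply.
  - rewrite mulr_sumr; apply: ler_sum => c _.
    by have := hW w (vslice c v); rewrite size_tuple.
have /choice[WX hWX] : forall v, exists l, cvgs (fun N => partial N v) l.
  by move=> v; have /choice[l hl] := lim v; exists (finfun l) => i; rewrite ffunE.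
have WX_linear : linear WX.
  move=> c u v; apply: cvgs_unique (hWX _) _.
  have -> : (fun N => partial N (c *: u + v)) = (fun N => c *: partial N u + partial N v).
    by apply/funext => N; exact: partial_linear.
  by apply: cvgsD (hWX v); exact: cvgsZ.
exists (HB.pack_for {linear 'cV[C]_(e * n) -> {ffun 'I_(d * n) -> H}} WX
  (GRing.isLinear.Build _ _ _ _ WX WX_linear)).
exact: hWX.
Qed.

Lemma norm1_bounded_pencil_op : norm1_bounded pencil_op.
Proof. by apply: norm1_bounded_sum => j; exact: norm1_bounded_ampl. Qed.

Lemma ampl_pencilE u v : tdot (ampl_pencil A X u) v =
  tdot u v + tdot (pencil_op u) v + tdot u (pencil_op v).
Proof.
rewrite /ampl_pencil !tdotDl; congr (_ + _ + _).
have suml (F : 'I_g -> {ffun 'I_(d * n) -> H}) : tdot (\sum_j F j) v = \sum_j tdot (F j) v.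
  elim/big_rec2: _ => [|j y x _ <-]; last by rewrite tdotDl.
  by rewrite -[0](scale0r 0) tdotZl mul0r.
have sumr (F : 'I_g -> {ffun 'I_(d * n) -> H}) : tdot u (\sum_j F j) = \sum_j tdot u (F j).
  elim/big_rec2: _ => [|j y x _ <-]; last by rewrite tdotDr.
  by rewrite -[0](scale0r 0) tdotZr conjC0 mul0r.
rewrite suml sumr; apply: eq_bigr => j _.
by rewrite -tdot_ampl adjmx_tens.
Qed.

Section Limit.
Variable WX : {linear 'cV[C]_(e * n) -> {ffun 'I_(d * n) -> H}}.
Hypothesis partial_WX : forall v, cvgs (fun N => partial N v) (WX v).

Let h a v : {ffun 'I_d -> H} := hslice a (pencil_op (WX v)).

Lemma cvgs_h a v : cvgs (fun N => hslice a (pencil_op (partial N v))) (h a v).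
Proof.
apply: (cvgs_bounded (T := hslice a)); first exact: norm1_bounded_hslice.
apply: (cvgs_bounded (T := pencil_op)); first exact: norm1_bounded_pencil_op.
exact: partial_WX.
Qed.

Lemma cvgs_Uh a v : cvgs (fun N => U (hslice a (pencil_op (partial N v)))) (U (h a v)).
Proof. by apply: (cvgs_bounded (T := U)); [exact: norm1_bounded_unitary|exact: cvgs_h]. Qed.

Lemma hslice_WX a v : hslice a (WX v) = V (vslice a v) + U (h a v) - h a v.
Proof.
have left : cvgs (fun N => hslice a (partial N.+1 v)) (hslice a (WX v)).
  apply: (cvgs_shift (x := fun N => hslice a (partial N v))).
  by apply: (cvgs_bounded (T := hslice a)); [exact: norm1_bounded_hslice|exact: partial_WX].
apply: cvgs_unique left _.
have -> : (fun N => hslice a (partial N.+1 v)) = (fun N => V (vslice a v) +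
    U (hslice a (pencil_op (partial N v))) + (-1) *: hslice a (pencil_op (partial N v))).
  by apply/funext => N; rewrite partialS scaleN1r.
rewrite -[- h a v]scaleN1r; apply: cvgsD; last by apply: cvgsZ; exact: cvgs_h.
by apply: cvgsD; [exact: cvgs_cst|exact: cvgs_Uh].
Qed.

(** The matrix of the operator whose slice a is [hadj V (U (h a v))], the limit of the right side of
    [eval_partialS]. *)
Definition eval_limit : 'M[C]_(e * n) := \matrix_(k, x)
  tdot (U (h (mxtens_unindex k).2 (delta_mx x 0))) (V (delta_mx (mxtens_unindex k).1 0)).

Lemma vslice_eval_limit a v : vslice a (eval_limit *m v) = hadj V (U (h a v)).
Proof.
pose F v := hadj V (U (h a v)).
have F_linear : linear F.
  by move=> c u w; rewrite /F /h (linearP WX) (linearP pencil_op) (linearP (hslice a)) (linearP U) linearP.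
pose L := HB.pack_for {linear 'cV[C]_(e * n) -> 'cV[C]_e} F (GRing.isLinear.Build _ _ _ _ F F_linear).
have LE w : L w = F w by [].
rewrite -/(F v) -LE; clearbody L.
have {2}-> : v = \sum_x v x 0 *: delta_mx x 0.
  by rewrite [LHS]matrix_sum_delta; apply: eq_bigr => x _; rewrite big_ord1.
rewrite linear_sum; apply/colP => b; rewrite summxE mxE mxE; apply: eq_bigr => x _.
by rewrite linearZ LE !mxE mxtens_indexK mulrC.
Qed.

Lemma converges_eval_limit : converges_mx G X eval_limit.
Proof.
apply: cvg_mx_entries => k x; case: (mxtens_indexP k) => b a.
suff : ((fun N => eval_partial N.+1 (mxtens_index (b, a)) x) : nat -> C^o) @ \oo -->
    (eval_limit (mxtens_index (b, a)) x : C^o).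
  by rewrite (cvg_shiftS (fun N => eval_partial N (mxtens_index (b, a)) x : C^o)).
have -> : eval_limit (mxtens_index (b, a)) x = tdot (U (h a (delta_mx x 0))) (V (delta_mx b 0)).
  by rewrite mxE mxtens_indexK.
have -> : (fun N => eval_partial N.+1 (mxtens_index (b, a)) x) =
    (fun N => tdot (U (hslice a (pencil_op (partial N (delta_mx x 0))))) (V (delta_mx b 0))).
  apply/funext => N.
  have := congr1 (fun u : 'cV[C]_e => u b 0) (eval_partialS a N (delta_mx x 0)).
  by rewrite -colE !mxE.
apply: cvg_tdot; exact: cvgs_Uh.
Qed.

(** Slice by slice [W = V + U h - h]. Inserted into the pencil form, all terms in [h] cancel by
    unitarity except the pairings of [U h] with [V], which are those of [G(X)] and its adjoint. *)
Lemma limit_identity v :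
  (1%:M + eval_limit + eval_limit^t*) *m v = hadj WX (ampl_pencil A X (WX v)).
Proof.
have [U1 _] := U_unitary.
apply/eqP; rewrite -subr_eq0; apply/eqP; set z := _ - _; apply: cdot_eq0.
suff test x : cdot z x = 0 by exact: test.
rewrite cdotBl hadjP ampl_pencilE !mulmxDl mul1mx !cdotDl [cdot (_^t* *m v) x]cdot_mulmxl trmxCK.
apply/eqP; rewrite subr_eq0; apply/eqP.
rewrite !cdot_vslice !tdot_hslice -!big_split; apply: eq_bigr => a _ /=.
rewrite !vslice_eval_limit hadjP [cdot _ (hadj V _)]cdot_sym hadjP.
have sym (u w : {ffun 'I_d -> H}) : (tdot u w)^* = tdot w u.
  by rewrite /tdot rmorph_sum; apply: eq_bigr => i _; rewrite [RHS]hermC expr0 mul1r.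
rewrite sym -/(h a v) -/(h a x) !hslice_WX !tdotBl !tdotBr !tdotDl !tdotDr U1 isometry_dot//.
ring.
Qed.

End Limit.

Lemma evaluation_identity (kappa tau : R) (N0 : nat) : 0 <= kappa -> 0 <= tau ->
  g%:R * kappa * tau < 1 ->
  (forall w v, norm1 (W w v) <= (kappa ^+ size w)%:C%C * norm1 (V v)) ->
  (forall w, (N0 <= size w)%N -> opnorm (mxword X w) <= tau ^+ size w) ->
  identity_at A G (fun w => W w : _ -> _) X.
Proof.
move=> kappa0 tau0 q1 hW hX.
have [WX hWX] := partial_cvg kappa0 tau0 q1 hW hX.
exists (eval_limit WX), WX; split.
- exact: converges_eval_limit.
- by move=> v i; exact: hWX.
- by move=> v; exact: limit_identity.
Qed.

End Evaluation.

(** * The theorem *)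

Lemma tensmx_sumr (R : realType) m n k l (I : Type) (r : seq I) (P : pred I)
    (M : 'M[R[i]]_(m, n)) (F : I -> 'M_(k, l)) :
  M *t (\sum_(i <- r | P i) F i) = \sum_(i <- r | P i) M *t F i.
Proof.
apply/matrixP => x y; rewrite mxE !summxE mulr_sumr.
by apply: eq_bigr => i _; rewrite mxE.
Qed.

Lemma linear_pencil_series (R : realType) g h e n (B : @mxtuple R h e) (pc : 'I_h -> word g -> R[i])
    (X : @mxtuple R g n) N :
  linear_pencil B (fun t => \sum_(k < N.+1) \sum_(w : k.-tuple 'I_g) pc t w *: mxword X w) =
  trunc_eval N (fun w => \sum_(t < h) pc t w *: B t) X.
Proof.
rewrite /linear_pencil /trunc_eval.
under eq_bigr => t _ do rewrite tensmx_sumr.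
rewrite exchange_big; apply: eq_bigr => k _ /=.
under eq_bigr => t _ do rewrite tensmx_sumr.
rewrite exchange_big; apply: eq_bigr => w _ /=.
apply/matrixP => i j; case: (mxtens_indexP i) => a b; case: (mxtens_indexP j) => a' b'.
rewrite summxE tensmxE summxE mulr_suml; apply: eq_bigr => t _.
by rewrite tensmxE !mxE mulrCA mulrA.
Qed.

Section Main.
Variables (R : realType) (g h d e : nat) (A : @mxtuple R g d).
Local Notation C := R[i].

Lemma realization_exists (G : word g -> 'M[C]_e) : (0 < d)%N ->
  free_bounded (free_spectrahedron A) -> G [::] = 0 ->
  (forall N n (X : mxtuple g n), free_spectrahedron A X ->
     (forall w, (N < size w)%N -> mxword X w = 0) ->
     psdmx (1%:M + trunc_eval N G X + (trunc_eval N G X)^t*)) ->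
  exists (H : hilbertType R) (U : {linear {ffun 'I_d -> H} -> {ffun 'I_d -> H}})
      (V : {linear 'cV[C]_e -> {ffun 'I_d -> H}}),
    [/\ unitary_op U, isometry_op V & forall j w v,
      G (j :: w) *m v = hadj V (U (ampl (A j) (opword (ramp A U) w (V v))))].
Proof.
move=> d_gt0 A_bounded G0 Gpos.
have real N := finite_realization d_gt0 A_bounded G0 (Gpos N).
have /choice[dim hdim] := real.
pose T N := sval (cid (hdim N)).
pose V N := sval (cid (svalP (cid (hdim N)))).
have hV N := svalP (cid (svalP (cid (hdim N)))); rewrite -/(T _) -/(V _) in hV.
apply: (@ultraproduct_realization _ _ _ _ A G dim T V).
- by move=> N; have [] := hV N.
- by move=> N; have [] := hV N.
- by move=> N; have [] := hV N.
- by move=> N j w wN; have [_ _ _] := hV N; apply.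
Qed.

End Main.

Theorem corollary1p10 (R : realType) (g h d e : nat) (d_gt0 : (0 < d)%N)
    (A : @mxtuple R g d) (B : @mxtuple R h e) (p : @graded_map R g h)
    (A_bounded : free_bounded (free_spectrahedron A))
    (p_maps : maps_into p (free_spectrahedron A) (free_spectrahedron B))
    (p0 : forall t : 'I_h, p 1%N (fun=> 0) t = 0)
    (p_class :
       (forall t : 'I_h, rational_on (free_spectrahedron A) (component p t))
       \/
       (exists (s r N : nat) (Q : word g -> 'M[R[i]]_(s, r)),
          [/\ free_subset (free_spectrahedron A) (pseudoconvex_set N Q),
              forall t : 'I_h,
                free_analytic (pseudoconvex_set N Q) (component p t)
            & bounded_on (pseudoconvex_set N Q) p])) :
  exists pc : 'I_h -> word g -> R[i],
    (forall t : 'I_h, power_series_at0 (component p t) (pc t)) /\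
    let G (w : word g) : 'M[R[i]]_e := \sum_(t < h) pc t w *: B t in
    exists (H : hilbertType R)
           (W : word g -> {linear 'cV[R[i]]_e -> {ffun 'I_d -> H}})
           (U : {linear {ffun 'I_d -> H} -> {ffun 'I_d -> H}})
           (V : {linear 'cV[R[i]]_e -> {ffun 'I_d -> H}}),
      let bA (j : 'I_g) (u : {ffun 'I_d -> H}) := ampl (A j) u in
      let Rop (j : 'I_g) (u : {ffun 'I_d -> H}) := U (bA j u) - bA j u in
      [/\ unitary_op U /\ isometry_op V,
          ser_pencil B pc =1 ser_hermitian G,
          formal_identity A G W,
          exists tau : R, 0 < tau /\
            forall (n : nat) (X : mxtuple g n),
              spectral_radius X < tau -> identity_at A G W X
        & [/\ (fun w v => G w *m v) =2
                ser_mul (ser_const (hadj V))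
                  (ser_mul (ser_const U) (ser_mul (ser_linear bA) W)),
              exists J : word g -> {linear {ffun 'I_d -> H} -> {ffun 'I_d -> H}},
                ser_inverse (ser_sub (ser_const id) (ser_linear Rop)) J /\
                (fun w v => W w v) =2 ser_mul J (ser_const V)
            & forall (j : 'I_g) (w : word g) (v : 'cV[R[i]]_e),
                G (j :: w) *m v = hadj V (U (bA j (opword Rop w (V v))))]].
Proof.
have series t : exists a : word g -> R[i], power_series_at0 (component p t) a /\
    forall N n (X : mxtuple g n), free_spectrahedron A X ->
      (forall w, (N < size w)%N -> mxword X w = 0) ->
      component p t X = \sum_(k < N.+1) \sum_(w : k.-tuple 'I_g) a w *: mxword X w.
  apply: bounded_near0_power_series; case: p_class => [p_rat|[s [r [N [Q [AQ p_an p_bd]]]]]].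
    exact: rational_bounded_near0.
  exact: pseudoconvex_bounded_near0 AQ (p_an t) p_bd.
have [pc hpc] := choice series; exists pc; split; first by move=> t; have [] := hpc t.
move=> G.
(* At the zero tuple of size 1 all nonempty words vanish, so the expansion of order 0 is the
   constant coefficient alone. *)
have G0 : G [::] = 0.
  rewrite /G big1// => t _; have [_ pct] := hpc t.
  have := pct 0%N 1%N (fun=> 0) (@free_spectrahedron0 _ _ _ A 1%N).
  rewrite big_ord1 sum_tuple0 mxword_nil /component p0 => pc0.
  have {pc0} : (0 : 'M[R[i]]_1) = pc t [::] *: 1%:M.
    by apply: pc0 => -[|j w]// _; rewrite mxword_cons mul0mx.
  by move=> /matrixP/(_ 0 0); rewrite !mxE eqxx mulr1 => <-; rewrite scale0r.
(* At such an [X] the series of [p] terminates and equals [p n X], so the matrix in question is the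
   pencil of [B] at a point of its spectrahedron. *)
have Gpos N n (X : mxtuple g n) : free_spectrahedron A X ->
    (forall w, (N < size w)%N -> mxword X w = 0) ->
    psdmx (1%:M + trunc_eval N G X + (trunc_eval N G X)^t*).
  move=> AX X_nil; have := p_maps n X AX.
  rewrite /free_spectrahedron /= monic_pencilE.
  have -> : p n X = fun t => \sum_(k < N.+1) \sum_(w : k.-tuple 'I_g) pc t w *: mxword X w.
    by apply/funext => t; have [_ pct] := hpc t; exact: pct.
  by rewrite linear_pencil_series.
have [H [U [V [U_unitary V_isometry G_coef]]]] := realization_exists d_gt0 A_bounded G0 Gpos.
pose W w := HB.pack_for {linear 'cV[R[i]]_e -> {ffun 'I_d -> H}} (fun v => opword (ramp A U) w (V v))
  (GRing.isLinear.Build _ _ _ _ (fun v => opword (ramp A U) w (V v)) (opwordV_linear A U V w)).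
have WE w v : W w v = opword (ramp A U) w (V v) by [].
clearbody W; exists H, W, U, V => bA Rop; split=>//.
- exact: ser_pencilE.
- exact: (realization_formal_identity U_unitary V_isometry G_coef WE).
- have W_nil v : W [::] v = V v by rewrite WE.
  have W_cons j w v : W (j :: w) v = U (ampl (A j) (W w v)) - ampl (A j) (W w v) by rewrite !WE.
  have [kappa kappa0 hW] := norm1_W_bound U_unitary W_nil W_cons.
  (* Then [g * kappa * tau < 1], the ratio needed in [partial_cvg]; the summand 1 covers
     [g * kappa = 0]. *)
  pose tau := (2%:R * (g%:R * kappa + 1))^-1 : R.
  have gk : 0 <= g%:R * kappa by rewrite mulr_ge0.
  have tau0 : 0 < tau by rewrite invr_gt0 mulr_gt0// ltr_wpDl.
  exists tau; split=> // n X /spectral_radius_lt[N0 hX].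
  apply: (evaluation_identity U_unitary V_isometry W_nil W_cons G0 _ kappa0 (ltW tau0) _ hW hX).
    by move=> j w v; rewrite G_coef WE.
  rewrite ltr_pdivrMr ?mulr_gt0 ?ltr_wpDl// mul1r.
  by move: gk; move: (g%:R * kappa) => x; lra.
split=> //; first exact: (realization_series G_coef WE G0).
pose J w := HB.pack_for {linear {ffun 'I_d -> H} -> {ffun 'I_d -> H}} (opword (ramp A U) w)
  (GRing.isLinear.Build _ _ _ _ (opword (ramp A U) w) (opword_linear A U w)).
have JE w : J w =1 opword (ramp A U) w by [].
clearbody J; exists J; split; first exact: (neumann_series (T := Rop)).
by move=> w v; rewrite ser_mul_constr; rewrite WE; rewrite -JE.
Qed.
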